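(* Let $X=(x_0,x_1)$ with $x_0<x_1$, let $\zeta:\mathbb{R}\to\mathbb{R}_{>0}$ be absolutely continuous with $\operatorname{supp}\zeta'\subset X$, and let $q=(\sqrt\zeta)''/\sqrt\zeta$. Then, for $\sigma\in\mathbb{R}\setminus\{0\}$, the $S$-matrix of the Schrödinger equation $-y''+qy=\sigma^2y$ is given by $$S(\sigma)=\mathrm{Sech}^X_\alpha(\sigma)\begin{pmatrix}1&e^{2i\sigma x_0}\,\mathrm{Sinh}^X_\alpha(\sigma)\\ -e^{-2i\sigma x_0}\,\overline{\mathrm{Sinh}^X_\alpha(\sigma)}&1\end{pmatrix},\qquad\text{where }\alpha=-\tfrac12(\log\zeta)'.$$
   Context: Interpretation of the Schrödinger equation. The change of variables $y=\sqrt\zeta\,u$ transforms $(\zeta u')'+\sigma^2\zeta u=0$ into $-y''+qy=\sigma^2y$ when $\zeta'$ is absolutely continuous. When $\zeta$ is only absolutely continuous, $y$ is understood to be a solution of $-y''+qy=\sigma^2 y$ if and only if $u=y/\sqrt\zeta$ is a solution of $(\zeta u')'+\sigma^2\zeta u=0$ on $\mathbb{R}$, meaning $u\in W^{1,2}_{\mathrm{loc}}(\mathbb{R})$ satisfies the latter in the sense of distributions (so $u$ and $\zeta u'$ are continuous). Note that $\zeta$ is constant on $(-\infty,x_0]$ and on $[x_1,\infty)$, so $q=0$ outside $X$. $S$-matrix. Let $f_1,f_2$ be the solutions of $-y''+qy=\sigma^2y$ determined by $f_1(x,\sigma)=e^{i\sigma x}$ for $x\ge x_1$ and $f_2(x,\sigma)=e^{-i\sigma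 x}$ for $x\le x_0$. The coefficients $T_1,T_2,R_1,R_2$ are defined by $$f_1(x,\sigma)=\frac{1}{T_2(\sigma)}e^{i\sigma x}+\frac{R_2(\sigma)}{T_2(\sigma)}e^{-i\sigma x}\quad(x\le x_0),\qquad f_2(x,\sigma)=\frac{R_1(\sigma)}{T_1(\sigma)}e^{i\sigma x}+\frac{1}{T_1(\sigma)}e^{-i\sigma x}\quad(x\ge x_1),$$ and $S=\begin{pmatrix}T_1&R_2\\ R_1&T_2\end{pmatrix}$. Harmonic exponential operator. For a real-valued $\alpha$ integrable on $X=(x_0,x_1)$, define for $\sigma\in\mathbb{C}$ $$E^{X}_\alpha(\sigma)=1+\sum_{j=1}^\infty\ \int_{x_0<s_1<\cdots<s_j<x_1}e^{2i\sigma\kappa(s_1,\ldots,s_j)}\prod_{\nu=1}^j\alpha(s_\nu)\,ds_1\cdots ds_j,$$ where $\kappa(s_1,\ldots,s_j)=(s_j-s_{j-1})+(s_{j-2}-s_{j-3})+\cdots+(s_2-s_1)$ if $j$ is even, and $\kappa(s_1,\ldots,s_j)=(s_j-s_{j-1})+(s_{j-2}-s_{j-3})+\cdots+(s_3-s_2)+(s_1-x_0)$ if $j$ is odd (so $\kappa(s_1)=s_1-x_0$ for $j=1$). Further, $\mathrm{Cosh}^{X}_\alpha=\frac12\left(E^{X}_\alpha+E^{X}_{-\alpha}\right)$, $\mathrm{Sinh}^{X}_\alpha=\frac12\left(E^{X}_\alpha-E^{X}_{-\alpha}\right)$, $\mathrm{Sech}^X_\alpha=1/\mathrm{Cosh}^X_\alpha$.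 *)

(* Defs.v *)
From mathcomp Require Import all_boot all_order all_algebra.
From mathcomp Require Import all_classical all_reals all_analysis.
From mathcomp Require Import complex.
Set Implicit Arguments.
Unset Strict Implicit.
Unset Printing Implicit Defensive.
Import Order.TTheory GRing.Theory Num.Theory.
Import numFieldNormedType.Exports.
Local Open Scope classical_set_scope.
Local Open Scope ring_scope.
Local Open Scope complex_scope.

Section complex_calculus.
Context {R : realType}.

Definition cexp (z : R[i]) : R[i] :=
  (expR (complex.Re z))%:C * (cos (complex.Im z) +i* sin (complex.Im z)).

(* Lebesgue integrals and limits of complex-valued functions and sequences are
   taken on the real and imaginary parts. *)
Definition cintegral (D : set R) (f : R -> R[i]) : R[i] :=
  (\int[@lebesgue_measure R]_(x in D) complex.Re (f x)) +i*
  (\int[@lebesgue_measure R]_(x in D) complex.Im (f x)).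

Definition clim (u : nat -> R[i]) : R[i] :=
  limn (fun n => complex.Re (u n)) +i* limn (fun n => complex.Im (u n)).

Definition ccontinuous (f : R -> R[i]) : Prop :=
  continuous (fun x => complex.Re (f x)) /\
  continuous (fun x => complex.Im (f x)).

Definition cmeasurable (f : R -> R[i]) : Prop :=
  measurable_fun [set: R] (fun x => complex.Re (f x)) /\
  measurable_fun [set: R] (fun x => complex.Im (f x)).

Definition mx2 (a b c d : R[i]) : 'M[R[i]]_2 :=
  \matrix_(i < 2, j < 2)
    if i == 0 then (if j == 0 then a else b) else (if j == 0 then c else d).

End complex_calculus.

Section real_functions.
Context {R : realType}.

Definition absolutely_continuous (f : R -> R) : Prop :=
  forall e : R, 0 < e -> exists2 d : R, 0 < d &
    forall (n : nat) (a b : nat -> R),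
      (forall i, (i < n)%N -> a i <= b i) ->
      trivIset `I_n (fun i => [set` `]a i, b i[]) ->
      \sum_(i < n) (b i - a i) < d ->
      \sum_(i < n) `|f (b i) - f (a i)| < e.

(* The support of the almost-everywhere class of f: the complement of the
   largest open set on which f vanishes almost everywhere. *)
Definition ess_support (f : R -> R) : set R :=
  [set x | forall U : set R, open U -> U x ->
    ~ (@lebesgue_measure R).-negligible (U `&` [set y | f y != 0])].

Definition test_function (phi : R -> R) : Prop :=
  (forall (n : nat) (x : R), derivable (derive1n n phi) x 1) /\
  compact (closure [set x | phi x != 0]).

End real_functions.

Section schrodinger.
Context {R : realType}.
Implicit Types (zeta : R -> R) (sigma : R[i]) (u v y : R -> R[i]).

Definition L2loc u : Prop :=
  cmeasurable u /\
  forall a b : R, (@lebesgue_measure R).-integrable `[a, b]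
    (EFin \o (fun x => complex.Re (u x) ^+ 2 + complex.Im (u x) ^+ 2)).

(* v is the distributional derivative of u. Real test functions suffice: both
   sides are the restriction of a complex-linear functional. *)
Definition weak_derivative u v : Prop :=
  forall phi, test_function phi ->
    cintegral [set: R] (fun x => u x * (derive1 phi x)%:C) =
    - cintegral [set: R] (fun x => v x * (phi x)%:C).

(* u is a W^{1,2}_loc solution of (zeta u')' + sigma^2 zeta u = 0 in the sense
   of distributions, v being the weak derivative u'. Elements of W^{1,2}_loc
   are almost-everywhere classes; u denotes the continuous representative. *)
Definition impedance_solution zeta sigma u : Prop :=
  ccontinuous u /\
  exists v, [/\ L2loc u, L2loc v, weak_derivative u v &
    forall phi, test_function phi ->
      - cintegral [set: R] (fun x => (zeta x)%:C * v x * (derive1 phi x)%:C)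
      + cintegral [set: R]
          (fun x => sigma ^+ 2 * (zeta x)%:C * u x * (phi x)%:C) = 0].

(* y solves - y'' + q y = sigma^2 y, where q = (sqrt zeta)'' / sqrt zeta. For
   zeta merely absolutely continuous q is only formal, and the equation is
   given its meaning by the substitution y = sqrt zeta * u. *)
Definition schrodinger_solution zeta sigma y : Prop :=
  impedance_solution zeta sigma (fun x => y x / (Num.sqrt (zeta x))%:C).

Definition is_S_matrix zeta (x0 x1 : R) sigma (M : 'M[R[i]]_2) : Prop :=
  exists f1 f2 : R -> R[i],
  [/\ schrodinger_solution zeta sigma f1,
      forall x, x1 <= x -> f1 x = cexp ('i%C * sigma * x%:C),
      schrodinger_solution zeta sigma f2 &
      forall x, x <= x0 -> f2 x = cexp (- ('i%C * sigma * x%:C))] /\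
  exists T1 T2 R1 R2 : R[i],
  [/\ T1 != 0 /\ T2 != 0,
      forall x, x <= x0 ->
        f1 x = 1 / T2 * cexp ('i%C * sigma * x%:C)
               + R2 / T2 * cexp (- ('i%C * sigma * x%:C)),
      forall x, x1 <= x ->
        f2 x = R1 / T1 * cexp ('i%C * sigma * x%:C)
               + 1 / T1 * cexp (- ('i%C * sigma * x%:C)) &
      M = mx2 T1 R2
              R1 T2].

End schrodinger.

Section harmonic_exponential.
Context {R : realType}.
Implicit Types (alpha : R -> R) (sigma : R[i]).

(* The integral of F [:: s_1; ...; s_j] over lo < s_1 < ... < s_j < hi, as an
   iterated integral with s_1 outermost. *)
Fixpoint simplex_integral (j : nat) (lo hi : R) (F : seq R -> R[i]) : R[i] :=
  if j is k.+1 then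
    cintegral `]lo, hi[ (fun s => simplex_integral k s hi (fun l => F (s :: l)))
  else F [::].

Fixpoint kappa_rev (x0 : R) (l : seq R) : R :=
  match l with
  | a :: b :: t => (a - b) + kappa_rev x0 t
  | [:: a] => a - x0
  | [::] => 0
  end.

(* Differences are paired starting from the last entry s_j; when j is odd the
   unpaired s_1 contributes s_1 - x0. *)
Definition kappa (x0 : R) (s : seq R) : R := kappa_rev x0 (rev s).

Definition harmonic_term (x0 x1 : R) alpha sigma (j : nat) : R[i] :=
  simplex_integral j x0 x1 (fun s =>
    cexp (2 * 'i%C * sigma * (kappa x0 s)%:C) * (\prod_(a <- s) alpha a)%:C).

Definition harmonic_exp (x0 x1 : R) alpha sigma : R[i] :=
  1 + clim (fun n => \sum_(1 <= j < n) harmonic_term x0 x1 alpha sigma j).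

Definition harmonic_cosh (x0 x1 : R) alpha sigma : R[i] :=
  2^-1 * (harmonic_exp x0 x1 alpha sigma
          + harmonic_exp x0 x1 (fun s => - alpha s) sigma).

Definition harmonic_sinh (x0 x1 : R) alpha sigma : R[i] :=
  2^-1 * (harmonic_exp x0 x1 alpha sigma
          - harmonic_exp x0 x1 (fun s => - alpha s) sigma).

Definition harmonic_sech (x0 x1 : R) alpha sigma : R[i] :=
  1 / harmonic_cosh x0 x1 alpha sigma.

End harmonic_exponential.

(* Main.v *)
From HB Require Import structures.
Require Import Defs.
From mathcomp Require Import all_boot all_order all_algebra.
From mathcomp Require Import all_classical all_reals all_analysis.
From mathcomp Require Import complex measurable_realfun.
From mathcomp Require Import ring lra.
Set Implicit Arguments.
Unset Strict Implicit.
Unset Printing Implicit Defensive.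
Import Order.TTheory GRing.Theory Num.Theory.
Import numFieldNormedType.Exports.
Local Open Scope classical_set_scope.
Local Open Scope ring_scope.
Local Open Scope complex_scope.

(** Write [alpha = - (log zeta)' / 2] and [u = y / sqrt zeta].  A weak solution [u] is C^1,
    with [w = zeta u'] also C^1 and [w' = - sigma^2 zeta u]: test the equations against smooth
    plateaus whose derivatives are differences of mollifiers, and pass to the limit at Lebesgue
    points.  In the variables [sqrt zeta u] and [w / sqrt zeta] the system is
    [A' = - alpha e^{-2 i sigma (x - x0)} B], [B' = - alpha e^{2 i sigma (x - x0)} A], where
    [y = A e^{i sigma (x - x0)} + B e^{-i sigma (x - x0)}].  Its Picard series started from
    [A = 1], [B = 0] at [x1] is, at [x0], the pair (Cosh, Sinh) term by term.  This gives [f1];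
    as sigma and zeta are real, conj [f1] is a solution too, and [f2] is a combination of both.
    The Wronskian of [Re] and [Im] of [f1] is constant, which yields
    [|Cosh|^2 - |Sinh|^2 = 1] and the uniqueness of [f1] and [f2].

    The passage between [zeta] and [zeta'] is the fundamental theorem of calculus for absolutely
    continuous functions: such a function is a difference of two monotone absolutely continuous
    ones (total variation), whose Stieltjes measures have a Radon-Nikodym density. *)

(** * Absolutely continuous functions *)

Section absolute_continuity.
Context {R : realType}.
Implicit Types (f g : R -> R) (a b c d e x y : R) (p q : R * R) (l : seq (R * R)).

(** Since [zeta'] is merely integrable, the equations for the amplitudes hold only almost
    everywhere, and [alpha], a pointwise [derive1], takes default values wherever [ln zeta] is not
    differentiable. It is therefore traded for an integrable [beta] that agrees with it almost
    everywhere and vanishes outside [X]. Classical derivatives reappear only for [u] and [w]: the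
    terms in [alpha] cancel there, and an absolutely continuous function whose almost everywhere
    derivative is continuous is C^1.

    The coefficients being real, a complex solution is handled as two real ones. For a real solution
    [B] is the conjugate of [A], so a single unknown [h] remains, with
    [h' = - beta e^{-2 i theta} conj h] and [theta = sigma (x - x0)]. The datum [h = 1] at [x1]
    gives the real part of [e^{i theta}] beyond [x1]. The imaginary part comes from the same series
    for [- beta], because exchanging the two real variables of the system amounts to changing the
    signs of [beta] and [sigma]. This is the source of the two signs of [alpha] in Cosh and Sinh.
    Starting from the right matches the iterated integral over the simplex, whose inner variables
    range up to [x1]. *)

Definition ordered_pair p := p.1 <= p.2.
Definition nonoverlapping p q := (p.2 <= q.1) || (q.2 <= p.1).
Definition total_length l := \sum_(p <- l) (p.2 - p.1).
Definition total_increment f l := \sum_(p <- l) `|f p.2 - f p.1|.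

(** Lists replace indexed families because they can be concatenated, clipped, filtered and refined.
    Shared endpoints are allowed, so the steps of a partition form an admissible list. *)
Definition ac_modulus f e d := forall l, all ordered_pair l -> pairwise nonoverlapping l ->
  total_length l < d -> total_increment f l < e.

Lemma apart_disj p q : nonoverlapping p q ->
  [set` `]p.1, p.2[] `&` [set` `]q.1, q.2[] = set0.
Proof.
move=> pq; rewrite -subset0 => z /= [].
rewrite !in_itv/= => /andP[h1 h2] /andP[h3 h4].
by case/orP: pq => h; lra.
Qed.

Lemma absolutely_continuousP f : absolutely_continuous f ->
  forall e, 0 < e -> exists2 d, 0 < d & ac_modulus f e d.
Proof.
move=> acf e e0; have [d d0 H] := acf e e0; exists d => // l le pw ld.
have := H (size l) (fun i => (nth (0, 0) l i).1) (fun i => (nth (0, 0) l i).2).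
have sumE (F : R * R -> R) :
    \sum_(i < size l) F (nth (0, 0) l i) = \sum_(p <- l) F p.
  by rewrite (big_nth (0, 0)) big_mkord.
rewrite /total_increment /total_length (sumE (fun p => `|f p.2 - f p.1|)) (sumE (fun p =>
  p.2 - p.1)).
apply => //.
- by move=> i il; move/allP : le => /(_ _ (mem_nth (0, 0) il)).
- apply/trivIsetP => i j /= il jl ij.
  have sym u v : nonoverlapping u v -> nonoverlapping v u by rewrite /nonoverlapping orbC.
  wlog ltij : i j il jl ij / (i < j)%N.
    move=> wl; have /orP[ltij|ltij] : (i < j)%N || (j < i)%N by rewrite -neq_ltn.
      exact: wl.
    by rewrite setIC; apply: wl => //; rewrite eq_sym.
  by apply: apart_disj; move/(pairwiseP (0, 0)): pw; apply.
Qed.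

Fixpoint partition_steps x (s : seq R) : seq (R * R) :=
  if s is y :: s' then (x, y) :: partition_steps y s' else [::].

Lemma steps_sub x s : path <%R x s ->
  all (fun p => (x <= p.1) && (p.1 < p.2) && (p.2 <= last x s)) (partition_steps x s).
Proof.
elim: s x => //= y s ih x /andP[xy ys].
rewrite lexx xy /=; apply/andP; split.
  by apply: (@itv_partition_le _ _ _ _ s); split.
apply: sub_all (ih _ ys) => p /andP[/andP[h1 h2] h3].
by rewrite h2 h3 (le_trans (ltW xy)).
Qed.

Lemma steps_pairwise x s : path <%R x s -> pairwise nonoverlapping (partition_steps x s).
Proof.
elim: s x => //= y s ih x /andP[xy ys]; rewrite ih// andbT.
apply/allP => p /(allP (steps_sub ys)) /andP[/andP[h1 _] _].
by rewrite /nonoverlapping /= h1.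
Qed.

Lemma len_steps x s : total_length (partition_steps x s) = last x s - x.
Proof.
rewrite /total_length; elim: s x => [x|y s ih x] /=; first by rewrite big_nil subrr.
by rewrite big_cons /= ih; lra.
Qed.

Lemma incr_steps f x y s : total_increment f (partition_steps x s) = variation x y f s.
Proof.
rewrite /total_increment /variation; elim: s x => [x|z s ih x] /=; first by rewrite !big_nil.
by rewrite big_cons /= big_nat_recl//= ih.
Qed.

(* Cutting the intervals into partitions keeps the family non-overlapping and of the same total
   length, so the bound on increments passes to the suprema. *)
Lemma ac_modulus_tv f e d : ac_modulus f e d ->
  forall l, all ordered_pair l -> pairwise nonoverlapping l -> total_length l < d ->
  (\sum_(p <- l) total_variation p.1 p.2 f <= e%:E)%E.
Proof.
move=> H l.
(* Generalised so that [l'] accumulates the partitions already chosen: the suprema can then be taken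
   one interval at a time. *)
suff : forall l', all ordered_pair (l' ++ l) -> pairwise nonoverlapping (l' ++ l) ->
   total_length (l' ++ l) < d ->
   ((total_increment f l')%:E + \sum_(p <- l) total_variation p.1 p.2 f <= e%:E)%E.
  move=> /(_ [::]) /=; rewrite /total_increment big_nil add0e; exact.
elim: l => [l'|p l ih l' le pw ld].
  by rewrite cats0 big_nil adde0 lee_fin => le pw ld; apply/ltW/H.
have px : p.1 <= p.2 by move: le; rewrite all_cat /= => /and3P[_ ? _].
rewrite big_cons addeA.
have tvl0 : (0 <= \sum_(q <- l) total_variation q.1 q.2 f)%E.
  rewrite big_seq; apply: sume_ge0 => q ql; apply: total_variation_ge0.
  by move: le; rewrite all_cat /= => /and3P[_ _ /allP/(_ _ ql)].
have key s : itv_partition p.1 p.2 s ->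
  ((total_increment f l')%:E + (variation p.1 p.2 f s)%:E +
    \sum_(q <- l) total_variation q.1 q.2 f <= e%:E)%E.
  move=> [ps /eqP ls].
  have := ih (l' ++ partition_steps p.1 s).
  rewrite {1}/total_increment big_cat /= -/(total_increment f l') -/(total_increment f
    (partition_steps _ _)).
  rewrite (incr_steps _ _ p.2) EFinD; apply.
  - move: le; rewrite !all_cat /= => /and3P[-> _ ->]; rewrite andbT /=.
    by apply/allP => q /(allP (steps_sub ps)) /andP[/andP[_ /ltW]].
  - have mono (r q : R * R) : q \in partition_steps p.1 s -> nonoverlapping r p ->
    nonoverlapping r q.
      move/allP : (steps_sub ps) => /[apply]; rewrite ls.
      move=> /andP[/andP[h1 _] h3].
      by rewrite /nonoverlapping => /orP[h|h]; apply/orP; [left|right]; lra.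
    have sym u v : nonoverlapping u v = nonoverlapping v u by rewrite /nonoverlapping orbC.
    move: pw; rewrite !pairwise_cat /= allrel_consr.
    move=> /and4P[/andP[/allP h1 h2] h3 /allP h4 h5].
    rewrite steps_pairwise// h5 h3 /= !andbT allrel_catl h2 /=.
    apply/andP; split; last first.
      by apply/allrelP => u v ul vs; apply: mono vs _; exact: h1.
    apply/allrelP => u v us vl; rewrite sym; apply: mono us _.
    by rewrite sym; exact: h4.
  - move: ld; rewrite /total_length !big_cat !big_cons /= -?/(total_length _) len_steps ls.
    by lra.
(* The remaining sum has to be finite before it can be moved across the inequality; were it
   infinite, a single partition of [p] would contradict [key]. *)
have [abs|abs] := eqVneq (\sum_(q <- l) total_variation q.1 q.2 f)%E +oo%E.
  have [s ps] : exists s, itv_partition p.1 p.2 s.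
    move: px; rewrite le_eqVlt => /predU1P[->|px].
      by exists [::]; split.
    by exists [:: p.2]; exact: itv_partition1.
  by have := key _ ps; rewrite abs -EFinD addey// leye_eq.
have fin : (\sum_(q <- l) total_variation q.1 q.2 f)%E \is a fin_num.
  by rewrite ge0_fin_numE// ltey.
rewrite -leeBrDr//.
rewrite -leeBrDl//.
apply: ge_ereal_sup => _ [_ [s ps <-] <-].
by rewrite leeBrDl// leeBrDr//; exact: key.
Qed.

End absolute_continuity.

(** * Stieltjes measures of absolutely continuous functions *)

Section stieltjes.
Context {R : realType}.
Notation mu := (@lebesgue_measure R).
Implicit Types (f g : R -> R) (a b c d e x y : R) (l : seq (R * R)).

Lemma open_itv_meet a b c d : a < b -> c < d -> a < d -> c < b ->
  exists2 z, a < z < b & c < z < d.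
Proof.
move=> ab cd ad cb; exists ((Num.max a c + Num.min b d) / 2);
  rewrite /Num.max /Num.min; case: ifPn; case: ifPn;
  rewrite -?leNgt => *; apply/andP; split; lra.
Qed.

Lemma stieltjes_measure_itv (F : cumulative R R) a b : a <= b ->
  lebesgue_stieltjes_measure F `]a, b]%classic = (F b - F a)%:E.
Proof.
move=> ab; rewrite /lebesgue_stieltjes_measure /measure_extension/=.
rewrite measurable_mu_extE/=; last exact: is_ocitv.
by rewrite wlength_itv_bnd// EFinB.
Qed.

Lemma open_itv_sub (I : set R) : open I -> is_interval I -> I !=set0 ->
  has_lbound I -> has_ubound I -> I = [set` `]inf I, sup I[].
Proof.
move=> oI iI I0 lI uI; have := interval_bounded_interior iI lI uI.
have /interior_id -> := oI.
by move=> {1}->; rewrite set_itvE.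
Qed.

(** A null set lies in an open set of measure less than [d], whose components are disjoint
    intervals. Any finitely many of them have total length less than [d], so the modulus bounds the
    sum of the increments of [F], that is, their Stieltjes measure; countable additivity passes this
    to the whole open set. *)
Lemma stieltjes_bounded_dominates (F : cumulative R R) lo hi :
  (forall e, 0 < e -> exists2 d, 0 < d & ac_modulus F e d) ->
  forall A : set (measurableTypeR R), measurable A -> A `<=` `]lo, hi[ ->
  mu A = 0%E -> lebesgue_stieltjes_measure F A = 0%E.
Proof.
move=> acF A mA Alh A0.
apply/eqP; rewrite eq_le measure_ge0 andbT; apply/lee_addgt0Pr => e e0.
rewrite add0e; have [d d0 H] := acF e e0.
have [|U [oU AU]] := lebesgue_regularity_outer mA _ d0.
  by rewrite [X in (X < _)%E]A0 ltry.
move=> UAd; have mU : measurable (U : set (measurableTypeR R)).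
  exact: open_measurable.
have Ud : (mu U < d%:E)%E.
  apply: le_lt_trans UAd; rewrite -[leRHS]adde0 -A0 -{1}(setDKU AU).
  by apply: measureU2 => //; exact: measurableD.
(* Cutting down to []lo, hi[] bounds the components, so that [inf] and [sup] are their true
   endpoints. *)
pose U' := U `&` `]lo, hi[%classic.
have oU' : open U' by apply: openI => //; exact: itv_open.
have AU' : A `<=` U' by move=> x Ax; split; [exact: AU|exact: Alh].
have U'd : (mu U' < d%:E)%E.
  apply: le_lt_trans Ud; apply: le_measure; rewrite ?inE; last by move=> ? [].
    exact: open_measurable.
  exact: open_measurable.
pose I := open_disjoint_itv oU'.
have oI i : open (I i) by exact: open_disjoint_itv_open.
have mI i : measurable (I i : set (measurableTypeR R)) by exact: open_measurable.
have tI : trivIset [set: nat] I by exact: open_disjoint_itv_trivIset.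
have UI : U' = \bigcup_q I q by exact: open_disjoint_itv_bigcup.
have IE i : I i !=set0 -> I i = [set` `]inf (I i), sup (I i)[].
  move=> I0; apply: open_itv_sub => //.
  - exact: open_disjoint_itv_is_interval.
  - exists lo => x Ix; have : U' x by rewrite UI; exists i.
    by case=> _ /=; rewrite in_itv/= => /andP[/ltW].
  - exists hi => x Ix; have : U' x by rewrite UI; exists i.
    by case=> _ /=; rewrite in_itv/= => /andP[_ /ltW].
have Ilt i : I i !=set0 -> inf (I i) < sup (I i).
  by move=> I0; have [x] := I0; rewrite {1}IE//= in_itv/= => /andP[/lt_trans]; apply.
have muI i : I i !=set0 -> mu (I i) = (sup (I i) - inf (I i))%:E.
  by move=> I0; rewrite {1}IE// lebesgue_measure_itv/= lte_fin Ilt// EFinB.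
have nuI i : I i !=set0 ->
    (lebesgue_stieltjes_measure F (I i) <= (F (sup (I i)) - F (inf (I i)))%:E)%E.
  move=> I0; rewrite -stieltjes_measure_itv; last exact/ltW/Ilt.
  apply: le_measure; rewrite ?inE//.
  by rewrite {1}IE//; apply: subset_itvl; rewrite bnd_simp.
apply: (@le_trans _ _ (lebesgue_stieltjes_measure F U')).
  by apply: le_measure; rewrite ?inE//; exact: open_measurable.
rewrite [in leLHS]UI measure_semi_bigcup//; last first.
  by rewrite -UI; exact: open_measurable.
apply: lime_le; first by apply: is_cvg_nneseries => *; exact: measure_ge0.
near=> n.
(* Empty components are discarded: their [inf] and [sup] are default values, unrelated to the
   set. *)
pose r := [seq i <- iota 0 n | I i != set0].
pose l := [seq (inf (I i), sup (I i)) | i <- r].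
have rP i : i \in r -> I i !=set0.
  by rewrite mem_filter => /andP[/set0P].
rewrite (bigID (fun i => I i != set0))/= [X in (_ + X)%E]big1; last first.
  by move=> i /negPn/eqP ->; rewrite measure0.
rewrite adde0 -big_filter /index_iota subn0 -/r.
apply: (@le_trans _ _ (\sum_(p <- l) `|F p.2 - F p.1|)%:E).
  rewrite big_map -sumEFin [leRHS]big_seq [leLHS]big_seq.
  apply: lee_sum => i /rP /nuI /le_trans; apply.
  by rewrite lee_fin ler_norm.
rewrite lee_fin; apply: ltW; apply: H.
- by apply/allP => _ /mapP[i /rP/Ilt/ltW ? ->].
- rewrite pairwise_map; apply: (@sub_in_pairwise _ (mem r) (fun i j => i != j)).
  + move=> i j ir jr ij; rewrite /nonoverlapping/=.
    apply/orP; apply: contrapT => /not_orP[/negP h1 /negP h2].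
    move: h1 h2; rewrite -!ltNge => h1 h2.
    have li := Ilt _ (rP _ ir); have lj := Ilt _ (rP _ jr).
    have eij : i = j; last by move: ij; rewrite eij eqxx.
    apply: (tI i j) => //.
    have [z zi zj] := open_itv_meet li lj h2 h1.
    exists z.
    by split; [rewrite (IE i (rP _ ir))|rewrite (IE j (rP _ jr))];
      rewrite /= in_itv/=.
  + by apply/allP.
  + by rewrite -uniq_pairwise filter_uniq// iota_uniq.
- rewrite -lte_fin /total_length big_map/= -sumEFin.
  apply: le_lt_trans U'd.
  rewrite UI measure_semi_bigcup//; last by rewrite -UI; exact: open_measurable.
  apply: le_trans (nneseries_lim_ge n _) => //.
  rewrite [leRHS](bigID (fun i => I i != set0))/= [X in (_ + X)%E]big1; last first.
    by move=> i /negPn/eqP ->; rewrite measure0.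
  rewrite adde0 -[leRHS]big_filter /index_iota subn0 -/r.
  rewrite [leRHS]big_seq [leLHS]big_seq.
  by apply: lee_sum => i /rP /muI ->.
Unshelve. all: by end_near. Qed.

End stieltjes.

(** * Fundamental theorem of calculus for absolutely continuous functions *)

Section ac_density.
Context {R : realType}.
Notation mu := (@lebesgue_measure R).
Implicit Types (f g F : R -> R) (a b c d e x y : R) (l : seq (R * R)).

Definition abs_cont f := forall e, 0 < e -> exists2 d, 0 < d & ac_modulus f e d.

Lemma ac_pair f : abs_cont f -> forall e, 0 < e -> exists2 d, 0 < d &
  forall x y, x <= y -> y - x < d -> `|f y - f x| < e.
Proof.
move=> acf e e0; have [d d0 H] := acf e e0; exists d => // x y xy xyd.
have := H [:: (x, y)];
  rewrite /total_increment /total_length /= !big_cons !big_nil !addr0 /ordered_pair /=.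
by rewrite xy; apply.
Qed.

Lemma ac_continuous f : abs_cont f -> continuous f.
Proof.
move=> acf x; apply/cvgrPdist_lt => e e0; have [d d0 H] := ac_pair acf e0.
near=> y; have yx : `|x - y| < d.
  by near: y; apply/nbhs_ballP; exists d.
have [xy|xy] := leP x y.
  by rewrite distrC; apply: H => //; rewrite distrC ger0_norm ?subr_ge0 in yx.
by apply: H; [exact: ltW|rewrite gtr0_norm ?subr_gt0 in yx].
Unshelve. all: by end_near. Qed.

Lemma nondecreasing_ac_density F lo hi : lo <= hi -> {homo F : x y / x <= y} -> abs_cont F ->
  exists g : R -> R, mu.-integrable setT (EFin \o g) /\
    forall x, lo <= x <= hi -> F x = F lo + \int[mu]_(t in `]lo, x]) g t.
Proof.
move=> lohi ndF acF.
pose Fc : cumulative R R := HB.pack F (@isCumulative.Build R _ R F ndF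
  (right_continuousW (ac_continuous acF))).
have FcE : (Fc : R -> R) = F by [].
pose D : set (measurableTypeR R) := `]lo, hi]%classic.
have mD : measurable D by exact: measurable_itv.
have Doo : (lebesgue_stieltjes_measure Fc D < +oo)%E.
  by rewrite stieltjes_measure_itv// ltry.
pose nu := mfrestr mD Doo.
have numu : nu `<< mu.
  apply/null_content_dominatesP => A mA A0.
  rewrite /nu /mfrestr /mrestr.
  (* The margin of 1 fits the half-open []lo, hi]] into an open interval. *)
  apply: (@stieltjes_bounded_dominates _ _ (lo - 1) (hi + 1)) => //.
  - exact: measurableI.
  - by move=> x [_]; rewrite /D /= !in_itv/= => /andP[h1 h2]; apply/andP; split; lra.
  - apply: (@subset_measure0 _ _ _ mu _ A) => //; exact: measurableI.
have [g [g0 gfin ig nuE]] := radon_nikodym_sigma_finite numu.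
exists (fine \o g); split.
  by apply: eq_integrable ig => // x _; rewrite /= fineK.
move=> x /andP[lox xhi]; rewrite /Rintegral.
under eq_integral do rewrite /= fineK//.
rewrite -nuE; last exact: measurable_itv.
rewrite /nu/= /mfrestr /mrestr setIidl; last first.
  by apply: subset_itvl; rewrite bnd_simp.
by rewrite stieltjes_measure_itv//= addrC subrK.
Qed.

(** With [d] the modulus for [e = 1], the variation over an interval shorter than [d] is at most 1,
    and finitely many steps of length [d / 2] lead from [a] to [b]. *)
Lemma ac_total_variation f a b : abs_cont f -> a <= b -> total_variation a b f \is a fin_num.
Proof.
move=> acf ab; have [d d0 H] := acf 1 ltr01.
have key n : forall x, a <= x -> x <= a + n%:R * (d / 2) ->
    total_variation a x f \is a fin_num.
  elim: n => [x ax|n ih x ax xn].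
    rewrite mul0r addr0 => xa; have -> : x = a by apply/eqP; rewrite eq_le xa ax.
    by rewrite total_variationxx.
  have [xc|cx] := leP x (a + n%:R * (d / 2)); first exact: ih.
  set c := a + _ in cx; have ac' : a <= c by rewrite lerDl mulr_ge0// divr_ge0// ltW.
  rewrite (total_variationD f ac' (ltW cx)) fin_numD ih//=.
  rewrite ge0_fin_numE; last exact/total_variation_ge0/ltW.
  have := ac_modulus_tv H (l := [:: (c, x)]).
  rewrite /= /ordered_pair /total_length /= !big_cons !big_nil (ltW cx) addr0 adde0.
  move=> /(_ isT isT); have -> : x - c < d.
    by move: xn; rewrite /c -natr1 mulrDl mul1r; lra.
  by move=> /(_ isT) /le_lt_trans; apply; rewrite ltry.
apply: (key (Num.bound ((b - a) / (d / 2)))) => //.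
rewrite -lerBlDl -ler_pdivrMr ?divr_gt0//; apply/ltW/archi_boundP.
by rewrite divr_ge0 ?subr_ge0// divr_ge0// ltW.
Qed.

(** The variation from [a] to [x] is meaningful for [a <= x] only, while monotonicity and [abs_cont]
    are stated on the whole line. Replacing [x] by [Num.max a x] extends by a constant to the left
    of [a]; on lists of intervals this is [clip]. *)
Let clip a (p : R * R) := (Num.max a p.1, Num.max a p.2).

Let clipP a l : all ordered_pair l -> pairwise nonoverlapping l ->
  [/\ all ordered_pair (map (clip a) l), pairwise nonoverlapping (map (clip a) l) &
      total_length (map (clip a) l) <= total_length l].
Proof.
move=> le pw; split.
- rewrite all_map; apply: sub_all le => p; rewrite /ordered_pair /= => p12.
  by rewrite ge_max !le_max lexx p12 /= orbT.
- rewrite pairwise_map; apply: sub_pairwise pw => p q; rewrite /nonoverlapping /=.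
  by move=> /orP[] h; apply/orP; [left|right];
    rewrite ge_max !le_max h ?orbT ?lexx.
- rewrite /total_length big_map [leLHS]big_seq [leRHS]big_seq; apply: ler_sum => p pl.
  move/allP : le => /(_ _ pl); rewrite /ordered_pair /= /Num.max.
  by case: ifPn; case: ifPn; rewrite -?leNgt; lra.
Qed.

Lemma ac_clip f a : abs_cont f -> abs_cont (fun x => f (Num.max a x)).
Proof.
move=> acf e e0; have [d d0 H] := acf e e0; exists d => // l le pw ld.
have [le' pw' ld'] := clipP a le pw.
by have := H _ le' pw' (le_lt_trans ld' ld); rewrite /total_increment big_map.
Qed.

(** By additivity, the increments of the variation function over a list are the variations over its
    intervals, which [ac_modulus_tv] controls. Taking [e / 2] recovers the strict inequality lost in
    the suprema. *)
Lemma ac_total_variation_clip f a : abs_cont f ->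
  abs_cont (fun x => fine (total_variation a (Num.max a x) f)).
Proof.
move=> acf e e0.
have e20 : 0 < e / 2 by rewrite divr_gt0.
have [d d0 H] := acf _ e20; exists d => // l le pw ld.
have [le' pw' ld'] := clipP a le pw.
have := ac_modulus_tv H le' pw' (le_lt_trans ld' ld).
rewrite big_map /total_increment.
rewrite (_ : (\sum_(i <- l) _)%E =
  (\sum_(p <- l) `|fine (total_variation a (Num.max a p.2) f) -
    fine (total_variation a (Num.max a p.1) f)|)%:E).
  by rewrite lee_fin => /le_lt_trans; apply; rewrite gtr_pMr//; lra.
rewrite -sumEFin big_seq [in RHS]big_seq; apply: eq_bigr => p pl.
have p12 : Num.max a p.1 <= Num.max a p.2.
  by move/allP : le' => /(_ (clip a p)); apply; exact: map_f.
have a1 : a <= Num.max a p.1 by rewrite le_max lexx.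
rewrite (total_variationD f a1 p12) fineD ?ac_total_variation//.
rewrite addrC addKr ger0_norm ?fine_ge0 ?total_variation_ge0//.
by rewrite fineK// ac_total_variation.
Qed.

Lemma acB f g : abs_cont f -> abs_cont g -> abs_cont (f \- g).
Proof.
move=> acf acg e e0; have e20 : 0 < e / 2 by rewrite divr_gt0.
have [d d0 H] := acf _ e20; have [d' d'0 H'] := acg _ e20.
exists (Num.min d d'); first by rewrite lt_min d0.
move=> l le pw; rewrite lt_min => /andP[h h'].
have {}H := H _ le pw h; have {}H' := H' _ le pw h'.
apply: (@le_lt_trans _ _ (total_increment f l + total_increment g l)); last by lra.
rewrite /total_increment -big_split/=; apply: ler_sum => p _ /=.
rewrite (_ : f p.2 - g p.2 - (f p.1 - g p.1) = (f p.2 - f p.1) - (g p.2 - g p.1)); last by lra.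
exact: ler_normB.
Qed.

Lemma ac_density f a b : abs_cont f -> a <= b ->
  exists g : R -> R, mu.-integrable setT (EFin \o g) /\
    forall x, a <= x <= b -> f x = f a + \int[mu]_(t in `]a, x]) g t.
Proof.
move=> acf ab.
pose V x := fine (total_variation a (Num.max a x) f).
have acV : abs_cont V by exact: ac_total_variation_clip.
have acW : abs_cont (V \- (fun x => f (Num.max a x))) by apply: acB => //; exact: ac_clip.
have VD x y : x <= y -> V y - V x =
    fine (total_variation (Num.max a x) (Num.max a y) f) /\
    Num.max a x <= Num.max a y.
  move=> xy; have p12 : Num.max a x <= Num.max a y.
    by rewrite ge_max !le_max lexx xy /= orbT.
  split=> //; have a1 : a <= Num.max a x by rewrite le_max lexx.
  rewrite /V (total_variationD f a1 p12) fineD ?ac_total_variation//.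
  by rewrite addrC addKr.
have ndV : {homo V : x y / x <= y}.
  move=> x y /VD[h xy]; rewrite -subr_ge0 h fine_ge0//.
  exact: total_variation_ge0.
have ndW : {homo V \- (fun x => f (Num.max a x)) : x y / x <= y}.
  move=> x y /VD[h xy]; rewrite /= -subr_ge0.
  suff : f (Num.max a y) - f (Num.max a x) <= V y - V x by lra.
  rewrite h (le_trans (ler_norm _))// -lee_fin fineK ?ac_total_variation//.
  exact: total_variation_ge.
have [g1 [ig1 E1]] := nondecreasing_ac_density ab ndV acV.
have [g2 [ig2 E2]] := nondecreasing_ac_density ab ndW acW.
exists (g1 \- g2); split.
  rewrite (_ : EFin \o _ = (EFin \o g1) \- (EFin \o g2))%E//.
  exact: integrableB.
move=> x axb; have /andP[ax xb] := axb.
have := E2 x axb; have := E1 x axb; rewrite /= RintegralB//; last 2 first.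
- exact: integrableS ig1.
- exact: integrableS ig2.
by rewrite (max_r ax) (max_r (lexx a)) => -> ; lra.
Qed.

Lemma ae_is_derive_integral g a : mu.-integrable setT (EFin \o g) ->
  {ae mu, forall x, a < x ->
     is_derive x 1 (fun y => \int[mu]_(t in `]a, y]) g t) (g x)}.
Proof.
move=> ig; have lg : locally_integrable setT g.
  by apply: open_integrable_locally => //; exact: openT.
have ig' y : mu.-integrable [set` `]a, y]] (EFin \o g) by apply: integrableS ig.
have := FTC1 ig' lg.
apply: filterS; first exact: (ae_filter_ringOfSetsType mu).
move=> x H ax; have [|h1 h2] := H; first by [].
by apply: DeriveDef; [exact: h1|rewrite -derive1E h2].
Qed.

Lemma ac_ftc f a b : abs_cont f -> a < b ->
  exists g : R -> R, [/\ mu.-integrable setT (EFin \o g),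
    forall x, a <= x <= b -> f x = f a + \int[mu]_(t in `]a, x]) g t &
    {ae mu, forall x, a < x < b -> is_derive x 1 f (g x)}].
Proof.
move=> acf ab; have [g [ig E]] := ac_density acf (ltW ab).
exists g; split=> //; have := ae_is_derive_integral a ig.
apply: filterS; first exact: (ae_filter_ringOfSetsType mu).
move=> x H /andP[ax xb].
have h : is_derive x 1 (fun y => f a + \int[mu]_(t in `]a, y]) g t) (g x).
  by have := H ax => h; rewrite -[g x]add0r; apply: is_deriveD.
apply: near_eq_is_derive h.
near=> y; rewrite (E y)//; apply/andP; split; apply/ltW; near: y.
  exact: lt_nbhsr.
exact: lt_nbhsl.
Unshelve. all: by end_near. Qed.

End ac_density.

(** * Almost everywhere comparison of integrals, without measurability *)

Section ae_integral.
Context {d} {T : measurableType d} {R : realType} (mu : {measure set T -> \bar R}).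
Import HBNNSimple.
Implicit Types (D : set T) (f g : T -> \bar R).

(** The integral of any nonnegative function is a supremum over simple functions below it.
    Multiplying such a function below [f] by the indicator of the complement of the exceptional set
    puts it below [g] and does not change its integral. *)
Lemma ae_le_ge0_integral f g : (forall x, 0 <= f x)%E -> (forall x, 0 <= g x)%E ->
  {ae mu, forall x, (f x <= g x)%E} -> (\int[mu]_x f x <= \int[mu]_x g x)%E.
Proof.
move=> f0 g0 [N [mN N0 fgN]]; rewrite !ge0_integralTE//.
apply: ge_ereal_sup => _ [h hf <-]; apply: ereal_sup_ubound.
exists (mul_nnsfun h (indic_nnsfun R (measurableC mN))).
  move=> x; rewrite /= mindicE.
  have [xN|xN] := boolP (x \in ~` N); last by rewrite mulr0.
  rewrite mulr1 (le_trans (hf x))//; apply: contrapT => /fgN xN'.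
  by move: xN; rewrite inE; apply.
rewrite -!integralT_nnsfun; apply: ge0_ae_eq_integral => //.
- exact/measurable_EFinP.
- exact/measurable_EFinP.
- by move=> x _; rewrite lee_fin fun_ge0.
- by move=> x _; rewrite lee_fin fun_ge0.
- exists N; split=> // x /= H; apply: contrapT => xN; apply: H => _.
  by rewrite mindicE mem_set ?mulr1.
Qed.

(* No measurability is assumed: this is applied to [alpha], a pointwise [derive1]. *)
Lemma ae_eq_integral_nonmeasurable D f g : {ae mu, forall x, D x -> f x = g x} ->
  (\int[mu]_(x in D) f x = \int[mu]_(x in D) g x)%E.
Proof.
move=> fg; rewrite integral_mkcond [RHS]integral_mkcond.
have {}fg : {ae mu, forall x, (f \_ D) x = (g \_ D) x}.
  move: fg; apply: filterS => x fg; rewrite !patchE.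
  by case: ifPn => // /set_mem/fg.
rewrite integralE [RHS]integralE; congr (_ - _)%E; apply/eqP; rewrite eq_le;
  apply/andP; split; apply: ae_le_ge0_integral => //;
  move: fg; apply: filterS => x; rewrite ?funeposE ?funenegE => ->; exact: lexx.
Qed.

Lemma ae_eq_Rintegral D (f g : T -> R) : {ae mu, forall x, D x -> f x = g x} ->
  Rintegral mu D f = Rintegral mu D g.
Proof.
move=> fg; rewrite /Rintegral; congr fine; apply: ae_eq_integral_nonmeasurable.
by move: fg; apply: filterS => x + Dx => /(_ Dx) ->.
Qed.
End ae_integral.

(** * Stability of absolute continuity, and derivatives given almost everywhere *)

Section ac_closure.
Context {R : realType}.
Notation mu := (@lebesgue_measure R).
Implicit Types (f g h F : R -> R) (a b c d e x y K : R) (l : seq (R * R)).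

(** One estimate on increments that serves sums, bounded products and Lipschitz images alike. *)
Lemma ac_dominated f g h K :
  (forall x y, `|h y - h x| <= K * (`|f y - f x| + `|g y - g x|)) ->
  abs_cont f -> abs_cont g -> abs_cont h.
Proof.
move=> hfg acf acg e e0.
pose k := Num.max K 1.
have k0 : 0 < k by rewrite lt_max ltr01 orbT.
have e20 : 0 < e / k / 2 by rewrite !divr_gt0.
have [d d0 H] := acf _ e20; have [d' d'0 H'] := acg _ e20.
exists (Num.min d d'); first by rewrite lt_min d0.
move=> l le pw; rewrite lt_min => /andP[ld ld'].
have {}H := H _ le pw ld; have {}H' := H' _ le pw ld'.
apply: (@le_lt_trans _ _ (k * (total_increment f l + total_increment g l))).
  rewrite /total_increment -big_split/= mulr_sumr; apply: ler_sum => p _ /=.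
  apply: le_trans (hfg _ _) _; rewrite ler_wpM2r ?addr_ge0// le_max lexx//.
by rewrite -ltr_pdivlMl// mulrC; lra.
Qed.

Lemma ac_lipschitz f h K : (forall x y, `|h y - h x| <= K * `|f y - f x|) ->
  abs_cont f -> abs_cont h.
Proof.
move=> H acf; apply: (@ac_dominated f f h K) => // x y.
apply: le_trans (H x y) _.
(* No sign of [K] is known; the hypothesis itself makes [K * |f y - f x|] nonnegative. *)
have := H x y; have := normr_ge0 (h y - h x); have := normr_ge0 (f y - f x).
by nra.
Qed.

Lemma ac_id : abs_cont (@idfun R).
Proof.
move=> e e0; exists e => // l le _ ll.
suff : total_increment idfun l = total_length l by move=> ->.
rewrite /total_increment /total_length big_seq [RHS]big_seq; apply: eq_bigr => p pl.
by rewrite ger0_norm// subr_ge0; move/allP : le; apply.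
Qed.

Lemma acD f g : abs_cont f -> abs_cont g -> abs_cont (f \+ g).
Proof.
apply: (@ac_dominated _ _ _ 1) => x y; rewrite mul1r /=.
by rewrite opprD addrACA ler_normD.
Qed.

Lemma acM f g K : (forall x, `|f x| <= K) -> (forall x, `|g x| <= K) ->
  abs_cont f -> abs_cont g -> abs_cont (f \* g).
Proof.
move=> fK gK; apply: (@ac_dominated _ _ _ K) => x y /=.
rewrite (_ : _ - _ = (f y - f x) * g y + f x * (g y - g x)); last by ring.
apply: le_trans (ler_normD _ _) _; rewrite !normrM mulrDr.
by apply: lerD; [rewrite mulrC|]; rewrite ler_wpM2r.
Qed.

(** Derivatives are unique, so [h] agrees almost everywhere with the density of [ac_ftc] and may
    replace it under the integral, whether or not [h] is measurable. *)
Lemma ac_ae_ftc f h a b : abs_cont f -> a < b ->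
  {ae mu, forall x, a < x < b -> is_derive x 1 f (h x)} ->
  forall x, a <= x <= b -> f x = f a + \int[mu]_(t in `]a, x]) h t.
Proof.
move=> acf ab hD x axb; have [g [ig E gD]] := ac_ftc acf ab.
rewrite E//; congr (_ + _).
(* When [x = b] the domain []a, x]] contains [b], where nothing is known about the derivative. *)
have hb : {ae mu, forall x : R, x != b}.
  exists [set b]; split=> //; first exact: lebesgue_measure_set1.
  by move=> y /= /negP; rewrite negbK => /eqP.
have FF := ae_filter_ringOfSetsType mu.
apply: ae_eq_Rintegral; move: hb gD hD; apply: filterS3 => y yb gy hy.
rewrite /= in_itv/= => /andP[ay yx].
have ayb : a < y < b.
  by rewrite ay lt_neqAle yb (le_trans yx)//; case/andP: axb.
by have [_ <-] := gy ayb; have [_ <-] := hy ayb.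
Qed.

Lemma is_derive_integral h a x : a < x -> continuous h ->
  is_derive x 1 (fun y => \int[mu]_(t in `]a, y]) h t) (h x).
Proof.
move=> ax ch.
have ih : mu.-integrable `]a, x + 1] (EFin \o h).
  have i1 : mu.-integrable `[a, x + 1] (EFin \o h).
    apply: continuous_compact_integrable; first exact: segment_compact.
    by apply: continuous_subspaceT.
  apply: integrableS i1; [exact: measurable_itv|exact: measurable_itv|].
  by apply: subset_itvr; rewrite bnd_simp.
have xx : x < x + 1 by rewrite ltrDl.
have [h1 h2] := continuous_FTC1 xx ih (ax : (BRight a < BRight x)%E) (ch x).
by apply: DeriveDef; [exact: h1|rewrite -derive1E h2].
Qed.

(** The passage from almost everywhere to everywhere: near each point [f] is a constant plus the
    integral of the continuous [h]. *)
Lemma ac_is_derive f h : abs_cont f -> continuous h ->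
  {ae mu, forall x, is_derive x 1 f (h x)} -> forall x, is_derive x 1 f (h x).
Proof.
move=> acf ch hD x.
have x11 : x - 1 < x + 1 by lra.
have hD' : {ae mu, forall y, x - 1 < y < x + 1 -> is_derive y 1 f (h y)}.
  have FF := ae_filter_ringOfSetsType mu.
  by move: hD; apply: filterS => y + _.
have E := ac_ae_ftc acf x11 hD'.
have h' : is_derive x 1 (fun y => f (x - 1) + \int[mu]_(t in `]x - 1, y]) h t) (h x).
  rewrite -[h x]add0r; apply: is_deriveD; apply: is_derive_integral => //; lra.
apply: near_eq_is_derive h'.
near=> y; rewrite (E y)//.
apply/andP; split; apply/ltW; near: y; first by apply: lt_nbhsr; lra.
by apply: lt_nbhsl; lra.
Unshelve. all: by end_near. Qed.

End ac_closure.

(** * Integrals over right half-lines *)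

Section tail_integral.
Context {R : realType}.
Notation mu := (@lebesgue_measure R).
Implicit Types (f g h F : R -> R) (a b c d e x y K : R) (l : seq (R * R)).

Definition itvU l : set (measurableTypeR R) :=
  \big[setU/set0]_(p <- l) [set` `]p.1, p.2]].

Lemma itvU_measurable l : measurable (itvU l).
Proof. by apply: bigsetU_measurable => p _; exact: measurable_itv. Qed.

Lemma itvU_disjoint p l : all (nonoverlapping p) l ->
  [set` `]p.1, p.2]] `&` itvU l = set0.
Proof.
elim: l => [_|q l ih /= /andP[pq pl]]; first by rewrite /itvU big_nil setI0.
rewrite /itvU big_cons setIUr -/(itvU l) ih// setU0 -subset0 => z /= [].
rewrite !in_itv/= => /andP[h1 h2] /andP[h3 h4].
by case/orP: pq => h; clear ih; lra.
Qed.

Lemma itvU_integral l h : all ordered_pair l -> pairwise nonoverlapping l ->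
  mu.-integrable setT (EFin \o h) ->
  mu (itvU l) = (total_length l)%:E /\
  \int[mu]_(x in itvU l) h x = \sum_(p <- l) \int[mu]_(x in `]p.1, p.2]) h x.
Proof.
move=> + + ih; elim: l => [_ _|p l IH /= /andP[p12 le] /andP[pl pw]].
  by rewrite /itvU /total_length !big_nil measure0 Rintegral_set0.
have [E1 E2] := IH le pw.
have disj := itvU_disjoint pl; have mU := itvU_measurable l.
rewrite /itvU /total_length !big_cons -/(itvU l) -/(total_length l); split.
  rewrite measureU// EFinD; congr (_ + _)%E; last exact: E1.
  have := lebesgue_measure_itv `]p.1, p.2] => /= ->.
  rewrite lte_fin; case: ifPn => //; rewrite -leNgt => p21.
  have -> : p.2 = p.1 by apply/eqP; rewrite eq_le p21.
  by rewrite subrr.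
rewrite Rintegral_setU ?E2//; last exact/disj_set2P.
by apply: integrableS ih => //; exact: measurableU.
Qed.

(** Data are prescribed at the right end, hence primitives that vanish on the right. The integrands
    of the series are zero from [x1] on, so the limit [+oo] has the effect of [x1] without a
    separate case for [x > x1]. *)
Definition tail_integral h x := \int[mu]_(t in `]x, +oo[) h t.

Lemma tailD h x y : mu.-integrable setT (EFin \o h) -> x <= y ->
  tail_integral h x = \int[mu]_(t in `]x, y]) h t + tail_integral h y.
Proof.
move=> ih xy; rewrite /tail_integral (@itv_bndbnd_setU _ _ _ (BRight y))//.
rewrite Rintegral_setU//.
- by apply: integrableS ih => //; exact: measurableU.
- apply/disj_set2P; rewrite -subset0 => z /= [].
  by rewrite !in_itv/= => /andP[_ h1]; rewrite andbT ltNge h1.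
Qed.

(** The increments over a list are at most the integral of [|h|] over the union of its intervals,
    which is small with the measure of that union. *)
Lemma ac_tail h : mu.-integrable setT (EFin \o h) -> abs_cont (tail_integral h).
Proof.
move=> ih e e0; have [d [d0 H]] := integral_normr_continuous ih e0.
exists d => // l le pw ld.
have inh : mu.-integrable setT (EFin \o (fun x => `|h x|)).
  by have := integrable_norm ih; apply: eq_integrable => // x _ /=.
have [E1 E2] := itvU_integral le pw inh.
apply: (@le_lt_trans _ _ (\int[mu]_(x in itvU l) `|h x|)); last first.
  apply: H; first exact: itvU_measurable.
  by rewrite [X in (X < _)%E]E1 lte_fin.
rewrite E2 /total_increment big_seq [leRHS]big_seq; apply: ler_sum => p pl.
rewrite distrC (tailD ih (y := p.2)); last by move/allP : le; apply.
rewrite addrK; apply: le_normr_Rintegral; first exact: measurable_itv.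
by apply: integrableS ih => //; exact: measurable_itv.
Qed.

Lemma ae_is_derive_tail h : mu.-integrable setT (EFin \o h) ->
  {ae mu, forall x, is_derive x 1 (tail_integral h) (- h x)}.
Proof.
move=> ih; have lh : locally_integrable setT h.
  by apply: open_integrable_locally => //; exact: openT.
have ih' y : mu.-integrable [set` `]-oo, y]] (EFin \o h) by apply: integrableS ih.
have := FTC1Ny ih' lh.
apply: filterS; first exact: (ae_filter_ringOfSetsType mu).
move=> x [h1 h2].
have -> : tail_integral h = (fun y => \int[mu]_t h t - \int[mu]_(t in `]-oo, y]) h t).
  apply/funext => y; rewrite /tail_integral -[[set: _]]set_itvNyy.
  rewrite (@itv_bndbnd_setU _ _ -oo%O (BRight y) +oo%O)//.
  rewrite Rintegral_setU// ?addrK//=; first by rewrite addrC addKr.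
    by apply: integrableS ih => //; exact: measurableU.
  apply/disj_set2P; rewrite -subset0 => z /= [].
  by rewrite !in_itv/= => h3; rewrite andbT ltNge h3.
rewrite -[- h x]add0r; apply: is_deriveB.
by apply: DeriveDef; [exact: h1|rewrite -derive1E h2].
Qed.

Lemma normr_tail_le h k x : mu.-integrable setT (EFin \o h) ->
  mu.-integrable setT (EFin \o k) -> (forall t, `|h t| <= k t) ->
    `|tail_integral h x| <= tail_integral k x.
Proof.
move=> ih ik hk.
have ih' : mu.-integrable `]x, +oo[ (EFin \o h) by apply: integrableS ih.
have ik' : mu.-integrable `]x, +oo[ (EFin \o k) by apply: integrableS ik.
apply: le_trans (le_normr_Rintegral _ ih') _ => //.
apply: le_Rintegral => //.
by have := integrable_norm ih'; apply: eq_integrable => // t _ /=.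
Qed.

Lemma tail_ge0 h x : (forall t, 0 <= h t) -> 0 <= tail_integral h x.
Proof. by move=> h0; apply: Rintegral_ge0. Qed.

End tail_integral.

(** * The logarithm of the impedance and its density *)

Section log_impedance.
Context {R : realType}.
Notation mu := (@lebesgue_measure R).
Implicit Types (f g h F : R -> R) (a b c d e x y K : R).

Lemma is_derive0_const f a b : a <= b ->
  (forall x, a <= x <= b -> is_derive x 1 f 0) -> f b = f a.
Proof.
move=> ab H.
have dH x : x \in `]a, b[ -> is_derive x 1 f 0.
  by rewrite in_itv/= => /andP[/ltW ax /ltW xb]; apply: H; rewrite ax.
have cH : {within `[a, b], continuous f}.
  apply/continuous_in_subspaceT => x; rewrite inE/= in_itv/= => xab.
  by have [dx _] := H x xab; exact/differentiable_continuous/derivable1_diffP.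
have [c _] := MVT_segment ab dH cH.
by rewrite mul0r => /eqP; rewrite subr_eq0 => /eqP.
Qed.

(** A vanishing [derive1] alone says nothing about differentiability. But [f] is differentiable
    almost everywhere, so near [x] its derivative is almost everywhere [derive1 f], that is 0, and
    [ac_ae_ftc] makes [f] locally constant. *)
Lemma ac_is_derive0 f x : abs_cont f -> ~ ess_support (derive1 f) x -> is_derive x 1 f 0.
Proof.
move=> acf /existsNP[U /not_implyP[oU /not_implyP[Ux /contrapT nU]]].
have /nbhs_ballP[e /= e0 eU] : nbhs x U by exact: open_nbhs_nbhs.
have xx : x - e / 2 < x + e / 2 by lra.
have [g [ig E gD]] := ac_ftc acf xx.
have FF := ae_filter_ringOfSetsType mu.
have D0 : {ae mu, forall y, x - e / 2 < y < x + e / 2 -> is_derive y 1 f 0}.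
  have : {ae mu, forall y, U y -> (derive1 f) y = 0}.
    apply: negligibleS nU => y /= /not_implyP[Uy /eqP]; split=> //.
  move: gD; apply: filterS2 => y gy Uy yx.
  have [h1 h2] := gy yx.
  rewrite -(Uy _) ?derive1E//; apply: eU => /=; rewrite /ball/=.
  by rewrite ltr_distlC; case/andP: yx => ? ?; apply/andP; split; lra.
have {}E := ac_ae_ftc acf xx D0.
apply: (@near_eq_is_derive _ _ _ (fun=> f (x - e / 2))).
  near=> y; rewrite (E y).
    by rewrite Rintegral_cst// mul0r addr0.
  by apply/andP; split; apply/ltW; near: y; [apply: lt_nbhsr|apply: lt_nbhsl]; lra.
Unshelve. all: by end_near. Qed.

(** Apply [ln (1 + t) <= t] to the quotient of the two points, in both orders. *)
Lemma ln_lipschitz m x y : 0 < m -> m <= x -> m <= y -> `|ln y - ln x| <= m^-1 * `|y - x|.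
Proof.
move=> m0.
have key u v : m <= u -> m <= v -> ln v - ln u <= m^-1 * `|v - u|.
  move=> mu' mv; have u0 : 0 < u by exact: lt_le_trans mu'.
  have v0 : 0 < v by exact: lt_le_trans mv.
  rewrite -ln_div ?posrE//.
  have -> : v / u = 1 + (v - u) / u by field; exact: lt0r_neq0.
  apply: le_trans (le_ln1Dx _) _.
    have : 0 < v / u by exact: divr_gt0.
    have -> : v / u = 1 + (v - u) / u by field; exact: lt0r_neq0.
    by lra.
  apply: (@le_trans _ _ (`|v - u| / u)); first by rewrite ler_wpM2r ?ler_norm ?invr_ge0 ?ltW.
  by rewrite mulrC ler_wpM2r// lef_pV2 ?posrE.
move=> mx my; rewrite ler_norml key// andbT.
by rewrite lerNl opprB distrC key.
Qed.

Variables (x0 x1 : R) (zeta : R -> R).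
Hypothesis hX : x0 < x1.
Hypothesis zeta_gt0 : forall x, 0 < zeta x.
Hypothesis zeta_ac : abs_cont zeta.
Hypothesis zeta_supp : ess_support (derive1 zeta) `<=` `]x0, x1[.

Lemma is_derive_impedance_left x : x <= x0 -> is_derive x 1 zeta 0.
Proof.
move=> xx0; apply: ac_is_derive0 => // /zeta_supp; rewrite /= in_itv/=.
by move=> /andP[]; lra.
Qed.

Lemma is_derive_impedance_right x : x1 <= x -> is_derive x 1 zeta 0.
Proof.
move=> xx0; apply: ac_is_derive0 => // /zeta_supp; rewrite /= in_itv/=.
by move=> /andP[]; lra.
Qed.

Lemma impedance_left x : x <= x0 -> zeta x = zeta x0.
Proof.
move=> xx0; apply/esym/is_derive0_const => // y /andP[_ h].
exact: is_derive_impedance_left.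
Qed.

Lemma impedance_right x : x1 <= x -> zeta x = zeta x1.
Proof.
move=> xx0; apply/is_derive0_const => // y /andP[h _].
exact: is_derive_impedance_right.
Qed.

Lemma impedance_lower_bound : exists2 m, 0 < m & forall x, m <= zeta x.
Proof.
have cH : {within `[x0, x1], continuous zeta}.
  by apply: continuous_subspaceT; exact: ac_continuous.
have [c cX H] := EVT_min (ltW hX) cH.
exists (zeta c) => // x.
have [xx0|x0x] := leP x x0.
  by rewrite (impedance_left xx0) H// in_itv/= lexx ltW.
have [xx1|x1x] := leP x x1; first by rewrite H// in_itv/= xx1 ltW.
by rewrite (impedance_right (ltW x1x)) H// in_itv/= lexx ltW.
Qed.

Lemma impedance_upper_bound : exists M, forall x, zeta x <= M.
Proof.
have cH : {within `[x0, x1], continuous zeta}.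
  by apply: continuous_subspaceT; exact: ac_continuous.
have [c cX H] := EVT_max (ltW hX) cH.
exists (zeta c) => x.
have [xx0|x0x] := leP x x0.
  by rewrite (impedance_left xx0) H// in_itv/= lexx ltW.
have [xx1|x1x] := leP x x1; first by rewrite H// in_itv/= xx1 ltW.
by rewrite (impedance_right (ltW x1x)) H// in_itv/= lexx ltW.
Qed.

Lemma ac_ln_impedance : abs_cont (fun t => ln (zeta t)).
Proof.
have [m m0 mz] := impedance_lower_bound.
by apply: (@ac_lipschitz _ zeta _ m^-1) => // x y; exact: ln_lipschitz.
Qed.

(** [beta] is a genuine integrable representative of [alpha], and it vanishes at every point outside
    [X], as the tail integrals require. The factor [- 2] inverts the [- 1 / 2] in the definition of
    [alpha]. *)
Lemma reflectivity_density : let alpha x := - 2^-1 * derive1 (fun t => ln (zeta t)) x in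
  exists beta : R -> R, [/\ mu.-integrable setT (EFin \o beta),
   forall x, ~ x0 < x < x1 -> beta x = 0,
   {ae mu, forall x, alpha x = beta x} &
   {ae mu, forall x, is_derive x 1 (fun t => ln (zeta t)) (- 2 * beta x)}].
Proof.
move=> alpha; have acL := ac_ln_impedance.
have [g [ig _ gD]] := ac_ftc acL hX.
pose beta := (fun x => - 2^-1 * g x) \_ `]x0, x1[.
have LD : {ae mu, forall x, is_derive x 1 (fun t => ln (zeta t)) (- 2 * beta x)}.
  have FF := ae_filter_ringOfSetsType mu.
  have nx c : {ae mu, forall x : R, x != c}.
    exists [set c]; split=> //; first exact: lebesgue_measure_set1.
    by move=> y /= /negP; rewrite negbK => /eqP.
  have outside x c : (\near x, zeta x = c) -> is_derive x 1 (fun t => ln (zeta t)) 0.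
    move=> H; apply: (@near_eq_is_derive _ _ _ (fun=> ln c)).
      near=> y; congr ln; apply/esym; near: y; exact: H.
    have nx0 := nx x0; have nx1 := nx x1.
  move: gD nx0 nx1; apply: filterS3 => x gx xx0 xx1.
  rewrite /beta patchE; case: ifPn => [|/negP xX].
    rewrite inE/= in_itv/= => xX.
    by have := gx xX; rewrite mulrA mulrNN mulfV ?mul1r// pnatr_eq0.
  rewrite mulr0; have [xlt|xgt|xeq] := ltgtP x x0.
  - apply: (outside _ (zeta x0)); near=> y; apply: impedance_left.
    by apply/ltW; near: y; exact: lt_nbhsl.
  - have [xlt'|xgt'|xeq'] := ltgtP x x1.
    + by exfalso; apply: xX; rewrite inE/= in_itv/= xgt.
    + apply: (outside _ (zeta x1)); near=> y; apply: impedance_right.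
      by apply/ltW; near: y; exact: lt_nbhsr.
    + by rewrite xeq' eqxx in xx1.
  - by rewrite xeq eqxx in xx0.
exists beta; split=> //.
- rewrite /beta -restrict_EFin; apply: (integrable_mkcond _ _).1 => //.
  rewrite (_ : _ \o _ = (fun x => (- 2^-1)%:E * (g x)%:E)%E)//.
  by apply: integrableZl => //; apply: integrableS ig.
- move=> x nX; rewrite /beta patchE; case: ifPn => //.
  by rewrite inE/= in_itv/=.
- have FF := ae_filter_ringOfSetsType mu.
  move: LD; apply: filterS => x [h1 h2]; rewrite /alpha derive1E h2 mulrA.
  by rewrite mulrNN mulVf ?mul1r// pnatr_eq0.
Unshelve. all: by end_near. Qed.

End log_impedance.

(** * Smooth plateaus and mollifiers *)

Section smooth_functions.
Context {R : realType}.
Notation mu := (@lebesgue_measure R).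
Implicit Types (f g h F : R -> R) (a b c d e x y K t : R) (n : nat).

(** Recursion on the order, with the derivative taken inside, lets sums, products and affine
    substitutions be treated by induction without a Leibniz formula for [derive1n]. *)
Fixpoint derivable_times n f : Prop := (forall x, derivable f x 1) /\
  if n is m.+1 then derivable_times m (derive1 f) else True.

Definition smooth f := forall n x, derivable (derive1n n f) x 1.

Lemma derivable_timesP f : (forall n, derivable_times n f) <-> smooth f.
Proof.
split=> [H n x|].
  elim: n f H x => [|n ih] f H x; first by have [] := H 0%N; exact.
  by rewrite derive1Sn; apply: ih => m; have [] := H m.+1.
move=> H n; elim: n f H => [|n ih] f H; first by split=> // x; exact: (H 0%N).
by split=> [x|]; [exact: (H 0%N)|apply: ih => m x; rewrite -derive1Sn; exact: H].
Qed.

Lemma derivable_timesS n f : derivable_times n.+1 f -> derivable_times n f.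
Proof. by elim: n f => [|n ih] f [h1 h2]; split=> //; exact: ih. Qed.

Lemma is_derive1E f x : derivable f x 1 -> is_derive x 1 f (derive1 f x).
Proof. by move=> df; apply: DeriveDef => //; rewrite derive1E. Qed.

Lemma is_derive_derive1 f d x : is_derive x 1 f d -> derive1 f x = d.
Proof. by case=> _ <-; rewrite derive1E. Qed.

Lemma derivable_timesD n f g : derivable_times n f -> derivable_times n g ->
  derivable_times n (fun x => f x + g x).
Proof.
elim: n f g => [|n ih] f g [f1 f2] [g1 g2].
  by split=> [x|//]; exact: derivableD (f1 x) (g1 x).
have E x : is_derive x 1 (fun x => f x + g x) (derive1 f x + derive1 g x).
  by apply: is_deriveD; exact: is_derive1E.
split=> [x|]; first by have [] := E x.
rewrite (_ : derive1 _ = fun x => derive1 f x + derive1 g x); first exact: ih.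
by apply/funext => x; exact: is_derive_derive1.
Qed.

Lemma derivable_timesM n f g : derivable_times n f -> derivable_times n g ->
  derivable_times n (fun x => f x * g x).
Proof.
elim: n f g => [|n ih] f g /[dup] df [f1 f2] /[dup] dg [g1 g2].
  by split=> [x|//]; exact: derivableM (f1 x) (g1 x).
have E x : is_derive x 1 (fun x => f x * g x) (f x * derive1 g x + g x * derive1 f x).
  by apply: is_deriveM; exact: is_derive1E.
split=> [x|]; first by have [] := E x.
rewrite (_ : derive1 _ = fun x => f x * derive1 g x + g x * derive1 f x).
  by apply: derivable_timesD; apply: ih => //; exact: derivable_timesS.
by apply/funext => x; exact: is_derive_derive1.
Qed.

Lemma derivable_times_cst n c : derivable_times n (fun=> c).
Proof.
elim: n c => [|n ih] c; split=> //.
rewrite (_ : derive1 _ = fun=> 0)//; apply/funext => x.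
by apply: is_derive_derive1; exact: is_derive_cst.
Qed.

Lemma is_derive_affine f d k c x : is_derive (k * x + c) 1 f d ->
  is_derive x 1 (fun y => f (k * y + c)) (d * k).
Proof.
move=> h; apply: (@is_derive1_comp _ f (fun y => k * y + c)) => //.
rewrite -[k in is_derive _ _ _ k]addr0; apply: is_deriveD.
by rewrite -[k in is_derive _ _ _ k]mulr1; apply: is_deriveZ.
Qed.

Lemma derivable_times_affine n f k c : derivable_times n f ->
  derivable_times n (fun x => f (k * x + c)).
Proof.
elim: n f => [|n ih] f [f1 f2].
  by split=> [x|//]; have [] := is_derive_affine (is_derive1E (f1 (k * x + c))).
have E x := is_derive_affine (is_derive1E (f1 (k * x + c))).
split=> [x|]; first by have [] := E x.
rewrite (_ : derive1 _ = fun x => derive1 f (k * x + c) * k).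
  by apply: derivable_timesM; [exact: ih|exact: derivable_times_cst].
by apply/funext => x; exact: is_derive_derive1.
Qed.

(** The functions [p(1/x) e^{-1/x}], extended by 0, form a family closed under differentiation;
    smoothness of the classical flat function follows by one induction over all [p]. *)
Definition flat_exp (p : {poly R}) x : R := if 0 < x then p.[x^-1] * expR (- x^-1) else 0.

Lemma exprn_le_expR n : exists2 C, 0 <= C & forall t, 0 <= t -> t ^+ n <= C * expR t.
Proof.
case: n => [|n].
  by exists 1 => // s s0; rewrite mul1r; apply: le_trans (expR_ge1Dx s); rewrite lerDl.
exists (n.+1%:R ^+ n.+1) => [|s s0]; first exact: exprn_ge0.
(* From [y <= expR y] at [y = s / n.+1], raised to the power [n.+1]. *)
rewrite [in expR s](_ : s = n.+1%:R * (s / n.+1%:R)); last first.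
  by rewrite mulrC divfK// pnatr_eq0.
rewrite expRM_natl -exprMn_comm; last exact: mulrC.
have h : s <= n.+1%:R * expR (s / n.+1%:R).
  rewrite -ler_pdivrMl// mulrC; apply: le_trans (expR_ge1Dx _).
  by rewrite lerDr.
by apply: lerXn2r => //; rewrite nnegrE mulr_ge0 ?expR_ge0.
Qed.

Lemma horner_le_expR (p : {poly R}) n : exists2 C, 0 <= C &
  forall t, 0 <= t -> `|p.[t]| * t ^+ n <= C * expR t.
Proof.
elim/poly_ind: p n => [n|p c ih n].
  by exists 0 => // t _; rewrite horner0 normr0 !mul0r.
have [C C0 H] := ih n.+1; have [D D0 H'] := exprn_le_expR n.
exists (C + `|c| * D) => [|t t0]; first by rewrite addr_ge0// mulr_ge0.
rewrite hornerMXaddC mulrDl (le_trans (ler_wpM2r _ (ler_normD _ _))) ?exprn_ge0//.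
rewrite mulrDl lerD//; last by rewrite -mulrA ler_wpM2l// H'.
by rewrite normrM (ger0_norm t0) -mulrA -exprS H.
Qed.

Lemma flat_le (p : {poly R}) : exists2 C, 0 <= C & forall x, `|flat_exp p x| <= C * `|x|.
Proof.
have [C C0 H] := horner_le_expR p 1; exists C => // x; rewrite /flat_exp.
case: ifPn => x0; last by rewrite normr0 mulr_ge0.
have := H x^-1; rewrite invr_ge0 (ltW x0) expr1 => /(_ isT) h.
rewrite normrM expRN normfV !(gtr0_norm (expR_gt0 _)) (gtr0_norm x0).
by rewrite ler_pdivrMr ?expR_gt0// mulrAC -ler_pdivrMr.
Qed.

(** Away from 0 this is the chain rule: the factor ['X ^+ 2] is the [1/x^2] from the derivative of
    [1/x]. At 0 the difference quotient of [flat_exp p] is [flat_exp ('X * p)], which [flat_le]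
    bounds by a multiple of the increment. *)
Lemma is_derive_flat (p : {poly R}) x :
  is_derive x 1 (flat_exp p) (flat_exp ('X ^+ 2 * (p - p^`()%R)) x).
Proof.
have [x0|x0|->] := ltgtP x 0.
- rewrite {2}/flat_exp ltNge (ltW x0) /=.
  apply: (@near_eq_is_derive _ _ _ (fun=> 0)).
  near=> y; rewrite /flat_exp ltNge (_ : y <= 0)//.
  by apply/ltW; near: y; exact: lt_nbhsl.
- apply: (@near_eq_is_derive _ _ _ (fun y => p.[y^-1] * expR (- y^-1))).
    near=> y; rewrite /flat_exp (_ : 0 < y)//.
    by near: y; exact: lt_nbhsr.
  have dV : is_derive x 1 (fun y : R => y^-1) (- x ^- 2).
    have := @is_deriveV R id x 1 1 (lt0r_neq0 x0) (is_derive_id _ _).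
    by rewrite [_ *: _]mulr1.
  have dp := @is_derive1_comp _ (horner p) _ x _ _ (is_derive_poly p x^-1) dV.
  have de := @is_derive1_comp _ expR (fun y => - y^-1) x _ _ (is_derive_expR (- x^-1))
    (is_deriveN dV).
  have := is_deriveM dp de; rewrite /flat_exp x0 => h.
  apply: (is_derive_eq h).
  rewrite /= hornerM hornerXn hornerD hornerN /GRing.scale /=.
  by field; exact: lt0r_neq0.
- have [C C0 H] := flat_le p.
  have fl0 : flat_exp p 0 = 0 by rewrite /flat_exp ltxx.
  have [D D0 H'] := flat_le ('X * p).
  rewrite [X in is_derive _ _ _ X]/flat_exp ltxx.
  suff h : (h^-1 *: (flat_exp p (h + 0) - flat_exp p 0)) @[h --> 0^'] --> (0 : R).
    apply: DeriveDef; last first.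
      apply: cvg_lim => //.
      by apply: cvg_trans h; apply: near_eq_cvg; near=> z; rewrite /= [_ *: 1]mulr1.
    apply/cvg_ex; exists 0.
    by apply: cvg_trans h; apply: near_eq_cvg; near=> z; rewrite /= [_ *: 1]mulr1.
  apply/cvgr0Pnorm_le => e e0; near=> z.
  have -> : z^-1 *: (flat_exp p (z + 0) - flat_exp p 0) = flat_exp ('X * p) z.
    rewrite fl0 subr0 addr0 /GRing.scale /= /flat_exp.
    by case: ifP => _; rewrite ?mulr0// hornerM hornerX mulrA.
  apply: le_trans (H' z) _; apply: (@le_trans _ _ ((D + 1) * `|z|)).
    by rewrite ler_wpM2r// lerDl.
  rewrite -ler_pdivlMl ?ltr_wpDl//; near: z; apply: dnbhs0_le.
  by rewrite mulr_gt0// invr_gt0 ltr_wpDl.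
Unshelve. all: by end_near. Qed.

Lemma derivable_times_flat n (p : {poly R}) : derivable_times n (flat_exp p).
Proof.
elim: n p => [|n ih] p; split=> //; try by move=> x; have [] := is_derive_flat p x.
rewrite (_ : derive1 _ = flat_exp ('X ^+ 2 * (p - p^`()%R)))//.
by apply/funext => x; apply: is_derive_derive1; exact: is_derive_flat.
Qed.

Definition unit_bump x : R := flat_exp 1 x * flat_exp 1 (1 - x).

Lemma derivable_times_bump n : derivable_times n unit_bump.
Proof.
apply: derivable_timesM; first exact: derivable_times_flat.
rewrite (_ : (fun x => _) = (fun x => flat_exp 1 (-1 * x + 1))); last first.
  by apply/funext => x; rewrite mulN1r addrC.
by apply: derivable_times_affine; exact: derivable_times_flat.
Qed.

Lemma bump_ge0 x : 0 <= unit_bump x.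
Proof.
by apply: mulr_ge0; rewrite /flat_exp; case: ifP => // _; rewrite hornerC mul1r expR_ge0.
Qed.

Lemma bump_gt0 x : 0 < x < 1 -> 0 < unit_bump x.
Proof.
move=> /andP[x0 x1]; rewrite /unit_bump /flat_exp x0 subr_gt0 x1 !hornerC !mul1r.
by rewrite mulr_gt0 ?expR_gt0.
Qed.

Lemma bump_eq0 x : ~~ (0 < x < 1) -> unit_bump x = 0.
Proof.
rewrite /unit_bump /flat_exp negb_and => /orP[/negbTE ->|h]; first by rewrite mul0r.
by rewrite subr_gt0 (negbTE h) mulr0.
Qed.

Lemma bump_le1 x : unit_bump x <= 1.
Proof.
have H y : 0 <= flat_exp 1 y <= 1.
  rewrite /flat_exp; case: ifP => [y0|_]; last by rewrite lexx ler01.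
  rewrite hornerC mul1r expR_ge0 /= -[leRHS]expR0 ler_expR oppr_le0 invr_ge0.
  exact: ltW.
have /andP[h1 h2] := H x; have /andP[h3 h4] := H (1 - x).
by rewrite /unit_bump -[leRHS]mulr1 ler_pM.
Qed.

Lemma derivable_continuous f : (forall x, derivable f x 1) -> continuous f.
Proof. by move=> df x; exact/differentiable_continuous/derivable1_diffP. Qed.

Lemma continuous_bump : continuous unit_bump.
Proof. by apply: derivable_continuous; have [] := derivable_times_bump 0. Qed.

(** The lower limit is -1 rather than 0 so that 0, where the bump begins, lies strictly inside the
    range in which the integral can be differentiated. *)
Definition bump_int x := \int[mu]_(t in `]-1, x]) unit_bump t.

Lemma is_derive_bump_int x : -1 < x -> is_derive x 1 bump_int (unit_bump x).
Proof. by move=> x1; apply: is_derive_integral => //; exact: continuous_bump. Qed.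

Lemma bump_int_eq0 x : x <= 0 -> bump_int x = 0.
Proof.
move=> x0; rewrite /bump_int (@eq_Rintegral _ _ _ _ _ (fun=> 0)); last first.
  move=> t; rewrite inE/= in_itv/= => /andP[_ tx]; apply: bump_eq0.
  by rewrite negb_and -leNgt (le_trans tx).
by rewrite Rintegral_cst// mul0r.
Qed.

Lemma is_derive_bump_intT x : is_derive x 1 bump_int (unit_bump x).
Proof.
have [x0|x0] := ltP x 0; last by apply: is_derive_bump_int; lra.
rewrite bump_eq0; last by rewrite negb_and -leNgt ltW.
apply: (@near_eq_is_derive _ _ _ (fun=> 0)).
near=> y; rewrite bump_int_eq0//; apply/ltW; near: y; exact: lt_nbhsl.
Unshelve. all: by end_near. Qed.

Lemma bump_int1_gt0 : 0 < bump_int 1.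
Proof.
have c : {within `[0, 1], continuous bump_int}.
  apply: continuous_subspaceT; apply: derivable_continuous => x.
  by have [] := is_derive_bump_intT x.
have [c' /bump_gt0 c'0] := MVT ltr01 (fun x _ => is_derive_bump_intT x) c.
by rewrite (bump_int_eq0 (lexx 0)) !subr0 mulr1 => ->.
Qed.

Lemma bump_int_ge1 x : 1 <= x -> bump_int x = bump_int 1.
Proof.
move=> x1; apply: is_derive0_const => // y /andP[y1 _].
have := is_derive_bump_intT y; rewrite bump_eq0//.
by rewrite negb_and -(leNgt 1) y1 orbT.
Qed.

Lemma bump_int_nondecreasing x y : x <= y -> bump_int x <= bump_int y.
Proof.
move=> xy; have c : {within `[x, y], continuous bump_int}.
  apply: continuous_subspaceT; apply: derivable_continuous => z.
  by have [] := is_derive_bump_intT z.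
have [z _ h] := MVT_segment xy (fun x _ => is_derive_bump_intT x) c.
by rewrite -subr_ge0 h mulr_ge0 ?bump_ge0 ?subr_ge0.
Qed.

Definition smooth_step x := bump_int x / bump_int 1.

Lemma step_le0 x : x <= 0 -> smooth_step x = 0.
Proof. by move=> x0; rewrite /smooth_step bump_int_eq0// mul0r. Qed.

Lemma step_ge1 x : 1 <= x -> smooth_step x = 1.
Proof. by move=> x1; rewrite /smooth_step bump_int_ge1// divff// gt_eqF// bump_int1_gt0. Qed.

Lemma step_nondecreasing x y : x <= y -> smooth_step x <= smooth_step y.
Proof.
by move=> xy; rewrite ler_wpM2r ?invr_ge0 ?bump_int_nondecreasing// ltW// bump_int1_gt0.
Qed.

Lemma step_itv x : 0 <= smooth_step x <= 1.
Proof.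
apply/andP; split.
  have [/step_le0 ->//|/ltW/step_nondecreasing] := leP x 0.
  by rewrite step_le0.
have [/step_nondecreasing|/ltW/step_ge1 ->//] := leP x 1.
by rewrite (step_ge1 (lexx 1)).
Qed.

Lemma is_derive_step x : is_derive x 1 smooth_step (unit_bump x / bump_int 1).
Proof.
have := @is_deriveZ _ _ _ _ (bump_int 1)^-1 x 1 _ (is_derive_bump_intT x).
rewrite /GRing.scale /= mulrC => h.
rewrite (_ : smooth_step = (bump_int 1)^-1 \*: bump_int)//.
by apply/funext => y; rewrite /smooth_step mulrC.
Qed.

Lemma derivable_times_step n : derivable_times n smooth_step.
Proof.
case: n => [|n]; split=> //; try by move=> x; have [] := is_derive_step x.
rewrite (_ : derive1 _ = fun x => unit_bump x * (bump_int 1)^-1).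
    apply: derivable_timesM; first exact: derivable_times_bump.
    exact: derivable_times_cst.
  by apply/funext => x; apply: is_derive_derive1; exact: is_derive_step.
Qed.

(** A rise on [[a, a + e]] minus a rise on [[b, b + e]], written in affine form to fit
    [derivable_times_affine]. *)
Definition plateau a b e x :=
  smooth_step (e^-1 * x + - (a / e)) + -1 * smooth_step (e^-1 * x + - (b / e)).

(** The derivative of the rescaled step: of integral 1 and supported to the right of [a], on
    [[a, a + e]]. *)
Definition mollifier a e x := unit_bump ((x - a) / e) / (bump_int 1 * e).

Lemma smooth_plateau a b e : smooth (plateau a b e).
Proof.
apply/derivable_timesP => n; apply: derivable_timesD.
  by apply: derivable_times_affine; exact: derivable_times_step.
apply: derivable_timesM; first exact: derivable_times_cst.
by apply: derivable_times_affine; exact: derivable_times_step.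
Qed.

Lemma derive1_plateau a b e x :
  derive1 (plateau a b e) x = mollifier a e x - mollifier b e x.
Proof.
apply: is_derive_derive1.
have h1 := is_derive_affine (is_derive_step (e^-1 * x + - (a / e))).
have h2 := is_derive_affine (is_derive_step (e^-1 * x + - (b / e))).
have := is_deriveD h1 (@is_deriveZ _ _ _ _ (-1) x 1 _ h2) => h.
apply: is_derive_eq h _.
rewrite /mollifier /GRing.scale /= mulN1r.
have E c : e^-1 * x - c / e = (x - c) / e by rewrite mulrBl (mulrC x).
by rewrite !E !invfM -!mulrA.
Qed.

Lemma plateau_eq0 a b e x : 0 < e -> a <= b -> ~~ (a < x < b + e) -> plateau a b e x = 0.
Proof.
move=> e0 ab.
have E c : e^-1 * x - c / e = (x - c) / e by rewrite mulrBl (mulrC x).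
rewrite /plateau !E negb_and -!leNgt => /orP[xa|xb].
  rewrite !step_le0 ?mulr0 ?addr0// pmulr_lle0 ?invr_gt0// subr_le0//.
  exact: le_trans ab.
by rewrite !step_ge1 ?ler_pdivlMr ?mul1r//; lra.
Qed.

Lemma test_function_plateau a b e : 0 < e -> a <= b -> test_function (plateau a b e).
Proof.
move=> e0 ab; split; first exact: smooth_plateau.
apply: (@subclosed_compact _ _ `[a, b + e]); first exact: closed_closure.
  exact: segment_compact.
have /closure_id -> : closed `[a, b + e]%classic by exact: itv_closed.
apply: closureS => x /= px0; rewrite in_itv/=.
have [/andP[/ltW -> /ltW ->]//|/plateau_eq0 h] := boolP (a < x < b + e).
by rewrite h ?eqxx in px0.
Qed.

End smooth_functions.

(** * Weak and classical solutions *)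

Section weak_derivatives.
Context {R : realType}.
Notation mu := (@lebesgue_measure R).
Implicit Types (f g h F u v w z phi : R -> R) (a b c d e x y K t : R) (n : nat).

Lemma dominated_Rintegral (f_ : nat -> R -> R) f g :
  (forall n, measurable_fun setT (f_ n)) -> measurable_fun setT f ->
  mu.-integrable setT (EFin \o g) -> (forall n x, `|f_ n x| <= g x) ->
  (forall x, f_ n x @[n --> \oo] --> f x) ->
  \int[mu]_x f_ n x @[n --> \oo] --> \int[mu]_x f x.
Proof.
move=> mf_ mf ig fg ff.
have FF := ae_filter_ringOfSetsType mu.
have [] := @dominated_convergence _ _ _ mu setT measurableT
  (fun n => EFin \o f_ n) (EFin \o f) (EFin \o g).
- by move=> n; apply/measurable_EFinP; exact: mf_.
- by apply/measurable_EFinP; exact: mf.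
- by apply: aeW => x _; apply: cvg_EFin; [exact: nearW|exact: ff].
- exact: ig.
- by apply: aeW => x n _; rewrite lee_fin.
move=> i1 _ i3; apply: fine_cvg; rewrite fineK//.
exact: integrable_fin_num.
Qed.

Lemma integrable_fun_scale (D : set R) k f : measurable D ->
  mu.-integrable D (EFin \o f) -> mu.-integrable D (EFin \o (fun x => k * f x)).
Proof.
move=> mD fi; rewrite (_ : _ \o _ = (fun x => k%:E * (f x)%:E)%E)//.
exact: integrableZl.
Qed.

Definition locally_integrable_fun f := measurable_fun [set: R] f /\
  forall a b, mu.-integrable `[a, b] (EFin \o f).

Lemma continuous_locally_integrable f : continuous f -> locally_integrable_fun f.
Proof.
move=> cf; split; first exact: continuous_measurable_fun.
move=> a b; apply: continuous_compact_integrable; first exact: segment_compact.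
exact: continuous_subspaceT.
Qed.

Lemma integrable_dominated f g : measurable_fun [set: R] f ->
  mu.-integrable setT (EFin \o g) -> (forall x, `|f x| <= g x) ->
  mu.-integrable setT (EFin \o f).
Proof.
move=> mf ig fg; apply: le_integrable ig => //; first exact/measurable_EFinP.
by move=> x _ /=; rewrite lee_fin (le_trans (fg x))// ler_norm.
Qed.

Lemma locally_integrableM f g a b K : locally_integrable_fun f ->
  measurable_fun [set: R] g -> (forall x, `|g x| <= K) ->
  (forall x, ~~ (a <= x <= b) -> g x = 0) ->
  mu.-integrable setT (EFin \o (fun x => f x * g x)).
Proof.
move=> [mf lf] mg gK g0.
have i1 : mu.-integrable setT (EFin \o (fun x => K * `|(f \_ `[a, b]) x|)).
  rewrite (_ : _ \o _ = (fun x => K%:E * (`|(f \_ `[a, b]) x|)%:E)%E)//.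
  apply: integrableZl => //.
  have : mu.-integrable setT (EFin \o (f \_ `[a, b])).
    rewrite -restrict_EFin; apply: (integrable_mkcond _ _).1 => //; exact: lf.
  move=> /integrable_norm; exact.
apply: integrable_dominated i1 _ => //; first exact: measurable_funM.
move=> x; rewrite normrM patchE mulrC; case: ifPn => [_|].
  by rewrite ler_wpM2r.
move/negP; rewrite inE/= in_itv/= => /negP/g0 ->.
by rewrite !normr0 mul0r mulr0.
Qed.

Lemma locally_integrable_funP f : locally_integrable_fun f -> locally_integrable setT f.
Proof.
move=> [mf lf]; split=> //; first exact: openT.
move=> A _ cA; have [M [_ hM]] := compact_bounded cA.
have AM : A `<=` `[- (M + 1), M + 1].
  by move=> x Ax; rewrite /= in_itv/= -ler_norml; apply: hM => //; rewrite ltrDl.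
have /integrableP[_] := lf (- (M + 1)) (M + 1).
apply: le_lt_trans; apply: ge0_subset_integral => //.
- exact: compact_measurable.
- apply: measurable_funTS; apply/measurable_EFinP => /=.
  by apply: measurableT_comp.
Qed.

Lemma locally_integrable_dist f c a b : locally_integrable_fun f ->
  mu.-integrable `[a, b] (EFin \o (fun y => `|f y - c|)).
Proof.
move=> [mf lf].
have ic : mu.-integrable `[a, b] (EFin \o cst c).
  apply: continuous_compact_integrable; first exact: segment_compact.
  exact: cst_continuous.
have iB : mu.-integrable `[a, b] ((EFin \o f) \- (EFin \o cst c))%E.
  exact: integrableB.
have := integrable_norm iB.
by apply: eq_integrable.
Qed.

Lemma lebesgue_pt_cvg f x : locally_integrable_fun f -> lebesgue_pt f x ->
  n.+1%:R * \int[mu]_(y in ball x n.+1%:R^-1) `|f y - f x| @[n --> \oo] --> (0 : R).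
Proof.
move=> lf fx.
have inv0 : (n.+1%:R^-1 : R) @[n --> \oo] --> (0:R)^'+.
  move=> U HU.
  have H : \forall n \near \oo, 0 < @harmonic R n -> U (harmonic n) := cvg_harmonic HU.
  by apply: filterS H => n; apply; exact: harmonic_gt0.
have := cvg_comp _ _ inv0 fx => /fine_cvgP[_ /=].
move=> h.
(* A ball of radius [r] has measure [2 r]; the factor 2 turns the average into the scaled integral
   of the statement. *)
have {}h : 2 * fine (davg f x n.+1%:R^-1) @[n --> \oo] --> (0 : R).
  rewrite -[X in _ --> X](mulr0 (2 : R)).
  by apply: cvgM; [exact: cvg_cst|exact: h].
apply: cvg_trans h; apply: near_eq_cvg; near=> n.
rewrite /= /davg /iavg lebesgue_measure_ball// inver mulrn_eq0/= invr_eq0 pnatr_eq0/=.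
rewrite fineM//; last first.
  apply: integrable_fin_num => //; first exact: measurable_ball.
  apply: integrableS (locally_integrable_dist (f x) (x - n.+1%:R^-1) (x + n.+1%:R^-1) lf).
  - exact: measurable_itv.
  - exact: measurable_ball.
  - by rewrite ball_itv; apply: subset_itv_oo_cc.
rewrite /= mulrA; congr (_ * _).
by rewrite -[_^-1 *+ 2]mulr_natl invfM invrK mulrA mulfV ?mul1r// pnatr_eq0.
Unshelve. all: by end_near. Qed.

Lemma mollifier_ge0 a e x : 0 < e -> 0 <= mollifier a e x.
Proof. by move=> e0; rewrite divr_ge0 ?bump_ge0// ltW// mulr_gt0 ?bump_int1_gt0. Qed.

Lemma mollifier_le a e x : 0 < e -> mollifier a e x <= (bump_int 1)^-1 / e.
Proof.
move=> e0; rewrite /mollifier invfM mulrA ler_wpM2r ?invr_ge0 ?(ltW e0)//.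
by rewrite ler_piMl ?bump_le1// invr_ge0 ltW// bump_int1_gt0.
Qed.

Lemma mollifier_eq0 a e x : 0 < e -> ~~ (a < x < a + e) -> mollifier a e x = 0.
Proof.
move=> e0 H; rewrite /mollifier bump_eq0 ?mul0r//; apply: contra H.
by rewrite pmulr_lgt0 ?invr_gt0// subr_gt0 ltr_pdivrMr// mul1r ltrBlDl.
Qed.

Lemma mollifierE a e : mollifier a e =
  (fun x => unit_bump (e^-1 * x + - (a / e)) * (bump_int 1 * e)^-1).
Proof. by apply/funext => x; rewrite /mollifier mulrBl (mulrC e^-1). Qed.

Lemma continuous_mollifier a e : continuous (mollifier a e).
Proof.
rewrite mollifierE; apply: derivable_continuous.
have [] // : derivable_times 0 (fun x => unit_bump (e^-1 * x + - (a / e)) * (bump_int 1 * e)^-1).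
apply: derivable_timesM; last exact: derivable_times_cst.
by apply: derivable_times_affine; exact: derivable_times_bump.
Qed.

Lemma Rintegral_continuous_FTC2 F f a b : a < b -> continuous f ->
  (forall x, is_derive x 1 F (f x)) -> \int[mu]_(x in `[a, b]) f x = F b - F a.
Proof.
move=> ab cf FD; rewrite /Rintegral.
have cF : continuous F by apply: derivable_continuous => x; have [] := FD x.
rewrite (continuous_FTC2 (F := F))//.
- exact: continuous_subspaceT.
- split=> [x _||]; first by have [] := FD x.
    by apply: cvg_at_right_filter; exact: cF.
  by apply: cvg_at_left_filter; exact: cF.
- by move=> x _; exact: is_derive_derive1.
Qed.

Lemma Rintegral_support f a b : (forall x, ~~ (a <= x <= b) -> f x = 0) ->
  \int[mu]_x f x = \int[mu]_(x in `[a, b]) f x.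
Proof.
move=> f0; rewrite [RHS]Rintegral_mkcond; apply: eq_Rintegral => x _.
rewrite patchE; case: ifPn => // /negP; rewrite inE/= in_itv/= => /negP.
exact: f0.
Qed.

Lemma integral_mollifier a e : 0 < e -> \int[mu]_x mollifier a e x = 1.
Proof.
move=> e0; rewrite (@Rintegral_support _ a (a + e)); last first.
  move=> x H; apply: mollifier_eq0 => //; apply: contra H => /andP[].
  by move=> /ltW -> /ltW ->.
have FD x : is_derive x 1 (fun x => smooth_step (e^-1 * x + - (a / e))) (mollifier a e x).
  have := is_derive_affine (is_derive_step (e^-1 * x + - (a / e))).
  by rewrite mollifierE invfM mulrA.
have aae : a < a + e by rewrite ltrDl.
rewrite (Rintegral_continuous_FTC2 aae (@continuous_mollifier a e) FD).
have E c : e^-1 * c - a / e = (c - a) / e by rewrite mulrBl (mulrC c).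
rewrite !E subrr mul0r (step_le0 (lexx 0)) subr0 addrAC subrr add0r.
by rewrite divff ?gt_eqF// step_ge1.
Qed.

(** Since the mollifier has integral 1, the error is at most the integral of [|f - f a|] against it.
    It is bounded by [1 / (bump_int 1 * e)] and supported in the ball of radius [e], so a constant
    times the average of [|f - f a|] over that ball dominates. *)
Lemma mollifier_cvg f a : locally_integrable_fun f -> lebesgue_pt f a ->
  \int[mu]_x (f x * mollifier a n.+1%:R^-1 x) @[n --> \oo] --> f a.
Proof.
move=> lf fa; have h := lebesgue_pt_cvg lf fa.
have {}h : (bump_int 1)^-1 * (n.+1%:R * \int[mu]_(y in ball a n.+1%:R^-1) `|f y - f a|)
    @[n --> \oo] --> (0 : R).
  rewrite -[X in _ --> X](mulr0 ((bump_int 1)^-1 : R)).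
  by apply: cvgM; [exact: cvg_cst|exact: h].
apply/cvgrPdist_le => e e0.
move/cvgr0Pnorm_le : h => /(_ e e0); apply: filterS => n h.
set d := n.+1%:R^-1 in h *; have d0 : 0 < d by rewrite invr_gt0.
have mo : measurable_fun [set: R] (mollifier a d).
  by apply: continuous_measurable_fun; exact: continuous_mollifier.
have mob x : `|mollifier a d x| <= (bump_int 1)^-1 / d.
  by rewrite ger0_norm ?mollifier_ge0// mollifier_le.
have mo0 x : ~~ (a <= x <= a + d) -> mollifier a d x = 0.
  move=> H; apply: mollifier_eq0 => //; apply: contra H => /andP[].
  by move=> /ltW -> /ltW ->.
have i1 := locally_integrableM lf mo mob mo0.
have i2 := locally_integrableM (continuous_locally_integrable (@cst_continuous _ _ (f a)))
  mo mob mo0.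
rewrite distrC -[X in `|_ - X|]mulr1 -(integral_mollifier a d0).
rewrite -RintegralZl// -?RintegralB//; last first.
  have := locally_integrableM (continuous_locally_integrable (@cst_continuous _ _ (1 : R)))
  mo mob mo0.
  by apply: eq_integrable => // x _; rewrite /= mul1r.
apply: le_trans h; apply: le_trans (ler_norm _).
have iB : mu.-integrable setT
    (EFin \o (fun x => f x * mollifier a d x - f a * mollifier a d x)).
  by have := integrableB measurableT i1 i2; apply: eq_integrable.
apply: le_trans (le_normr_Rintegral _ iB) _ => //.
have idist : mu.-integrable (ball a d) (EFin \o (fun y => `|f y - f a|)).
  apply: integrableS (locally_integrable_dist (f a) (a - d) (a + d) lf).
  - exact: measurable_itv.
  - exact: measurable_ball.
  - by rewrite ball_itv; apply: subset_itv_oo_cc.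
rewrite mulrA -RintegralZl//; last exact: measurable_ball.
rewrite [leRHS]Rintegral_mkcond; apply: le_Rintegral => //.
- by have := integrable_norm iB; apply: eq_integrable.
- rewrite -restrict_EFin; apply: (integrable_mkcond _ _).1 => //.
    exact: measurable_ball.
  by apply: integrable_fun_scale => //; exact: measurable_ball.
- move=> x _; rewrite -mulrBl normrM patchE; case: ifPn => [_|].
    rewrite mulrC ler_wpM2r//; apply: le_trans (mob x) _.
    by rewrite /d invrK.
  move/negP; rewrite inE ball_itv/= in_itv/= => /negP H.
  rewrite mollifier_eq0 ?normr0 ?mulr0//; apply: contra H => /andP[h1 h2].
  by rewrite h2 andbT; lra.
Qed.

End weak_derivatives.

(** * Weak solutions are classical *)

Section classical_solutions.
Context {R : realType}.
Notation mu := (@lebesgue_measure R).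
Implicit Types (f g h F u v w z phi zeta : R -> R) (a b c d e s x y K t : R) (n : nat).

Lemma smooth_derivable phi x : smooth phi -> derivable phi x 1.
Proof. by move=> sphi; exact: (sphi 0%N). Qed.

Lemma smooth_continuous phi : smooth phi -> continuous phi.
Proof. by move=> sphi; apply: derivable_continuous => x; exact: smooth_derivable. Qed.

Lemma smooth_derive1_continuous phi : smooth phi -> continuous (derive1 phi).
Proof. by move=> sphi; apply: derivable_continuous => x; exact: (sphi 1%N). Qed.

Lemma test_function_support phi : test_function phi ->
  exists2 M, 0 < M & forall x, ~~ (- M < x < M) -> phi x = 0 /\ derive1 phi x = 0.
Proof.
move=> [sphi cphi]; have [M [_ hM]] := compact_bounded cphi.
have h x : M + 1 < `|x| -> phi x = 0.
  move=> Mx; apply: contrapT => /eqP px.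
  have : closure [set x | phi x != 0] x by exact: subset_closure.
  move=> /(hM (M + 1)) /=; rewrite ltrDl ltr01 => /(_ isT); lra.
pose N := Num.max (M + 2) 1.
exists N; first by rewrite lt_max ltr01 orbT.
move=> x; rewrite -ltr_norml -leNgt ge_max => /andP[Mx _].
have Mx' : M + 1 < `|x| by lra.
split; first exact: h.
apply: is_derive_derive1; apply: (@near_eq_is_derive _ _ _ (fun=> 0)).
near=> y; rewrite h//; near: y.
have /cvgr_gt : `|y| @[y --> x] --> `|x| by apply: cvg_norm; exact: cvg_id.
exact.
Unshelve. all: by end_near. Qed.

Lemma weak_ftc w z : locally_integrable_fun w -> locally_integrable_fun z ->
  (forall phi, test_function phi ->
    \int[mu]_x (w x * derive1 phi x) = - \int[mu]_x (z x * phi x)) ->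
  forall a b, a < b -> lebesgue_pt w a -> lebesgue_pt w b ->
  w b - w a = \int[mu]_(t in `]a, b]) z t.
Proof.
move=> lw lz H a b ab wa wb.
pose e n : R := n.+1%:R^-1.
have e0 n : 0 < e n by rewrite invr_gt0.
have e1 n : e n <= 1 by rewrite invf_le1// ler1n.
have pl n : measurable_fun [set: R] (plateau a b (e n)).
  by apply: continuous_measurable_fun; apply: smooth_continuous; exact: smooth_plateau.
have plb n x : `|plateau a b (e n) x| <= 1.
  rewrite /plateau mulN1r.
  have /andP[h1 h2] := step_itv ((e n)^-1 * x - a / e n).
  have /andP[h3 h4] := step_itv ((e n)^-1 * x - b / e n).
  by rewrite ler_norml; apply/andP; split; lra.
(* As [e n <= 1], all plateaus live in one compact interval, which provides the dominating function
   below. *)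
have pl0 n x : ~~ (a <= x <= b + 1) -> plateau a b (e n) x = 0.
  move=> nx; apply: plateau_eq0 => //; first exact: ltW.
  apply: contra nx => /andP[/ltW -> /= h]; have := e1 n; lra.
have lhs : \int[mu]_x (w x * derive1 (plateau a b (e n)) x) @[n --> \oo] --> w a - w b.
  have im c n : mu.-integrable setT (EFin \o (fun x => w x * mollifier c (e n) x)).
    apply: (@locally_integrableM _ w _ c (c + e n) ((bump_int 1)^-1 / e n)) => //.
    - by apply: continuous_measurable_fun; exact: continuous_mollifier.
    - by move=> x; rewrite ger0_norm ?mollifier_ge0// mollifier_le.
    - move=> x nx; apply: mollifier_eq0 => //; apply: contra nx => /andP[].
      by move=> /ltW -> /ltW ->.
  rewrite (_ : (fun n => _) = (fun n => \int[mu]_x (w x * mollifier a (e n) x) -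
     \int[mu]_x (w x * mollifier b (e n) x))).
    by apply: cvgB; apply: mollifier_cvg.
  apply/funext => n; rewrite -RintegralB//; apply: eq_Rintegral => x _.
  by rewrite derive1_plateau mulrBr.
have rhs : \int[mu]_x (z x * plateau a b (e n) x) @[n --> \oo] -->
    \int[mu]_(t in `]a, b]) z t.
  rewrite [X in _ --> X]Rintegral_mkcond.
  have [mz iz] := lz.
  apply: (@dominated_Rintegral _ _ _ (fun x => `|(z \_ `[a, b + 1]) x|)).
  - by move=> n; apply: measurable_funM.
  - by apply: (measurable_restrictT _ _).1 => //; exact: measurable_funTS.
  - have : mu.-integrable setT (EFin \o (z \_ `[a, b + 1])).
      by rewrite -restrict_EFin; apply: (integrable_mkcond _ _).1 => //; exact: iz.
    by move=> /integrable_norm; apply: eq_integrable.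
  - move=> n x; rewrite normrM patchE; case: ifPn => [_|/negP].
      by rewrite -[leRHS]mulr1 ler_wpM2l.
    by rewrite inE/= in_itv/= => /negP /pl0 ->; rewrite normr0 mulr0.
  (* The limit is exactly the indicator of []a, b]]: a plateau is 0 up to [a], and its descent
     begins only after [b]. *)
  - move=> x; rewrite patchE.
    have E n c : (e n)^-1 * x - c / e n = (x - c) / e n by rewrite mulrBl (mulrC x).
    have small d : 0 < d -> \forall n \near \oo, e n <= d.
      by move=> d0; have /cvgr_le := @cvg_harmonic R => /(_ d d0); exact.
    have [xa|ax] := leP x a.
      rewrite memNset; last by rewrite /= in_itv/= => /andP[]; lra.
      apply: cvg_near_cst; near=> n; rewrite plateau_eq0 ?mulr0//.
        exact: ltW.
      by rewrite negb_and -leNgt xa.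
    have [xb|bx] := leP x b.
      rewrite mem_set; last by rewrite /= in_itv/= ax.
      apply: cvg_near_cst; near=> n; rewrite /plateau !E.
      rewrite (@step_ge1 _ ((x - a) / e n)) ?(@step_le0 _ ((x - b) / e n)).
      + by rewrite mulr0 addr0 mulr1.
      + by rewrite pmulr_lle0 ?invr_gt0// subr_le0.
      + rewrite ler_pdivlMr// mul1r; near: n; apply: small; lra.
    rewrite memNset; last by rewrite /= in_itv/= => /andP[]; lra.
    apply: cvg_near_cst; near=> n; rewrite plateau_eq0 ?mulr0//; first exact: ltW.
    rewrite negb_and -!leNgt; apply/orP; right.
    rewrite -lerBrDl; near: n; apply: small; lra.
have {}lhs : (- \int[mu]_x (z x * plateau a b (e n) x)) @[n --> \oo] --> w a - w b.
  apply: cvg_trans lhs; apply: near_eq_cvg; near=> n.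
  by rewrite H//; apply: test_function_plateau => //; exact: ltW.
have E : w a - w b = - \int[mu]_(t in `]a, b]) z t.
  by apply: (cvg_unique (@Rhausdorff R) lhs); exact: cvgN rhs.
lra.
Unshelve. all: by end_near. Qed.

Lemma continuous_primitive z : continuous z ->
  exists Z : R -> R, forall x, is_derive x 1 Z (z x).
Proof.
(* The signed integral from 0: one of the two domains is always empty. *)
move=> cz; pose Z x := \int[mu]_(t in `]0, x]) z t - \int[mu]_(t in `]x, 0]) z t.
have [_ iz] := continuous_locally_integrable cz.
have iz' a b : mu.-integrable `]a, b] (EFin \o z).
  apply: integrableS (iz a b); [exact: measurable_itv|exact: measurable_itv|].
  by apply: subset_itvr; rewrite bnd_simp.
have add a b c : a <= b -> b <= c -> \int[mu]_(t in `]a, c]) z t =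
    \int[mu]_(t in `]a, b]) z t + \int[mu]_(t in `]b, c]) z t.
  move=> ab bc; rewrite (@itv_bndbnd_setU _ _ _ (BRight b)) ?bnd_simp//.
  rewrite Rintegral_setU//.
  - by rewrite -itv_bndbnd_setU ?bnd_simp.
  - apply/disj_set2P; rewrite -subset0 => y /= [].
    by rewrite !in_itv/= => /andP[_ h1]; rewrite ltNge h1.
have e0 a b : b <= a -> \int[mu]_(t in `]a, b]) z t = (0 : R).
  move=> ba; have -> : `]a, b]%classic = set0.
    by apply: set_itv_ge; rewrite bnd_simp -leNgt.
  by rewrite Rintegral_set0.
have ZE a x : a <= 0 -> a <= x ->
    Z x = \int[mu]_(t in `]a, x]) z t - \int[mu]_(t in `]a, 0]) z t.
  move=> a0 ax; rewrite /Z; have [x0|x0] := leP x 0.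
    by rewrite (e0 0 x x0) (add a x 0 ax x0) opprD addrA subrr.
  by rewrite (e0 x 0 (ltW x0)) (add a 0 x a0 (ltW x0)) subr0 addrAC subrr add0r.
exists Z => x; pose a := Num.min x 0 - 1.
have [a0 ax] : a < 0 /\ a < x.
  by clear; rewrite /a /Num.min; case: ifPn; rewrite -?leNgt; split; lra.
have h : is_derive x 1
    (fun y => \int[mu]_(t in `]a, y]) z t - \int[mu]_(t in `]a, 0]) z t) (z x).
  by rewrite -[z x]subr0; apply: is_deriveB; exact: is_derive_integral.
apply: near_eq_is_derive h; near=> y; rewrite -ZE ?(ltW a0)//.
by apply/ltW; near: y; exact: lt_nbhsr.
Unshelve. all: by end_near. Qed.

(** Here [s] stands for [sigma ^+ 2]. As it is real, the real and imaginary parts of a complex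
    solution satisfy this separately. *)
Definition weak_solution zeta s u := continuous u /\
  exists v, [/\ locally_integrable_fun v,
    forall phi, test_function phi ->
      \int[mu]_x (u x * derive1 phi x) = - \int[mu]_x (v x * phi x) &
    forall phi, test_function phi ->
      \int[mu]_x (zeta x * v x * derive1 phi x) = \int[mu]_x (s * zeta x * u x * phi x)].

Definition classical_solution zeta s u := exists w, forall x,
  is_derive x 1 u (w x / zeta x) /\ is_derive x 1 w (- (s * zeta x * u x)).

(** The flux [zeta v] is known only almost everywhere. Anchored at one of its Lebesgue points [c],
    the primitive [w] of [- s zeta u] agrees with it at all its Lebesgue points, so [v = w / zeta]
    almost everywhere. Since [u] is an integral of [v], it is also one of the continuous
    [w / zeta]. *)
Lemma weak_solution_classical zeta s u : continuous zeta -> (forall x, 0 < zeta x) ->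
  weak_solution zeta s u -> classical_solution zeta s u.
Proof.
move=> cz z0 [cu [v [lv uv zv]]].
pose z x := - (s * zeta x * u x).
have ctz : continuous z.
  by move=> x; apply: cvgN; apply: cvgM; [apply: cvgM; [exact: cvg_cst|exact: cz]|exact: cu].
have lz := continuous_locally_integrable ctz.
have lzv : locally_integrable_fun (fun x => zeta x * v x).
  have [mv iv] := lv; split.
    by apply: measurable_funM => //; exact: continuous_measurable_fun.
  move=> a b.
  have [K K0 zK] : exists2 K, 0 < K & forall x, x \in `[a, b] -> `|zeta x| <= K.
    have [ba|ab] := ltP b a.
      exists 1 => // x; rewrite in_itv/= => /andP[]; lra.
    have cW : {within `[a, b], continuous zeta} by exact: continuous_subspaceT.
    have [c _ Hc] := EVT_max ab cW.
    by exists (zeta c) => // x xab; rewrite gtr0_norm// Hc.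
  have iK : mu.-integrable `[a, b] (EFin \o (fun x => K * `|v x|)).
    apply: integrable_fun_scale => //.
    by have := integrable_norm (iv a b); apply: eq_integrable.
  apply: le_integrable iK => //.
    apply/measurable_EFinP; apply: measurable_funM; apply: measurable_funTS => //.
    exact: continuous_measurable_fun.
  move=> x xab /=; rewrite lee_fin normrM [leRHS]ger0_norm; last first.
    by rewrite mulr_ge0// ltW.
  by rewrite ler_wpM2r// zK.
have lpt c : lebesgue_pt u c.
  apply: (@continuous_lebesgue_pt _ u c [set: R]).
  - by split=> //; exact: openT.
  - exact: measurableT.
  - exact: continuous_measurable_fun.
  - exact: cu.
have uE a b : a < b -> u b - u a = \int[mu]_(t in `]a, b]) v t.
  move=> ab; apply: weak_ftc => //; exact: continuous_locally_integrable.
have wE a b : a < b -> lebesgue_pt (fun x => zeta x * v x) a ->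
    lebesgue_pt (fun x => zeta x * v x) b ->
    zeta b * v b - zeta a * v a = \int[mu]_(t in `]a, b]) z t.
  move=> ab ha hb; apply: (weak_ftc lzv lz) => // phi tphi.
  rewrite zv// -mulN1r -RintegralZl//.
    by apply: eq_Rintegral => x _; rewrite /z; ring.
  have [M M0 hM] := test_function_support tphi.
  have [sphi _] := tphi; have cphi := smooth_continuous sphi.
  have cW : {within `[- M, M], continuous (fun x => `|phi x|)}.
    by apply: continuous_subspaceT => x; apply: cvg_norm; exact: cphi.
  have MM : - M <= M by lra.
  have [c _ Hc] := EVT_max MM cW.
  apply: (@locally_integrableM _ _ _ (- M) M `|phi c|) => //.
  - exact: continuous_measurable_fun.
  - move=> x; have [xM|nxM] := boolP (x \in `[- M, M]); first exact: Hc.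
    rewrite (hM x _).1 ?normr0//; apply: contra nxM.
    by rewrite in_itv/= => /andP[/ltW -> /ltW ->].
  - move=> x nxM; apply: (hM x _).1; apply: contra nxM.
    by move=> /andP[/ltW -> /ltW ->].
have FF := ae_filter_ringOfSetsType mu.
have aept := lebesgue_differentiation (locally_integrable_funP lzv).
(* Otherwise the unit interval would be contained in a null set. *)
have [c hc] : exists c, lebesgue_pt (fun x => zeta x * v x) c.
  apply: contrapT => /forallNP nc.
  have [A [mA A0 sA]] := aept.
  have : (mu `[0%R, 1%R]%classic <= mu A)%E.
    apply: le_measure; rewrite ?inE//.
    by move=> x _; apply: sA => /=; exact: nc.
  rewrite A0; have := lebesgue_measure_itv `[0%R, 1%R] => /= ->.
  by rewrite lte_fin ltr01 oppr0 adde0 lee_fin ler10.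
have [Z ZD] := continuous_primitive ctz.
pose w x := zeta c * v c + (Z x - Z c).
have wD x : is_derive x 1 w (z x).
  rewrite -[z x]add0r; apply: is_deriveD.
  by rewrite -[z x]subr0; apply: is_deriveB.
have cw : continuous w by apply: derivable_continuous => x; have [] := wD x.
have ZI a b : a < b -> \int[mu]_(t in `]a, b]) z t = Z b - Z a.
  move=> ab; rewrite Rintegral_itv_obnd_cbnd; last first.
    apply: integrableS (lz.2 a b); [exact: measurable_itv|exact: measurable_itv|].
    by apply: subset_itvr; rewrite bnd_simp.
  exact: Rintegral_continuous_FTC2.
have aew : {ae mu, forall x, v x = w x / zeta x}.
  move: aept; apply: filterS => x hx.
  suff -> : w x = zeta x * v x by rewrite mulrC mulKf// lt0r_neq0.
  rewrite /w; have [xc|cx|->] := ltgtP x c; last by rewrite subrr addr0.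
  - by have := wE _ _ xc hx hc; rewrite ZI//; lra.
  - by have := wE _ _ cx hc hx; rewrite ZI//; lra.
exists w => x; split=> //.
have cwz : continuous (fun x => w x / zeta x).
  by move=> y; apply: cvgM; [exact: cw|apply: cvgV; [exact: lt0r_neq0|exact: cz]].
have x1 : x - 1 < x by lra.
have h : is_derive x 1
    (fun y => u (x - 1) + \int[mu]_(t in `]x - 1, y]) (w t / zeta t)) (w x / zeta x).
  by rewrite -[w x / zeta x]add0r; apply: is_deriveD; exact: is_derive_integral.
apply: near_eq_is_derive h; near=> y.
have xy : x - 1 < y by near: y; exact: lt_nbhsr.
rewrite (@ae_eq_Rintegral _ _ _ mu _ (fun t => w t / zeta t) v).
  by rewrite -uE//; lra.
by move: aew; apply: filterS => t ->.
Unshelve. all: by end_near. Qed.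

End classical_solutions.

(** * Wronskians and uniqueness *)

Section wronskian.
Context {R : realType}.
Notation mu := (@lebesgue_measure R).
Implicit Types (f g h F u v w z phi zeta : R -> R) (a b c d e s x y K t : R) (n : nat).

Lemma Rintegral_by_parts_test F f phi : continuous f ->
  (forall x, is_derive x 1 F (f x)) -> test_function phi ->
  \int[mu]_x (F x * derive1 phi x) = - \int[mu]_x (f x * phi x).
Proof.
move=> cf FD tphi; have [M M0 hM] := test_function_support tphi; have [sphi _] := tphi.
have cphi := smooth_continuous sphi; have cphi' := smooth_derive1_continuous sphi.
have cF : continuous F by apply: derivable_continuous => x; have [] := FD x.
have out x : ~~ (- M <= x <= M) -> phi x = 0 /\ derive1 phi x = 0.
  by move=> nx; apply: hM; apply: contra nx => /andP[/ltW -> /ltW ->].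
rewrite !(@Rintegral_support _ _ (- M) M); last 2 first.
- by move=> x /out[-> _]; rewrite mulr0.
- by move=> x /out[_ ->]; rewrite mulr0.
have MM : - M < M by lra.
have c1 : continuous (fun x => F x * derive1 phi x).
  by move=> x; apply: cvgM; [exact: cF|exact: cphi'].
have c2 : continuous (fun x => f x * phi x).
  by move=> x; apply: cvgM; [exact: cf|exact: cphi].
have D x : is_derive x 1 (fun x => F x * phi x) (F x * derive1 phi x + f x * phi x).
  rewrite [f x * phi x]mulrC.
  have d1 := FD x; have d2 := is_derive1E (sphi 0%N x).
  by have := is_deriveM d1 d2.
have cD : continuous (fun x => F x * derive1 phi x + f x * phi x).
  by move=> x; apply: cvgD; [exact: c1|exact: c2].
have := Rintegral_continuous_FTC2 MM cD D.
rewrite RintegralD//; last 2 first.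
- exact: (continuous_locally_integrable c1).2.
- exact: (continuous_locally_integrable c2).2.
have [-> _] : phi M = 0 /\ derive1 phi M = 0 by apply: hM; rewrite ltxx andbF.
have [-> _] : phi (- M) = 0 /\ derive1 phi (- M) = 0 by apply: hM; rewrite ltxx.
by rewrite !mulr0 subrr => /eqP; rewrite addr_eq0 => /eqP.
Qed.

Definition solution_pair zeta s u w := forall x,
  is_derive x 1 u (w x / zeta x) /\ is_derive x 1 w (- (s * zeta x * u x)).

Lemma solution_pair_continuous zeta s u w : solution_pair zeta s u w ->
  continuous u /\ continuous w.
Proof.
move=> H; split; apply: derivable_continuous => x; have [h1 h2] := H x.
  by case: h1.
by case: h2.
Qed.

Lemma solution_pair_weak zeta s u w : continuous zeta -> (forall x, 0 < zeta x) ->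
  solution_pair zeta s u w ->
  [/\ continuous (fun x => w x / zeta x),
    forall phi, test_function phi ->
      \int[mu]_x (u x * derive1 phi x) = - \int[mu]_x (w x / zeta x * phi x) &
    forall phi, test_function phi ->
      \int[mu]_x (zeta x * (w x / zeta x) * derive1 phi x) =
      \int[mu]_x (s * zeta x * u x * phi x)].
Proof.
move=> cz z0 H; have [cu cw] := solution_pair_continuous H.
have cwz : continuous (fun x => w x / zeta x).
  by move=> y; apply: cvgM; [exact: cw|apply: cvgV; [exact: lt0r_neq0|exact: cz]].
split=> // phi tphi.
  by apply: Rintegral_by_parts_test => // x; exact: (H x).1.
have c2 : continuous (fun x => - (s * zeta x * u x)).
  by move=> x; apply: cvgN; apply: cvgM; [apply: cvgM; [exact: cvg_cst|exact: cz]|exact: cu].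
transitivity (\int[mu]_x (w x * derive1 phi x)).
  apply: eq_Rintegral => x _; by congr (_ * _); rewrite mulrCA divff ?mulr1// lt0r_neq0.
rewrite (Rintegral_by_parts_test c2 (fun x => (H x).2) tphi).
have [M M0 hM] := test_function_support tphi.
rewrite -mulN1r !(@Rintegral_support _ _ (- M) M); last 2 first.
- move=> x nx; rewrite (hM x _).1 ?mulr0//.
  by apply: contra nx => /andP[/ltW -> /ltW ->].
- move=> x nx; rewrite (hM x _).1 ?mulr0//.
  by apply: contra nx => /andP[/ltW -> /ltW ->].
rewrite -RintegralZl//; first by apply: eq_Rintegral => x _; ring.
apply: (continuous_locally_integrable _).2 => x.
by apply: cvgM; [exact: c2|apply: smooth_continuous; have [] := tphi].
Qed.

Lemma wronskian_const zeta s u1 w1 u2 w2 x y : (forall x, 0 < zeta x) ->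
  solution_pair zeta s u1 w1 -> solution_pair zeta s u2 w2 ->
  u1 x * w2 x - u2 x * w1 x = u1 y * w2 y - u2 y * w1 y.
Proof.
move=> z0 H1 H2.
have D t : is_derive t 1 (fun t => u1 t * w2 t - u2 t * w1 t) 0.
  have [d1 d1'] := H1 t; have [d2 d2'] := H2 t.
  have h := is_deriveB (is_deriveM d1 d2') (is_deriveM d2 d1').
  apply: (is_derive_eq h); rewrite /GRing.scale/=.
  by field; exact: lt0r_neq0.
by have [xy|/ltW xy] := leP x y; [apply/esym|];
  apply: (@is_derive0_const _ (fun t => u1 t * w2 t - u2 t * w1 t)) => // t _; exact: D.
Qed.

Lemma solution_pair_near0 zeta s u w x : (forall x, 0 < zeta x) ->
  solution_pair zeta s u w -> (\near x, u x = 0) -> u x = 0 /\ w x = 0.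
Proof.
move=> z0 H u0; split; first exact: nbhs_singleton u0.
have [h1 _] := H x.
have h : is_derive x 1 u 0.
  apply: (@near_eq_is_derive _ _ _ (fun=> 0)).
  by near=> y; apply/esym; near: y.
have : w x / zeta x = 0 by have [_ <-] := h1; have [_ <-] := h.
by move=> /eqP; rewrite mulf_eq0 invr_eq0 (gt_eqF (z0 x)) orbF => /eqP.
Unshelve. all: by end_near. Qed.

(** This stands in for a uniqueness theorem for initial value problems. The Wronskians of [u] with
    [u1] and with [u2] vanish at [p], hence everywhere, and [u] times the nonzero Wronskian of [u1]
    and [u2] is a combination of these two. *)
Lemma solution_pair_unique zeta s u w u1 w1 u2 w2 p q : (forall x, 0 < zeta x) ->
  solution_pair zeta s u1 w1 -> solution_pair zeta s u2 w2 ->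
  u1 q * w2 q - u2 q * w1 q != 0 ->
  solution_pair zeta s u w -> (\forall x \near (p : R), u x = 0) -> forall x, u x = 0.
Proof.
move=> z0 H1 H2 W H u0 x.
have [up wp] := solution_pair_near0 z0 H u0.
have E1 := wronskian_const x p z0 H H1; have E2 := wronskian_const x p z0 H H2.
have E := wronskian_const x q z0 H1 H2.
rewrite up wp !(mul0r, mulr0) subrr in E1 E2.
rewrite -{}E in W; apply/eqP; rewrite -(mulIr_eq0 _ (mulIf W)); apply/eqP.
have -> : u x * (u1 x * w2 x - u2 x * w1 x) =
  u1 x * (u x * w2 x - u2 x * w x) - u2 x * (u x * w1 x - u1 x * w x) by ring.
by rewrite E1 E2 !mulr0 subrr.
Qed.

Lemma solution_pairD zeta s u1 w1 u2 w2 a b :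
  solution_pair zeta s u1 w1 -> solution_pair zeta s u2 w2 ->
  solution_pair zeta s (fun x => a * u1 x + b * u2 x) (fun x => a * w1 x + b * w2 x).
Proof.
move=> H1 H2 x; have [d1 d1'] := H1 x; have [d2 d2'] := H2 x; split.
  have h := is_deriveD (@is_deriveZ _ _ _ _ a _ _ _ d1) (@is_deriveZ _ _ _ _ b _ _ _ d2).
  by apply: (is_derive_eq h); rewrite /GRing.scale/=; ring.
have h := is_deriveD (@is_deriveZ _ _ _ _ a _ _ _ d1') (@is_deriveZ _ _ _ _ b _ _ _ d2').
by apply: (is_derive_eq h); rewrite /GRing.scale/=; ring.
Qed.

End wronskian.

(** * The Picard series *)

Section picard.
Context {R : realType}.
Notation mu := (@lebesgue_measure R).
Implicit Types (f g h F u v w z phi zeta : R -> R) (a b d e x y K t : R) (n j : nat).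

Lemma integrableM_bounded beta g K : mu.-integrable setT (EFin \o beta) ->
  measurable_fun [set: R] g -> (forall x, `|g x| <= K) ->
  mu.-integrable setT (EFin \o (fun x => beta x * g x)).
Proof.
move=> ib mg gK.
have i1 : mu.-integrable setT (EFin \o (fun x => K * `|beta x|)).
  apply: integrable_fun_scale => //.
  by have := integrable_norm ib; apply: eq_integrable.
apply: integrable_dominated i1 _.
  apply: measurable_funM => //.
  by have /integrableP[/measurable_EFinP] := ib.
by move=> x; rewrite normrM mulrC ler_wpM2r.
Qed.

Lemma measurable_continuous f : continuous f -> measurable_fun [set: R] f.
Proof. exact: continuous_measurable_fun. Qed.

Lemma expR_lipschitz K x y : x <= K -> y <= K -> `|expR y - expR x| <= expR K * `|y - x|.
Proof.
have key a b : b <= K -> expR b - expR a <= expR K * `|b - a|.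
  move=> bK; have h : 1 + (a - b) <= expR (a - b) by exact: expR_ge1Dx.
  have -> : expR b - expR a = expR b * (1 - expR (a - b)).
    by rewrite mulrBr mulr1 -expRD [b + _]addrC subrK.
  apply: (@le_trans _ _ (expR b * (b - a))).
    by rewrite ler_wpM2l ?expR_ge0//; lra.
  apply: (@le_trans _ _ (expR b * `|b - a|)).
    by rewrite ler_wpM2l ?expR_ge0// ler_norm.
  by rewrite ler_wpM2r// ler_expR.
by move=> xK yK; rewrite ler_norml lerNl opprB distrC {1}key//= distrC key.
Qed.

Lemma ac_expR f K : (forall x, f x <= K) -> abs_cont f -> abs_cont (fun x => expR (f x)).
Proof. by move=> fK; apply: (@ac_lipschitz _ _ _ (expR K)) => x y; exact: expR_lipschitz. Qed.

Lemma ac_scale k f : abs_cont f -> abs_cont (fun x => k * f x).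
Proof.
by apply: (@ac_lipschitz _ _ _ `|k|) => x y; rewrite -mulrBr normrM.
Qed.

Lemma normr_cos_le1 x : `|cos x| <= 1 :> R.
Proof. by rewrite ler_norml cos_geN1 cos_le1. Qed.

Lemma normr_sin_le1 x : `|sin x| <= 1 :> R.
Proof. by rewrite ler_norml sin_geN1 sin_le1. Qed.

Variables (sigma x0 x1 : R) (beta : R -> R).
Hypothesis ib : mu.-integrable setT (EFin \o beta).
Hypothesis beta0 : forall x, x1 <= x -> beta x = 0.

Let c t := cos (2 * (sigma * (t - x0))).
Let s t := sin (2 * (sigma * (t - x0))).

Let c_cont : continuous c.
Proof.
move=> t; apply: continuous_comp; last exact: continuous_cos.
by apply: cvgM; [exact: cvg_cst|apply: cvgM; [exact: cvg_cst|apply: cvgB;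
  [exact: cvg_id|exact: cvg_cst]]].
Qed.

Let s_cont : continuous s.
Proof.
move=> t; apply: continuous_comp; last exact: continuous_sin.
by apply: cvgM; [exact: cvg_cst|apply: cvgM; [exact: cvg_cst|apply: cvgB;
  [exact: cvg_id|exact: cvg_cst]]].
Qed.

(* The pair [(p, q)] stands for the complex function [h = p + i q]; one iteration maps
   [h] to [x |-> \int_x^oo beta(t) e^{-2 i sigma (t - x0)} conj(h t) dt]. *)
Definition picard_step (h : (R -> R) * (R -> R)) : (R -> R) * (R -> R) :=
  (tail_integral (fun t => beta t * (c t * h.1 t - s t * h.2 t)),
   tail_integral (fun t => beta t * - (c t * h.2 t + s t * h.1 t))).

Definition picard j := iter j picard_step (fun=> 1, fun=> 0).

Let G := tail_integral (fun t => `|beta t|).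
Let Gmax := \int[mu]_t `|beta t|.

Let inb : mu.-integrable setT (EFin \o (fun t => `|beta t|)).
Proof. by have := integrable_norm ib; apply: eq_integrable. Qed.

Let G_ge0 x : 0 <= G x. Proof. by apply: tail_ge0 => t. Qed.

Let G_le x : G x <= Gmax.
Proof.
rewrite /G /tail_integral Rintegral_mkcond; apply: le_Rintegral => //.
  rewrite -restrict_EFin; apply: (integrable_mkcond _ _).1 => //.
  by apply: integrableS inb.
by move=> t _; rewrite patchE; case: ifP => _; [exact: lexx|exact: normr_ge0].
Qed.

(* Relative to this weight, each Picard step contracts by 1/2; this replaces the usual factorial
   bounds on the iterated integrals. *)
Let wgt x := expR (4 * G x).

Let wgt_ge0 x : 0 <= wgt x. Proof. exact: expR_ge0. Qed.

Let wgt_le x : wgt x <= expR (4 * Gmax).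
Proof. by rewrite ler_expR ler_wpM2l// G_le. Qed.

Let ac_wgt : abs_cont wgt.
Proof.
apply: (@ac_expR _ (4 * Gmax)); first by move=> x; rewrite ler_wpM2l// G_le.
by apply: ac_scale; exact: ac_tail.
Qed.

Let tail0 h x : (forall t, x1 <= t -> h t = 0) -> x1 <= x -> tail_integral h x = 0.
Proof.
move=> h0 xx; rewrite /tail_integral (@eq_Rintegral _ _ _ _ _ (fun=> 0)); last first.
  by move=> t; rewrite inE/= in_itv/= andbT => /ltW xt; rewrite h0// (le_trans xx).
by rewrite Rintegral_cst// mul0r.
Qed.

(** Almost everywhere [wgt' = - 4 |beta| wgt], so for [x < x1] the integral equals
    [(wgt x - wgt x1) / 4]. *)
Let tail_wgt x : tail_integral (fun t => `|beta t| * wgt t) x <= wgt x / 4.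
Proof.
have [xx|xx] := leP x1 x.
  by rewrite tail0// ?divr_ge0// => t /beta0 ->; rewrite normr0 mul0r.
have cw := ac_continuous ac_wgt.
have iw : mu.-integrable setT (EFin \o (fun t => `|beta t| * wgt t)).
  apply: (@integrableM_bounded _ _ (expR (4 * Gmax))) => //.
    exact: measurable_continuous.
  by move=> t; rewrite ger0_norm.
rewrite (tailD iw (ltW xx)) (@tail0 _ x1)//; last first.
  by move=> t /beta0 ->; rewrite normr0 mul0r.
have FF := ae_filter_ringOfSetsType mu.
have wD : {ae mu, forall t, x < t < x1 -> is_derive t 1 wgt (-4 * (`|beta t| * wgt t))}.
  move: (ae_is_derive_tail inb); apply: filterS => t Gt _.
  have h := @is_derive1_comp _ expR (fun t => 4 * G t) t _ _
    (is_derive_expR (4 * G t)) (@is_deriveZ _ _ _ _ 4 _ _ _ Gt).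
  apply: (is_derive_eq h); rewrite /GRing.scale/= /wgt; ring.
have := ac_ae_ftc ac_wgt xx wD; move=> /(_ x1); rewrite lexx (ltW xx) => /(_ isT).
have iw' : mu.-integrable `]x, x1] (EFin \o (fun t => `|beta t| * wgt t)).
  by apply: integrableS iw.
rewrite RintegralZl// addr0; move: (wgt x) (wgt x1) (wgt_ge0 x1) => w0 w1 w1_ge0.
by move: (\int[mu]_(t in `]x, x1]) _) => I E; lra.
Qed.

Definition dominated_pair j (h : (R -> R) * (R -> R)) :=
  [/\ continuous h.1, continuous h.2 &
  forall x, `|h.1 x| + `|h.2 x| <= 2^-1 ^+ j * wgt x].

Let integrable_picard (h : (R -> R) * (R -> R)) K : measurable_fun [set: R] h.1 ->
  measurable_fun [set: R] h.2 -> (forall x, `|h.1 x| + `|h.2 x| <= K) ->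
  mu.-integrable setT (EFin \o (fun t => beta t * (c t * h.1 t - s t * h.2 t))) /\
  mu.-integrable setT (EFin \o (fun t => beta t * - (c t * h.2 t + s t * h.1 t))).
Proof.
move=> m1 m2 hK; have mc := measurable_continuous c_cont.
have ms := measurable_continuous s_cont.
split; apply: (@integrableM_bounded _ _ K) => //.
- by apply: measurable_funB; apply: measurable_funM.
- move=> x; apply: le_trans (hK x); apply: le_trans (ler_normB _ _) _.
  by rewrite !normrM lerD// ler_piMl ?normr_cos_le1 ?normr_sin_le1.
- apply: measurableT_comp => //.
  by apply: measurable_funD; apply: measurable_funM.
- move=> x; rewrite normrN addrC; apply: le_trans (hK x); apply: le_trans (ler_normD _ _) _.
  by rewrite !normrM lerD// ler_piMl ?normr_cos_le1 ?normr_sin_le1.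
Qed.

Lemma picard_dominated j : dominated_pair j (picard j).
Proof.
elim: j => [|j [c1 c2 ih]].
  split; [exact: cst_continuous|exact: cst_continuous|move=> x /=].
  by rewrite normr1 normr0 addr0 expr0 mul1r -[leLHS]expR0 ler_expR mulr_ge0// G_ge0.
have b0 : 0 <= 2^-1 ^+ j :> R by rewrite exprn_ge0.
have [i1 i2] := @integrable_picard (picard j) (2^-1 ^+ j * expR (4 * Gmax))
  (measurable_continuous c1) (measurable_continuous c2)
  (fun x => le_trans (ih x) (ler_wpM2l b0 (wgt_le x))).
split; [exact/ac_continuous/ac_tail|exact/ac_continuous/ac_tail|move=> x].
have iw : mu.-integrable setT (EFin \o (fun t => `|beta t| * wgt t)).
  apply: (@integrableM_bounded _ _ (expR (4 * Gmax))) => //.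
    by apply: measurable_continuous; apply: ac_continuous; exact: ac_wgt.
  by move=> t; rewrite ger0_norm.
have iw' := integrable_fun_scale (2^-1 ^+ j) measurableT iw.
have tw : tail_integral (fun t => 2^-1 ^+ j * (`|beta t| * wgt t)) x <= 2^-1 ^+ j * (wgt x / 4).
  rewrite /tail_integral RintegralZl//; last by apply: integrableS iw.
  by rewrite ler_wpM2l//; exact: tail_wgt.
(* Each of the two components gains a factor 1/4 from the rate 4 in the weight; their sum gains
   1/2. *)
rewrite /= -/(picard j);
  apply: (@le_trans _ _ (2^-1 ^+ j * (wgt x / 4) + 2^-1 ^+ j * (wgt x / 4))).
  apply: lerD; apply: le_trans tw; apply: normr_tail_le => // t.
    rewrite normrM [leRHS]mulrCA ler_wpM2l//; apply: le_trans (ih t).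
    apply: le_trans (ler_normB _ _) _.
    by rewrite !normrM lerD// ler_piMl ?normr_cos_le1 ?normr_sin_le1.
  rewrite normrM [leRHS]mulrCA ler_wpM2l// normrN; apply: le_trans (ih t).
  apply: le_trans (ler_normD _ _) _; rewrite addrC.
  by rewrite !normrM lerD// ler_piMl ?normr_cos_le1 ?normr_sin_le1.
by rewrite exprS; lra.
Qed.

Hypothesis beta0l : forall x, x <= x0 -> beta x = 0.

Let P n x := \sum_(0 <= j < n) (picard j).1 x.
Let Q n x := \sum_(0 <= j < n) (picard j).2 x.

Let W := expR (4 * Gmax).

Let term_le j x : `|(picard j).1 x| + `|(picard j).2 x| <= 2^-1 ^+ j * W.
Proof.
have [_ _ h] := picard_dominated j; apply: le_trans (h x) _.
by rewrite ler_wpM2l ?exprn_ge0// wgt_le.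
Qed.

Lemma picard_bounded j : exists C, forall x,
  `|(picard j).1 x| <= C /\ `|(picard j).2 x| <= C.
Proof.
exists (2^-1 ^+ j * W) => x.
by split; apply: le_trans (term_le j x); rewrite ?lerDl ?lerDr.
Qed.

Let geo_cvg : cvgn (series (fun j => 2^-1 ^+ j * W)).
Proof.
rewrite (_ : (fun j => _) = geometric W 2^-1); last first.
  by apply/funext => j; rewrite /geometric/= mulrC.
by apply: is_cvg_geometric_series; rewrite ger0_norm// invf_lt1// ltr1n.
Qed.

Let sum_le n x : `|P n x| + `|Q n x| <= 2 * W.
Proof.
apply: (@le_trans _ _ (\sum_(0 <= j < n) (2^-1 ^+ j * W))).
  apply: (@le_trans _ _ (\sum_(0 <= j < n) (`|(picard j).1 x| + `|(picard j).2 x|))).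
    by rewrite big_split/=; apply: lerD; exact: ler_norm_sum.
  by apply: ler_sum => j _; exact: term_le.
rewrite -mulr_suml ler_wpM2r ?expR_ge0//.
elim: n => [|n _]; first by rewrite big_nil.
suff -> : \sum_(0 <= j < n.+1) 2^-1 ^+ j = 2 - 2^-1 ^+ n :> R.
  by rewrite gerBl exprn_ge0.
elim: n => [|n ih]; first by rewrite big_nat1 expr0; lra.
by rewrite big_nat_recr//= ih exprS; lra.
Qed.

Let P_cvg x : cvgn (P^~ x).
Proof.
apply: normed_cvg; apply: (@series_le_cvg _ _ (fun j => 2^-1 ^+ j * W)).
- by move=> j; exact: normr_ge0.
- by move=> j; rewrite mulr_ge0 ?exprn_ge0 ?expR_ge0.
- by move=> j; apply: le_trans (term_le j x); rewrite lerDl.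
- exact: geo_cvg.
Qed.

Let Q_cvg x : cvgn (Q^~ x).
Proof.
apply: normed_cvg; apply: (@series_le_cvg _ _ (fun j => 2^-1 ^+ j * W)).
- by move=> j; exact: normr_ge0.
- by move=> j; rewrite mulr_ge0 ?exprn_ge0 ?expR_ge0.
- by move=> j; apply: le_trans (term_le j x); rewrite lerDr.
- exact: geo_cvg.
Qed.

Let a x : R := limn (P^~ x).
Let b x : R := limn (Q^~ x).

Let P_meas n : measurable_fun [set: R] (P n).
Proof.
apply: measurable_sum => j; apply: measurable_continuous.
by have [h _ _] := picard_dominated j; exact: h.
Qed.

Let Q_meas n : measurable_fun [set: R] (Q n).
Proof.
apply: measurable_sum => j; apply: measurable_continuous.
by have [_ h _] := picard_dominated j; exact: h.
Qed.

Let ab_le x : `|a x| + `|b x| <= 2 * W.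
Proof.
have h : `|P n x| + `|Q n x| @[n --> \oo] --> `|a x| + `|b x|.
  by apply: cvgD; apply: cvg_norm; [exact: P_cvg|exact: Q_cvg].
rewrite -(cvg_lim (@Rhausdorff R) h); apply: limr_le; first by apply/cvg_ex; eexists; exact: h.
by apply: nearW => n; exact: sum_le.
Qed.

(** By linearity of [picard_step] the partial sums obey the integral equation with a shift of index.
    Its limit is then a matter of dominated convergence, with no exchange of a series and an
    integral. *)
Let PQ_step n x :
  P n.+1 x = 1 + tail_integral (fun t => beta t * (c t * P n t - s t * Q n t)) x /\
  Q n.+1 x = tail_integral (fun t => beta t * - (c t * Q n t + s t * P n t)) x.
Proof.
elim: n => [|n [ih1 ih2]].
  rewrite /P /Q !big_nat1 /tail_integral; split.
    rewrite (@eq_Rintegral _ _ _ _ _ (fun=> 0)) ?Rintegral_cst// ?mul0r ?addr0//.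
    by move=> t _; rewrite !big_geq// !mulr0 subr0 mulr0.
  rewrite (@eq_Rintegral _ _ _ _ _ (fun=> 0)) ?Rintegral_cst// ?mul0r//.
  by move=> t _; rewrite !big_geq// !mulr0 addr0 oppr0 mulr0.
have [i1 i2] := @integrable_picard (P n, Q n) (2 * W) (P_meas n) (Q_meas n) (sum_le n).
have [c1 c2 _] := picard_dominated n.
have [i3 i4] := @integrable_picard (picard n) (2^-1 ^+ n * W)
  (measurable_continuous c1) (measurable_continuous c2) (term_le n).
have E1 : P n.+2 x = P n.+1 x + (picard n.+1).1 x by rewrite /P big_nat_recr.
have E2 : Q n.+2 x = Q n.+1 x + (picard n.+1).2 x by rewrite /Q big_nat_recr.
rewrite E1 E2 ih1 ih2 -addrA /= -/(picard n) /tail_integral -!RintegralD//=;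
  try by [apply: integrableS i1|apply: integrableS i2|apply: integrableS i3|apply:
    integrableS i4].
split; [congr (1 + _)|]; apply: eq_Rintegral => t _;
  by rewrite /P /Q !(@big_nat_recr _ _ _ n)//=; ring.
Qed.

Let tail_cvg (g : nat -> R -> R) g0 x : (forall n, measurable_fun [set: R] (g n)) ->
  (forall n t, `|g n t| <= 2 * W) -> (forall t, g n t @[n --> \oo] --> g0 t) ->
  tail_integral (fun t => beta t * g n t) x @[n --> \oo] --> tail_integral (fun t =>
    beta t * g0 t) x.
Proof.
move=> mg gW gg0.
have mb : measurable_fun [set: R] beta by have /integrableP[/measurable_EFinP] := ib.
have mg0 : measurable_fun [set: R] g0.
  by apply: (@measurable_fun_cvg _ _ _ _ g) => // t _; exact: gg0.
rewrite /tail_integral [X in _ --> X]Rintegral_mkcond.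
rewrite (_ : (fun n => _) = (fun n =>
  \int[mu]_t ((fun t => beta t * g n t) \_ `]x, +oo[) t)); last first.
  by apply/funext => n; rewrite Rintegral_mkcond.
apply: (@dominated_Rintegral _ _ _ (fun t => (2 * W) * `|beta t|)).
- move=> n; apply: (measurable_restrictT _ _).1 => //.
  by apply: measurable_funTS; exact: measurable_funM.
- apply: (measurable_restrictT _ _).1 => //.
  by apply: measurable_funTS; exact: measurable_funM.
- by apply: integrable_fun_scale.
- move=> n t; rewrite patchE; case: ifP => _.
    by rewrite normrM mulrC ler_wpM2r.
  by rewrite normr0 mulr_ge0// mulr_ge0// expR_ge0.
- move=> t; rewrite patchE.
  rewrite (_ : (fun n => _) = (fun n => if t \in `]x, +oo[%classic then beta t * g n t else 0)).
    case: ifP => _; last exact: cvg_cst.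
    by apply: cvgM; [exact: cvg_cst|exact: gg0].
  by apply/funext => n; rewrite patchE.
Qed.

Let comb_le t K L : `|K| + `|L| <= 2 * W -> `|c t * K - s t * L| <= 2 * W /\
   `|- (c t * L + s t * K)| <= 2 * W.
Proof.
move=> h; split.
  apply: le_trans (ler_normB _ _) _; apply: le_trans h.
  by rewrite !normrM lerD// ler_piMl ?normr_cos_le1 ?normr_sin_le1.
rewrite normrN; apply: le_trans (ler_normD _ _) _; rewrite addrC; apply: le_trans h.
by rewrite !normrM lerD// ler_piMl ?normr_cos_le1 ?normr_sin_le1.
Qed.

Let mc : measurable_fun [set: R] c. Proof. exact: measurable_continuous. Qed.
Let ms : measurable_fun [set: R] s. Proof. exact: measurable_continuous. Qed.

Let a_eq x : a x = 1 + tail_integral (fun t => beta t * (c t * a t - s t * b t)) x.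
Proof.
have /cvg_lim <- // : P n x @[n --> \oo] --> 1 + tail_integral (fun t =>
  beta t * (c t * a t - s t * b t)) x.
rewrite -cvg_shiftS /=.
rewrite (_ : (fun n => _) = (fun n => 1 + tail_integral (fun t =>
  beta t * (c t * P n t - s t * Q n t)) x)).
  apply: cvgD; first exact: cvg_cst.
  apply: tail_cvg.
  - by move=> n; apply: measurable_funB; apply: measurable_funM.
  - by move=> n t; have [] := comb_le t (sum_le n t).
  - by move=> t; apply: cvgB; apply: cvgM;
      [exact: cvg_cst|exact: P_cvg|exact: cvg_cst|exact: Q_cvg].
by apply/funext => n; have [-> _] := PQ_step n x.
Qed.

Let b_eq x : b x = tail_integral (fun t => beta t * - (c t * b t + s t * a t)) x.
Proof.
have /cvg_lim <- // : Q n x @[n --> \oo] --> tail_integral (fun t =>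
  beta t * - (c t * b t + s t * a t)) x.
rewrite -cvg_shiftS /=.
rewrite (_ : (fun n => _) = (fun n => tail_integral (fun t =>
  beta t * - (c t * Q n t + s t * P n t)) x)).
  apply: tail_cvg.
  - move=> n; apply: measurableT_comp => //.
    by apply: measurable_funD; apply: measurable_funM.
  - by move=> n t; have [] := comb_le t (sum_le n t).
  - by move=> t; apply: cvgN; apply: cvgD; apply: cvgM;
      [exact: cvg_cst|exact: Q_cvg|exact: cvg_cst|exact: P_cvg].
by apply/funext => n; have [_ ->] := PQ_step n x.
Qed.

(** With [h = a + i b] and [theta = sigma (t - x0)], the two derivatives say
    [h' = - beta e^{-2 i theta} conj h]. The limit is 1 to the right of [X] and constant to its
    left. *)
Lemma picard_limit : exists a b : R -> R,
  [/\ forall x, \sum_(0 <= j < n) (picard j).1 x @[n --> \oo] --> a x,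
      forall x, \sum_(0 <= j < n) (picard j).2 x @[n --> \oo] --> b x &
  [/\ abs_cont a, abs_cont b, exists K, forall x, `|a x| <= K /\ `|b x| <= K,
      forall x, x1 <= x -> a x = 1 /\ b x = 0 &
      (forall x, x <= x0 -> a x = a x0 /\ b x = b x0) /\
      {ae mu, forall t,
        is_derive t 1 a (- (beta t * (cos (2 * (sigma * (t - x0))) * a t -
                                      sin (2 * (sigma * (t - x0))) * b t))) /\
        is_derive t 1 b (beta t * (cos (2 * (sigma * (t - x0))) * b t +
                                   sin (2 * (sigma * (t - x0))) * a t))}]].
Proof.
exists a, b; split; [exact: P_cvg|exact: Q_cvg|].
have ma : measurable_fun [set: R] a.
  by apply: (@measurable_fun_cvg _ _ _ _ P) => // t _; exact: P_cvg.
have mb : measurable_fun [set: R] b.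
  by apply: (@measurable_fun_cvg _ _ _ _ Q) => // t _; exact: Q_cvg.
have [i1 i2] := @integrable_picard (a, b) (2 * W) ma mb ab_le.
have aE : a = (fun x => 1 + tail_integral (fun t => beta t * (c t * a t - s t * b t)) x).
  by apply/funext => x; exact: a_eq.
have bE : b = tail_integral (fun t => beta t * - (c t * b t + s t * a t)).
  by apply/funext => x; exact: b_eq.
split.
- rewrite aE; apply: (@ac_lipschitz _ _ _ 1); last exact: ac_tail i1.
  by move=> x y; rewrite mul1r opprD addrACA subrr add0r.
- by rewrite bE; exact: ac_tail i2.
- exists (2 * W) => x; have h := ab_le x.
  by split; apply: le_trans h; rewrite ?lerDl ?lerDr.
- move=> x xx; rewrite a_eq b_eq !tail0 ?addr0// => t /beta0 ->; by rewrite mul0r.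
split.
  move=> x xx; rewrite !a_eq !b_eq (tailD i1 xx) (tailD i2 xx).
  have z (g : R -> R) : \int[mu]_(t in `]x, x0]) (beta t * g t) = 0.
    rewrite (@eq_Rintegral _ _ _ _ _ (fun=> 0)) ?Rintegral_cst// ?mul0r//.
    by move=> t; rewrite inE/= in_itv/= => /andP[_ /beta0l ->]; rewrite mul0r.
  by rewrite !z !add0r.
have FF := ae_filter_ringOfSetsType mu.
move: (ae_is_derive_tail i1) (ae_is_derive_tail i2); apply: filterS2 => t d1 d2.
split.
  rewrite {1}aE -[X in is_derive _ _ _ X]add0r.
  by apply: is_deriveD; exact: d1.
rewrite {1}bE; apply: (is_derive_eq d2).
by rewrite /= mulrN opprK.
Qed.

End picard.

(** * From amplitudes to solutions of the impedance equation *)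

Section jost.
Context {R : realType}.
Notation mu := (@lebesgue_measure R).
Implicit Types (f g h F u v w phi zeta L Y Z : R -> R) (a b d e s x y K t sigma : R) (n j : nat).

Lemma is_derive_pointM f g x df dg d : is_derive x 1 f df -> is_derive x 1 g dg ->
  d = f x * dg + g x * df -> is_derive x 1 (fun y => f y * g y) d.
Proof. by move=> h1 h2 ->; exact: is_deriveM h1 h2. Qed.

Lemma is_derive_trig sigma x0 x :
  is_derive x 1 (fun t => cos (sigma * (t - x0))) (- sigma * sin (sigma * (x - x0))) /\
  is_derive x 1 (fun t => sin (sigma * (t - x0))) (sigma * cos (sigma * (x - x0))).
Proof.
have d : is_derive x 1 (fun t => sigma * (t - x0)) sigma.
  have := @is_deriveZ _ _ _ _ sigma x 1 _ (is_deriveB (is_derive_id x 1) (is_derive_cst x0 x 1)).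
  by rewrite subr0 /GRing.scale/= mulr1.
split.
  have h := @is_derive1_comp _ cos (fun t => sigma * (t - x0)) x _ _
    (is_derive_cos (sigma * (x - x0))) d.
  by apply: (is_derive_eq h); ring.
have h := @is_derive1_comp _ sin (fun t => sigma * (t - x0)) x _ _
  (is_derive_sin (sigma * (x - x0))) d.
by apply: (is_derive_eq h); ring.
Qed.

Lemma lipschitz_derive f df K x y : (forall x, is_derive x 1 f (df x)) ->
  (forall x, `|df x| <= K) -> `|f y - f x| <= K * `|y - x|.
Proof.
move=> fD dfK; wlog xy : x y / x <= y.
  move=> H; have [/H//|/ltW/H] := leP x y.
  by rewrite distrC [X in _ * X]distrC.
have cf : {within `[x, y], continuous f}.
  apply: continuous_subspaceT; apply: derivable_continuous => z.
  by have [] := fD z.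
have [z _ ->] := MVT_segment xy (fun z _ => fD z) cf.
by rewrite normrM ler_wpM2r.
Qed.

Lemma ac_trig sigma x0 : abs_cont (fun t => cos (sigma * (t - x0))) /\
  abs_cont (fun t => sin (sigma * (t - x0))).
Proof.
split; apply: (@ac_lipschitz _ idfun _ `|sigma|); try exact: ac_id.
  have bd z : `|- sigma * sin (sigma * (z - x0))| <= `|sigma|.
    by rewrite normrM normrN ler_piMr// normr_sin_le1.
  by move=> x y; exact: lipschitz_derive (fun z => (is_derive_trig sigma x0 z).1) bd.
have bd z : `|sigma * cos (sigma * (z - x0))| <= `|sigma|.
  by rewrite normrM ler_piMr// normr_cos_le1.
by move=> x y; exact: lipschitz_derive (fun z => (is_derive_trig sigma x0 z).2) bd.
Qed.

Lemma acM_bounded f g K M : (forall x, `|f x| <= K) -> (forall x, `|g x| <= M) ->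
  abs_cont f -> abs_cont g -> abs_cont (fun x => f x * g x).
Proof.
move=> fK gM; apply: (@acM _ _ _ (Num.max K M)) => x; rewrite le_max ?fK ?gM ?orbT//.
Qed.

(** With [zeta = e^L] this is [u = Y / sqrt zeta] and [w = - sigma Z sqrt zeta]. Differentiating the
    exponentials produces terms in [alpha] that cancel those in the system for [Y] and [Z]; what
    remains is continuous, so [ac_is_derive] applies. *)
Lemma liouville_solution L Y Z (alpha : R -> R) sigma B K :
  abs_cont L -> (forall x, `|L x| <= B) -> abs_cont Y -> abs_cont Z ->
  (forall x, `|Y x| <= K) -> (forall x, `|Z x| <= K) ->
  {ae mu, forall t, is_derive t 1 L (- 2 * alpha t)} ->
  {ae mu, forall t, is_derive t 1 Y (- alpha t * Y t - sigma * Z t) /\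
                    is_derive t 1 Z (alpha t * Z t + sigma * Y t)} ->
  solution_pair (fun x => expR (L x)) (sigma ^+ 2)
    (fun x => Y x * expR (- 2^-1 * L x)) (fun x => - sigma * (Z x * expR (2^-1 * L x))).
Proof.
move=> acL LB acY acZ YK ZK LD YZD.
have acE k : abs_cont (fun x => expR (k * L x)).
  apply: (@ac_expR _ _ (`|k| * B)); last exact: ac_scale.
  by move=> x; apply: le_trans (ler_norm _) _; rewrite normrM ler_wpM2l.
have Eb k x : `|expR (k * L x)| <= expR (`|k| * B).
  rewrite ger0_norm ?expR_ge0// ler_expR; apply: le_trans (ler_norm _) _.
  by rewrite normrM ler_wpM2l.
have acu : abs_cont (fun x => Y x * expR (- 2^-1 * L x)) by exact: acM_bounded (acE _).
have acw : abs_cont (fun x => - sigma * (Z x * expR (2^-1 * L x))).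
  by apply: ac_scale; exact: acM_bounded (acE _).
have ED k t : is_derive t 1 L (- 2 * alpha t) ->
    is_derive t 1 (fun x => expR (k * L x)) (expR (k * L t) * (k * (- 2 * alpha t))).
  move=> d; exact: (@is_derive1_comp _ expR (fun x => k * L x) t _ _
    (is_derive_expR (k * L t)) (@is_deriveZ _ _ _ _ k t 1 _ d)).
have split_exp t : expR (L t) = expR (2^-1 * L t) * expR (2^-1 * L t).
  by rewrite -expRD; congr expR; lra.
have inv_exp t : expR (- 2^-1 * L t) = (expR (2^-1 * L t))^-1.
  by rewrite mulNr expRN.
have ne t : expR (2^-1 * L t) != 0 by rewrite gt_eqF// expR_gt0.
have FF := ae_filter_ringOfSetsType mu.
move=> x; split.
- apply: (@ac_is_derive _ _ (fun x => - sigma * (Z x * expR (2^-1 * L x)) / expR (L x))) => //.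
    move=> y; apply: cvgM; first exact: (ac_continuous acw).
    apply: cvgV; first by rewrite gt_eqF// expR_gt0.
    have := ac_continuous (acE 1); rewrite (_ : (fun x => _) = fun x => expR (L x)); first exact.
    by apply/funext => z; rewrite mul1r.
  move: LD YZD; apply: filterS2 => t d [dY dZ].
  apply: (is_derive_pointM dY (ED _ _ d)).
  rewrite split_exp inv_exp; move: (expR (2^-1 * L t)) (ne t) => E E0.
  by field.
- apply: (@ac_is_derive _ _ (fun x =>
  - (sigma ^+ 2 * expR (L x) * (Y x * expR (- 2^-1 * L x))))) => //.
    move=> y; apply: cvgN; apply: cvgM; last exact: (ac_continuous acu).
    apply: cvgM; first exact: cvg_cst.
    have := ac_continuous (acE 1); rewrite (_ : (fun x => _) = fun x => expR (L x)); first exact.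
    by apply/funext => z; rewrite mul1r.
  move: LD YZD; apply: filterS2 => t d [dY dZ].
  have h := @is_deriveZ _ _ _ _ (- sigma) t 1 _ (is_deriveM dZ (ED 2^-1 _ d)).
  apply: (is_derive_eq h); rewrite /GRing.scale/=.
  rewrite split_exp inv_exp; move: (expR (2^-1 * L t)) (ne t) => E E0.
  by field.
Qed.

(** [Y + i Z = h e^{i theta}] with [h = a + i b]. Since [e^{i theta} e^{-2 i theta} conj h = conj (h
    e^{i theta})], the oscillating factor disappears: [(Y + i Z)' = - beta conj (Y + i Z) + i sigma
    (Y + i Z)]. *)
Lemma rotation_derive (beta : R -> R) sigma x0 (a b : R -> R) t :
  is_derive t 1 a (- (beta t * (cos (2 * (sigma * (t - x0))) * a t -
                                sin (2 * (sigma * (t - x0))) * b t))) ->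
  is_derive t 1 b (beta t * (cos (2 * (sigma * (t - x0))) * b t +
                             sin (2 * (sigma * (t - x0))) * a t)) ->
  let C t := cos (sigma * (t - x0)) in let S t := sin (sigma * (t - x0)) in
  let Y t := a t * C t - b t * S t in let Z t := a t * S t + b t * C t in
  is_derive t 1 Y (- beta t * Y t - sigma * Z t) /\
  is_derive t 1 Z (beta t * Z t + sigma * Y t).
Proof.
move=> da db C S Y Z; have [dC dS] := is_derive_trig sigma x0 t.
have E1 : cos (2 * (sigma * (t - x0))) = C t * C t - S t * S t.
  by rewrite mulr_natl mulr2n cosD.
have E2 : sin (2 * (sigma * (t - x0))) = 2 * (S t * C t).
  by rewrite mulr_natl mulr2n sinD -/(C t) -/(S t); ring.
have E3 : C t * C t = 1 - S t * S t by rewrite -!expr2 /C /S cos2sin2.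
rewrite E1 E2 in da db; split.
- have h := is_deriveB (is_deriveM da dC) (is_deriveM db dS).
  apply: (is_derive_eq h); rewrite /GRing.scale/= /Y /Z -/(C t) -/(S t).
  by move: (C t) (S t) E3 => c s E3; ring: E3.
- have h := is_deriveD (is_deriveM da dS) (is_deriveM db dC).
  apply: (is_derive_eq h); rewrite /GRing.scale/= /Y /Z -/(C t) -/(S t).
  by move: (C t) (S t) E3 => c s E3; ring: E3.
Qed.

End jost.

(** * Complex solutions and the S-matrix *)

Section complex_solutions.
Context {R : realType}.
Notation mu := (@lebesgue_measure R).
Notation Re := (@complex.Re R).
Notation Im := (@complex.Im R).
Implicit Types (zeta phi : R -> R) (u v : R -> R[i]) (s x t sigma : R).

Lemma complex_ext (a b : R[i]) : Re a = Re b -> Im a = Im b -> a = b.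
Proof. by case: a b => [? ?] [? ?] /= -> ->. Qed.

Lemma Re_mulr_real (a : R[i]) (r : R) : Re (a * r%:C) = Re a * r.
Proof. by case: a => [p q] /=; rewrite mulr0 subr0. Qed.

Lemma Im_mulr_real (a : R[i]) (r : R) : Im (a * r%:C) = Im a * r.
Proof. by case: a => [p q] /=; rewrite mulr0 add0r. Qed.

Lemma Re_add (a b : R[i]) : Re (a + b) = Re a + Re b. Proof. by case: a b => [? ?] []. Qed.
Lemma Im_add (a b : R[i]) : Im (a + b) = Im a + Im b. Proof. by case: a b => [? ?] []. Qed.
Lemma Re_opp (a : R[i]) : Re (- a) = - Re a. Proof. by case: a. Qed.
Lemma Im_opp (a : R[i]) : Im (- a) = - Im a. Proof. by case: a. Qed.

Definition complex_solution zeta s u := exists wr wi,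
  solution_pair zeta s (fun x => Re (u x)) wr /\ solution_pair zeta s (fun x => Im (u x)) wi.

Lemma L2loc_locally_integrable u : L2loc u ->
  locally_integrable_fun (fun x => Re (u x)) /\ locally_integrable_fun (fun x => Im (u x)).
Proof.
move=> [[mr mi] l2].
have i1 a b : mu.-integrable `[a, b]
    (EFin \o (fun x => 1 + (Re (u x) ^+ 2 + Im (u x) ^+ 2))).
  have c1 : mu.-integrable `[a, b] (EFin \o cst 1).
    apply: continuous_compact_integrable; first exact: segment_compact.
    exact: cst_continuous.
  have mab : measurable (`[a, b]%classic : set (measurableTypeR R)).
    exact: measurable_itv.
  by have := integrableD mab c1 (l2 a b); apply: eq_integrable.
(* Square integrability implies integrability on bounded intervals, through [|p| <= 1 + p^2]. *)
have bd (p q : R) : `|p| <= 1 + (p ^+ 2 + q ^+ 2).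
  have h : `|p| ^+ 2 = p ^+ 2 by rewrite -normrX ger0_norm// sqr_ge0.
  have := sqr_ge0 q; have := sqr_ge0 (`|p| - 1); rewrite -h; nra.
split; split=> // a b; apply: le_integrable (i1 a b) => //.
- by apply/measurable_EFinP; exact: measurable_funTS.
- move=> x _ /=; rewrite lee_fin [leRHS]ger0_norm ?bd//.
  by rewrite !addr_ge0// sqr_ge0.
- by apply/measurable_EFinP; exact: measurable_funTS.
- move=> x _ /=; rewrite lee_fin [leRHS]ger0_norm; first by rewrite [X in 1 + X]addrC bd.
  by rewrite !addr_ge0// sqr_ge0.
Qed.

Lemma Re_cintegral D (f : R -> R[i]) : Re (cintegral D f) = \int[mu]_(x in D) Re (f x).
Proof. by []. Qed.

Lemma Im_cintegral D (f : R -> R[i]) : Im (cintegral D f) = \int[mu]_(x in D) Im (f x).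
Proof. by []. Qed.

Lemma weak_term (r : R -> R) (p : R -> R[i]) phi :
  Re (cintegral setT (fun x => (r x)%:C * p x * (phi x)%:C)) =
    \int[mu]_x (r x * Re (p x) * phi x) /\
  Im (cintegral setT (fun x => (r x)%:C * p x * (phi x)%:C)) =
    \int[mu]_x (r x * Im (p x) * phi x).
Proof.
split; rewrite /=; apply: eq_Rintegral => x _;
  rewrite ?Re_mulr_real ?Im_mulr_real mulrC [in RHS]mulrC;
  by rewrite [(r x)%:C * _]mulrC ?Re_mulr_real ?Im_mulr_real [r x * _]mulrC.
Qed.

Lemma sqr_realC sigma (z : R) : sigma%:C ^+ 2 * z%:C = (sigma ^+ 2 * z)%:C :> R[i].
Proof. by rewrite -rmorphXn -rmorphM. Qed.

Lemma impedance_solution_parts zeta sigma u :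
  continuous zeta -> (forall x, 0 < zeta x) ->
  impedance_solution zeta sigma%:C u -> complex_solution zeta (sigma ^+ 2) u.
Proof.
move=> cz z0 [[cr ci] [v [Lu Lv uv zv]]].
have [lr li] := L2loc_locally_integrable Lv.
have [|wr Hr] := @weak_solution_classical _ zeta (sigma ^+ 2) (fun x => Re (u x)) cz z0.
  split=> //; exists (fun x => Re (v x)); split=> // phi tphi.
    have /(congr1 Re) := uv _ tphi; rewrite Re_opp /=.
    under eq_Rintegral do rewrite Re_mulr_real.
    by under [in RHS]eq_Rintegral do rewrite Re_mulr_real.
  have /(congr1 Re) := zv _ tphi; rewrite Re_add Re_opp (weak_term _ _ _).1.
  rewrite (_ : (fun x => sigma%:C ^+ 2 * _ * _ * _) =
    (fun x => (sigma ^+ 2 * zeta x)%:C * u x * (phi x)%:C)); last first.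
    by apply/funext => x; rewrite sqr_realC.
  by rewrite (weak_term _ _ _).1 => /eqP; rewrite addrC subr_eq0 => /eqP.
have [|wi Hi] := @weak_solution_classical _ zeta (sigma ^+ 2) (fun x => Im (u x)) cz z0.
  split=> //; exists (fun x => Im (v x)); split=> // phi tphi.
    have /(congr1 Im) := uv _ tphi; rewrite Im_opp /=.
    under eq_Rintegral do rewrite Im_mulr_real.
    by under [in RHS]eq_Rintegral do rewrite Im_mulr_real.
  have /(congr1 Im) := zv _ tphi; rewrite Im_add Im_opp (weak_term _ _ _).2.
  rewrite (_ : (fun x => sigma%:C ^+ 2 * _ * _ * _) =
    (fun x => (sigma ^+ 2 * zeta x)%:C * u x * (phi x)%:C)); last first.
    by apply/funext => x; rewrite sqr_realC.
  by rewrite (weak_term _ _ _).2 => /eqP; rewrite addrC subr_eq0 => /eqP.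
by exists wr, wi.
Qed.

Lemma continuous_L2loc u : ccontinuous u -> L2loc u.
Proof.
move=> [cr ci]; split.
  by split; apply: measurable_continuous.
move=> a b; apply: (continuous_locally_integrable _).2 => x.
by apply: cvgD; apply: cvgM; [exact: cr|exact: cr|exact: ci|exact: ci].
Qed.

Lemma complex_solution_impedance zeta sigma u :
  continuous zeta -> (forall x, 0 < zeta x) ->
  complex_solution zeta (sigma ^+ 2) u -> impedance_solution zeta sigma%:C u.
Proof.
move=> cz z0 [wr [wi [Hr Hi]]].
have [cr _] := solution_pair_continuous Hr; have [ci _] := solution_pair_continuous Hi.
have [cvr r1 r2] := solution_pair_weak cz z0 Hr.
have [cvi i1 i2] := solution_pair_weak cz z0 Hi.
split=> //; exists (fun x => (wr x / zeta x) +i* (wi x / zeta x)); split.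
- exact: continuous_L2loc.
- exact: continuous_L2loc.
- move=> phi tphi; apply: complex_ext; rewrite ?Re_opp ?Im_opp ?Re_cintegral ?Im_cintegral.
    under eq_Rintegral do rewrite Re_mulr_real.
    under [in RHS]eq_Rintegral do rewrite Re_mulr_real.
    exact: r1.
  under eq_Rintegral do rewrite Im_mulr_real.
  under [in RHS]eq_Rintegral do rewrite Im_mulr_real.
  exact: i1.
- move=> phi tphi; rewrite (_ : (fun x => sigma%:C ^+ 2 * _ * _ * _) =
    (fun x => (sigma ^+ 2 * zeta x)%:C * u x * (phi x)%:C)); last first.
    by apply/funext => x; rewrite sqr_realC.
  apply: complex_ext; rewrite ?Re_add ?Im_add ?Re_opp ?Im_opp.
    by rewrite !(weak_term _ _ _).1 r2//= addNr.
  by rewrite !(weak_term _ _ _).2 i2//= addNr.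
Qed.

Lemma complex_solution_comb zeta s u v (a b : R[i]) :
  complex_solution zeta s u -> complex_solution zeta s v ->
  complex_solution zeta s (fun x => a * u x + b * v x).
Proof.
move=> [ur [ui [Hur Hui]]] [vr [vi [Hvr Hvi]]].
have Hr := solution_pairD 1 1 (solution_pairD (Re a) (- Im a) Hur Hui)
  (solution_pairD (Re b) (- Im b) Hvr Hvi).
have Hi := solution_pairD 1 1 (solution_pairD (Im a) (Re a) Hur Hui)
  (solution_pairD (Im b) (Re b) Hvr Hvi).
do 2 eexists; split; [move: Hr|move: Hi].
  rewrite (_ : (fun x => 1 * _ + _) = (fun x => Re (a * u x + b * v x))); first exact.
  by apply/funext => x; clear; case: a b (u x) (v x) => [? ?] [? ?] [? ?] [? ?] /=; ring.
rewrite (_ : (fun x => 1 * _ + _) = (fun x => Im (a * u x + b * v x))); first exact.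
by apply/funext => x; clear; case: a b (u x) (v x) => [? ?] [? ?] [? ?] [? ?] /=; ring.
Qed.

Lemma complex_solution_conj zeta s u : complex_solution zeta s u ->
  complex_solution zeta s (fun x => (u x)^*%C).
Proof.
move=> [wr [wi [Hr Hi]]]; have H := solution_pairD (-1) 0 Hi Hi.
exists wr, (fun x => -1 * wi x + 0 * wi x); split.
  by rewrite (_ : (fun x => Re _) = (fun x => Re (u x)))//; apply/funext => x; case: (u x).
rewrite (_ : (fun x => Im _) = (fun x => -1 * Im (u x) + 0 * Im (u x)))//.
by apply/funext => x; case: (u x) => p q /=; rewrite mul0r addr0 mulN1r.
Qed.

End complex_solutions.

(** * Identification of the Picard series with the harmonic exponential *)

Section harmonic_series.
Context {R : realType}.
Notation mu := (@lebesgue_measure R).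
Notation Re := (@complex.Re R).
Notation Im := (@complex.Im R).
Implicit Types (zeta phi : R -> R) (u v : R -> R[i]) (x t sigma : R) (j n : nat).

Definition cis t : R[i] := cos t +i* sin t.

Lemma cisD s t : cis (s + t) = cis s * cis t.
Proof. by apply: complex_ext; rewrite /= ?cosD ?sinD//; ring. Qed.

Lemma cisN t : cis (- t) = (cis t)^*%C.
Proof. by rewrite /cis cosN sinN. Qed.

Lemma cis0 : cis 0 = 1. Proof. by rewrite /cis cos0 sin0. Qed.

Lemma cexp_i (z : R[i]) t : Re z = 0 -> Im z = t -> cexp z = cis t.
Proof. by rewrite /cexp => -> ->; rewrite expR0 mul1r. Qed.

Lemma simplex_integral_ext j lo hi (F H : seq R -> R[i]) :
  (forall l, size l = j -> F l = H l) ->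
  simplex_integral j lo hi F = simplex_integral j lo hi H.
Proof.
elim: j lo F H => [|j ih] lo F H FH /=; first exact: FH.
congr cintegral; apply/funext => s; apply: ih => l lj.
by apply: FH; rewrite /= lj.
Qed.

Lemma kappa_rev_rcons (x0 s : R) m :
  kappa_rev x0 (rcons m s) = kappa_rev x0 m + (-1) ^+ size m * (s - x0).
Proof.
have [n] := ubnP (size m); elim: n m => // n ih [|a [|b m]] /= mn.
- by rewrite expr0 mul1r add0r.
- by rewrite expr1; ring.
- by rewrite ih; [rewrite !exprS; ring|exact: ltnW].
Qed.

(** If [l] has even length, the new first entry is unpaired and adds [s - x0]. If the length is odd,
    the formerly unpaired entry is now measured from [s] instead of [x0], which subtracts
    [s - x0]. *)
Lemma kappa_cons (x0 s : R) l :
  kappa x0 (s :: l) = kappa x0 l + (-1) ^+ size l * (s - x0).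
Proof. by rewrite /kappa rev_cons kappa_rev_rcons size_rev. Qed.

Lemma cexp_phase sigma r : cexp (2 * 'i%C * sigma%:C * r%:C) = cis (2 * (sigma * r)).
Proof. by apply: cexp_i => /=; ring. Qed.

Variables (sigma x0 x1 : R) (alpha beta : R -> R).
Hypothesis ib : mu.-integrable setT (EFin \o beta).
Hypothesis beta0 : forall x, x1 <= x -> beta x = 0.
Hypothesis alphaE : {ae mu, forall x, alpha x = beta x}.

Let weight (l : seq R) : R[i] :=
  cexp (2 * 'i%C * sigma%:C * (kappa x0 l)%:C) * (\prod_(a <- l) alpha a)%:C.

Let weight_cons s l : weight (s :: l) =
  (alpha s)%:C * cis ((-1) ^+ size l * (2 * (sigma * (s - x0)))) * weight l.
Proof.
rewrite /weight big_cons kappa_cons !cexp_phase rmorphM /=.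
rewrite (_ : 2 * (sigma * _) = (-1) ^+ size l * (2 * (sigma * (s - x0))) +
   2 * (sigma * kappa x0 l)); last by ring.
by rewrite cisD; ring.
Qed.

(** Three changes at once: [alpha] becomes [beta], the domain is extended to [+oo] because [beta]
    vanishes from [x1] on, and the complex constant is taken out. *)
Let cintegral_kernel (z : R[i]) (K : R -> R[i]) C lo :
  measurable_fun [set: R] (fun t => Re (K t)) -> measurable_fun [set: R] (fun t => Im (K t)) ->
  (forall t, `|Re (K t)| <= C) -> (forall t, `|Im (K t)| <= C) ->
  cintegral `]lo, x1[ (fun s => z * ((alpha s)%:C * K s)) =
  z * (tail_integral (fun t => beta t * Re (K t)) lo +i* tail_integral (fun t =>
    beta t * Im (K t)) lo).
Proof.
move=> mr mi Kr Ki.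
have i1 := integrableM_bounded ib mr Kr; have i2 := integrableM_bounded ib mi Ki.
have key (g : R -> R) (p q : R) :
    (forall t, beta t * g t = p * (beta t * Re (K t)) + q * (beta t * Im (K t))) ->
    \int[mu]_(t in `]lo, x1[) (alpha t * g t) =
    p * tail_integral (fun t => beta t * Re (K t)) lo + q * tail_integral (fun t =>
      beta t * Im (K t)) lo.
  move=> gE.
  transitivity (\int[mu]_(t in `]lo, x1[) (beta t * g t)).
    apply: ae_eq_Rintegral; have FF := ae_filter_ringOfSetsType mu.
    by move: alphaE; apply: filterS => t ->.
  transitivity (\int[mu]_(t in `]lo, +oo[) (beta t * g t)).
    rewrite Rintegral_mkcond [RHS]Rintegral_mkcond; apply: eq_Rintegral => t _.
    rewrite !patchE; have [tx|tx] := ltP t x1; last first.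
      by rewrite beta0// mul0r; do 2 case: ifP.
    by congr (if _ then _ else _); apply/idP/idP; rewrite !inE/= !in_itv/= tx andbT.
  rewrite /tail_integral -!RintegralZl//; last 2 first.
  - by apply: integrableS i2.
  - by apply: integrableS i1.
  rewrite -RintegralD//; last 2 first.
  - by apply: integrable_fun_scale => //; apply: integrableS i1.
  - by apply: integrable_fun_scale => //; apply: integrableS i2.
  by apply: eq_Rintegral => t _.
apply: complex_ext; rewrite ?Re_cintegral ?Im_cintegral.
  rewrite (_ : (fun t => Re _) = (fun t => alpha t * (Re z * Re (K t) - Im z * Im (K t)))).
    rewrite (key _ (Re z) (- Im z)); first by case: z => a b /=; ring.
    by move=> t; ring.
  by apply/funext => t; clear; case: z (K t) => [a b] [c d] /=; ring.
rewrite (_ : (fun t => Im _) = (fun t => alpha t * (Im z * Re (K t) + Re z * Im (K t)))).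
  rewrite (key _ (Im z) (Re z)); first by case: z => a b /=; ring.
  by move=> t; ring.
by apply/funext => t; clear; case: z (K t) => [a b] [c d] /=; ring.
Qed.

Let p j := (picard sigma x0 beta j).1.
Let q j := (picard sigma x0 beta j).2.
(** The j-th iterate for even [j], its conjugate for odd [j]. *)
Let g j t : R[i] := p j t +i* ((-1) ^+ j * q j t).

Let pS j x : p j.+1 x = tail_integral (fun t => beta t *
   (cos (2 * (sigma * (t - x0))) * p j t - sin (2 * (sigma * (t - x0))) * q j t)) x.
Proof. by []. Qed.

Let qS j x : q j.+1 x = tail_integral (fun t => beta t *
   - (cos (2 * (sigma * (t - x0))) * q j t + sin (2 * (sigma * (t - x0))) * p j t)) x.
Proof. by []. Qed.

(** The outermost variable contributes a phase of sign [(-1)^j] by [kappa_cons]. Multiplying [g j]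
    by it gives the Picard integrand or its conjugate, according to the parity of [j.+1]. The free
    constant [z] absorbs this factor, so that the induction hypothesis applies to the inner
    integral. *)
Lemma simplex_weight j lo (z : R[i]) :
  simplex_integral j lo x1 (fun l => z * weight l) = z * g j lo.
Proof.
elim: j lo z => [|j ih] lo z /=.
  rewrite /weight /kappa /= big_nil cexp_phase mulr0 mulr0 cis0.
  by congr (_ * _); apply: complex_ext; rewrite /= ?/p ?/q /picard /=; ring.
have E s : simplex_integral j s x1 (fun l => z * weight (s :: l)) =
    z * ((alpha s)%:C * (cis ((-1) ^+ j * (2 * (sigma * (s - x0)))) * g j s)).
  rewrite (@simplex_integral_ext j s x1 _ (fun l =>
    (z * (alpha s)%:C * cis ((-1) ^+ j * (2 * (sigma * (s - x0))))) * weight l)).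
    by rewrite ih !mulrA.
  by move=> l <-; rewrite weight_cons !mulrA.
rewrite (_ : (fun s => _) = (fun s => z * ((alpha s)%:C *
   (cis ((-1) ^+ j * (2 * (sigma * (s - x0)))) * g j s)))); last first.
  by apply/funext => s; exact: E.
have sgn : (-1) ^+ j = 1 :> R \/ (-1) ^+ j = -1 :> R.
  by rewrite -signr_odd; case: (odd j); [right|left]; rewrite ?expr1 ?expr0.
have KE t : cis ((-1) ^+ j * (2 * (sigma * (t - x0)))) * g j t =
  (cos (2 * (sigma * (t - x0))) * p j t - sin (2 * (sigma * (t - x0))) * q j t) +i*
  ((-1) ^+ j * (cos (2 * (sigma * (t - x0))) * q j t + sin (2 * (sigma * (t - x0))) * p j t)).
  rewrite /cis /g; case: sgn => ->; apply: complex_ext;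
    rewrite ?mul1r ?mulN1r ?cosN ?sinN /=; ring.
have [c1 c2 _] := picard_dominated sigma x0 ib beta0 j.
have mp := measurable_continuous c1; have mq := measurable_continuous c2.
have [C hC] := picard_bounded sigma x0 ib beta0 j.
have [dc ds] := ac_trig (2 * sigma) x0.
have mc : measurable_fun [set: R] (fun t => cos (2 * (sigma * (t - x0)))).
  apply: measurable_continuous; under eq_fun do rewrite mulrA; exact: ac_continuous.
have ms : measurable_fun [set: R] (fun t => sin (2 * (sigma * (t - x0)))).
  apply: measurable_continuous; under eq_fun do rewrite mulrA; exact: ac_continuous.
have bound (c s a b : R) : `|c| <= 1 -> `|s| <= 1 -> `|a| <= C -> `|b| <= C ->
    `|c * a + s * b| <= C + C.
  move=> c1' s1 aC bC; apply: le_trans (ler_normD _ _) _; rewrite !normrM.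
  by apply: lerD; [apply: le_trans aC|apply: le_trans bC]; rewrite ler_piMl.
have mX : measurable_fun [set: R] (fun t =>
    cos (2 * (sigma * (t - x0))) * q j t + sin (2 * (sigma * (t - x0))) * p j t).
  by apply: measurable_funD; apply: measurable_funM.
have bX t : `|cos (2 * (sigma * (t - x0))) * q j t +
  sin (2 * (sigma * (t - x0))) * p j t| <= C + C.
  by apply: bound; rewrite ?normr_cos_le1 ?normr_sin_le1//; have [] := hC t.
rewrite (@cintegral_kernel z _ (C + C)).
- congr (_ * _); apply: complex_ext.
    change (tail_integral (fun t => beta t *
      Re (cis ((-1) ^+ j * (2 * (sigma * (t - x0)))) * g j t)) lo = p j.+1 lo).
    by rewrite pS; apply: eq_Rintegral => t _; rewrite KE.
  change (tail_integral (fun t => beta t *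
    Im (cis ((-1) ^+ j * (2 * (sigma * (t - x0)))) * g j t)) lo = (-1) ^+ j.+1 * q j.+1 lo).
  rewrite qS.
  have mN : measurable_fun [set: R] (fun t =>
      - (cos (2 * (sigma * (t - x0))) * q j t + sin (2 * (sigma * (t - x0))) * p j t)).
    exact: measurableT_comp.
  have bN t : `|- (cos (2 * (sigma * (t - x0))) * q j t +
      sin (2 * (sigma * (t - x0))) * p j t)| <= C + C by rewrite normrN.
  have iN := integrableM_bounded ib mN bN.
  rewrite /tail_integral -RintegralZl//; last by apply: integrableS iN.
  by apply: eq_Rintegral => t _; rewrite KE /= exprS; ring.
- under eq_fun do rewrite KE /=.
  by apply: measurable_funB; apply: measurable_funM.
- under eq_fun do rewrite KE /=.
  exact: measurable_funM.
- move=> t; rewrite KE /= -mulNr; apply: bound; rewrite ?normrN ?normr_cos_le1 ?normr_sin_le1//;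
    by have [] := hC t.
- move=> t; rewrite KE /= normrM.
  by case: sgn => ->; rewrite ?normrN normr1 mul1r.
Qed.

Lemma harmonic_termE j : harmonic_term x0 x1 alpha sigma%:C j = g j x0.
Proof.
rewrite /harmonic_term -[g j x0]mul1r -simplex_weight.
by apply: simplex_integral_ext => l _; rewrite mul1r.
Qed.

Lemma picard_opp j x : (picard sigma x0 (fun t => - beta t) j).1 x = (-1) ^+ j * p j x /\
  (picard sigma x0 (fun t => - beta t) j).2 x = (-1) ^+ j * q j x.
Proof.
elim: j x => [|j ih] x; first by rewrite /p /q /picard /= !mul1r.
have sgn : (-1) ^+ j = 1 :> R \/ (-1) ^+ j = -1 :> R.
  by rewrite -signr_odd; case: (odd j); [right|left]; rewrite ?expr1 ?expr0.
have [c1 c2 _] := picard_dominated sigma x0 ib beta0 j.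
have mp := measurable_continuous c1; have mq := measurable_continuous c2.
have [C hC] := picard_bounded sigma x0 ib beta0 j.
have mc : measurable_fun [set: R] (fun t => cos (2 * (sigma * (t - x0)))).
  apply: measurable_continuous; under eq_fun do rewrite mulrA.
  by apply: ac_continuous; exact: (ac_trig (2 * sigma) x0).1.
have ms : measurable_fun [set: R] (fun t => sin (2 * (sigma * (t - x0)))).
  apply: measurable_continuous; under eq_fun do rewrite mulrA.
  by apply: ac_continuous; exact: (ac_trig (2 * sigma) x0).2.
have bound (c s a b : R) : `|c| <= 1 -> `|s| <= 1 -> `|a| <= C -> `|b| <= C ->
    `|c * a + s * b| <= C + C.
  move=> c1' s1 aC bC; apply: le_trans (ler_normD _ _) _; rewrite !normrM.
  by apply: lerD; [apply: le_trans aC|apply: le_trans bC]; rewrite ler_piMl.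
have i1 : mu.-integrable setT (EFin \o (fun t => beta t *
    (cos (2 * (sigma * (t - x0))) * p j t - sin (2 * (sigma * (t - x0))) * q j t))).
  apply: (@integrableM_bounded _ _ _ (C + C)) => //.
    by apply: measurable_funB; apply: measurable_funM.
  move=> t; rewrite -mulNr; apply: bound; rewrite ?normrN ?normr_cos_le1 ?normr_sin_le1//;
    by have [] := hC t.
have i2 : mu.-integrable setT (EFin \o (fun t => beta t *
    - (cos (2 * (sigma * (t - x0))) * q j t + sin (2 * (sigma * (t - x0))) * p j t))).
  apply: (@integrableM_bounded _ _ _ (C + C)) => //.
    by apply: measurableT_comp => //; apply: measurable_funD; apply: measurable_funM.
  move=> t; rewrite normrN; apply: bound; rewrite ?normr_cos_le1 ?normr_sin_le1//;
    by have [] := hC t.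
rewrite pS qS /tail_integral -!RintegralZl//; last 2 first.
- by apply: integrableS i2.
- by apply: integrableS i1.
split; apply: eq_Rintegral => t _; have [-> ->] := ih t; rewrite exprS; ring.
Qed.

(* The j-th term is [p_j + i (-1)^j q_j] at [x0], because of the conjugation in each Picard step,
   and [(-1)^j q_j] is the imaginary part of the j-th iterate for [- beta]. *)
Lemma harmonic_expE (a b : R) :
  \sum_(0 <= j < n) (picard sigma x0 beta j).1 x0 @[n --> \oo] --> a ->
  \sum_(0 <= j < n) (picard sigma x0 (fun t => - beta t) j).2 x0 @[n --> \oo] --> b ->
  harmonic_exp x0 x1 alpha sigma%:C = a +i* b.
Proof.
move=> ha hb; rewrite /harmonic_exp /clim.
have sumRe n (F : nat -> R[i]) : Re (\sum_(1 <= j < n) F j) = \sum_(1 <= j < n) Re (F j).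
  by apply: (big_morph Re (id1 := 0)) => // u v; exact: Re_add.
have sumIm n (F : nat -> R[i]) : Im (\sum_(1 <= j < n) F j) = \sum_(1 <= j < n) Im (F j).
  by apply: (big_morph Im (id1 := 0)) => // u v; exact: Im_add.
have /cvg_lim -> // : Re (\sum_(1 <= j < n) harmonic_term x0 x1 alpha sigma%:C j)
    @[n --> \oo] --> a - 1.
  rewrite -cvg_shiftS /=.
  rewrite (_ : (fun n => _) = (fun n => \sum_(0 <= j < n.+1) p j x0 - 1)).
    by apply: cvgB; [rewrite (cvg_shiftS (fun n => \sum_(0 <= j < n) p j x0))|exact: cvg_cst].
  apply/funext => n; rewrite sumRe [in RHS]big_ltn//.
  rewrite (_ : p 0 x0 = 1)// [1 + _]addrC addrK; apply: eq_bigr => j _.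
  by rewrite harmonic_termE.
have /cvg_lim -> // : Im (\sum_(1 <= j < n) harmonic_term x0 x1 alpha sigma%:C j)
    @[n --> \oo] --> b.
  rewrite (_ : (fun n => _) = (fun n => \sum_(0 <= j < n)
    (picard sigma x0 (fun t => - beta t) j).2 x0))//.
  apply/funext => n; rewrite sumIm; case: n => [|n]; first by rewrite !big_geq.
  rewrite [in RHS]big_ltn// [X in X + _](_ : _ = 0)// add0r.
  apply: eq_bigr => j _.
  by rewrite harmonic_termE /g; have [_ ->] := picard_opp j x0.
by apply: complex_ext => /=; ring.
Qed.

End harmonic_series.

(** * The Jost solution and its transmission identity *)

Section scattering.
Context {R : realType}.
Notation mu := (@lebesgue_measure R).
Notation Re := (@complex.Re R).
Notation Im := (@complex.Im R).

Lemma sqrt_expR (t : R) : Num.sqrt (expR t) = expR (2^-1 * t).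
Proof.
rewrite -[RHS]ger0_norm ?expR_ge0// -sqrtr_sqr; congr Num.sqrt.
by rewrite expr2 -expRD; congr expR; lra.
Qed.

Variables (x0 x1 : R) (zeta : R -> R) (sigma : R).
Hypothesis hX : x0 < x1.
Hypothesis zeta_gt0 : forall x, 0 < zeta x.
Hypothesis zeta_ac : abs_cont zeta.
Hypothesis zeta_supp : ess_support (derive1 zeta) `<=` `]x0, x1[.
Hypothesis sigma_neq0 : sigma != 0.

Let alpha : R -> R := fun x => - 2^-1 * derive1 (fun t => ln (zeta t)) x.
Let A := harmonic_cosh x0 x1 alpha sigma%:C.
Let B := harmonic_sinh x0 x1 alpha sigma%:C.

(** [F] is [e^{-i sigma x0} f1]: measuring phases from [x0] removes the exponentials in [x0] from
    the coefficients on the left. Uniqueness is stated here because the real and imaginary parts of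
    [F] supply the two independent solutions it needs. *)
Lemma jost_function : exists F : R -> R[i],
  [/\ complex_solution zeta (sigma ^+ 2) (fun x => F x / (Num.sqrt (zeta x))%:C),
      forall x, x1 <= x -> F x = cis (sigma * (x - x0)),
      forall x, x <= x0 -> F x = A * cis (sigma * (x - x0)) + B * cis (- (sigma * (x - x0))),
      A * A^*%C - B * B^*%C = 1 &
      forall (D : R -> R[i]) (p : R),
        complex_solution zeta (sigma ^+ 2) (fun x => D x / (Num.sqrt (zeta x))%:C) ->
        (\forall x \near p, D x = 0) -> forall x, D x = 0].
Proof.
have [beta [ib bout alphaE LD]] := reflectivity_density hX zeta_gt0 zeta_ac zeta_supp.
have b1 x : x1 <= x -> beta x = 0 by move=> xx; apply: bout => /andP[_]; lra.
have b0 x : x <= x0 -> beta x = 0 by move=> xx; apply: bout => /andP[]; lra.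
pose nbeta x := - beta x.
have inb : mu.-integrable setT (EFin \o nbeta).
  have := integrable_fun_scale (-1) measurableT ib.
  by apply: eq_integrable => // x _; rewrite /= mulN1r.
have nb1 x : x1 <= x -> nbeta x = 0 by move=> /b1; rewrite /nbeta => ->; rewrite oppr0.
have nb0 x : x <= x0 -> nbeta x = 0 by move=> /b0; rewrite /nbeta => ->; rewrite oppr0.
have [a [b [cva cvb [aca acb [K abK] ab1 [ab0 abD]]]]] := picard_limit sigma ib b1 b0.
have [a' [b' [cva' cvb' [aca' acb' [K' abK'] ab1' [ab0' abD']]]]] :=
  picard_limit sigma inb nb1 nb0.
have FF := ae_filter_ringOfSetsType mu.
have E1 : harmonic_exp x0 x1 alpha sigma%:C = a x0 +i* b' x0.
  by apply: (harmonic_expE ib b1 alphaE); [exact: cva|exact: cvb'].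
have nalphaE : {ae mu, forall x, - alpha x = nbeta x}.
  by move: alphaE; apply: filterS => x; rewrite /nbeta => <-.
have E2 : harmonic_exp x0 x1 (fun s => - alpha s) sigma%:C = a' x0 +i* b x0.
  apply: (harmonic_expE inb nb1 nalphaE); first exact: cva'.
  rewrite (_ : (fun t => - nbeta t) = beta); first exact: cvb.
  by apply/funext => t; rewrite /nbeta opprK.
pose L t := ln (zeta t).
have zE : zeta = (fun x => expR (L x)) by apply/funext => x; rewrite /L lnK// posrE.
have acL : abs_cont L by exact: (ac_ln_impedance hX zeta_gt0 zeta_ac zeta_supp).
have [C LC] : exists C, forall x, `|L x| <= C.
  have [m m0 zm] := impedance_lower_bound hX zeta_gt0 zeta_ac zeta_supp.
  have [M zM] := impedance_upper_bound hX zeta_ac zeta_supp.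
  have M0 : 0 < M by apply: lt_le_trans (zM x0).
  exists (Num.max (ln M) (- ln m)) => x.
  rewrite ler_norml lerNl !le_max lerN2; apply/andP; split; apply/orP; [right|left].
    by rewrite ler_ln ?posrE ?zm.
  by rewrite ler_ln ?posrE ?zM.
pose c t := cos (sigma * (t - x0)); pose s t := sin (sigma * (t - x0)).
pose Y t := a t * c t - b t * s t; pose Z t := a t * s t + b t * c t.
pose Y' t := a' t * c t - b' t * s t; pose Z' t := a' t * s t + b' t * c t.
have YZac (p q : R -> R) M : abs_cont p -> abs_cont q -> (forall x, `|p x| <= M /\ `|q x| <= M) ->
  [/\ abs_cont (fun t => p t * c t - q t * s t), abs_cont (fun t => p t * s t + q t * c t),
     forall x, `|p x * c x - q x * s x| <= M + M &
     forall x, `|p x * s x + q x * c x| <= M + M].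
  move=> aca0 acb0 h; have [acc acs] := ac_trig sigma x0.
  have ha x : `|p x| <= M by have [] := h x.
  have hq x : `|q x| <= M by have [] := h x.
  have hc x : `|c x| <= 1 by exact: normr_cos_le1.
  have hs x : `|s x| <= 1 by exact: normr_sin_le1.
  split.
  - by apply: acB; [exact: acM_bounded ha hc aca0 acc|exact: acM_bounded hq hs acb0 acs].
  - by apply: acD; [exact: acM_bounded ha hs aca0 acs|exact: acM_bounded hq hc acb0 acc].
  - move=> x; apply: le_trans (ler_normB _ _) _; rewrite !normrM lerD//.
      by apply: le_trans (ha x); rewrite ler_piMr.
    by apply: le_trans (hq x); rewrite ler_piMr.
  - move=> x; apply: le_trans (ler_normD _ _) _; rewrite !normrM lerD//.
      by apply: le_trans (ha x); rewrite ler_piMr.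
    by apply: le_trans (hq x); rewrite ler_piMr.
have [acY acZ YK ZK] := YZac _ _ _ aca acb abK.
have [acY' acZ' YK' ZK'] := YZac _ _ _ aca' acb' abK'.
have YZD : {ae mu, forall t : R, is_derive t 1 Y (- beta t * Y t - sigma * Z t) /\
                    is_derive t 1 Z (beta t * Z t + sigma * Y t)}.
  by move: abD; apply: filterS => t [d1 d2]; exact: rotation_derive d1 d2.
(* The pair for [- beta], with its components exchanged, solves the system for [beta] with
   [- sigma]; only [sigma ^+ 2] enters the equation for [u]. *)
have YZD' : {ae mu, forall t : R, is_derive t 1 Z' (- beta t * Z' t - - sigma * Y' t) /\
                    is_derive t 1 Y' (beta t * Y' t + - sigma * Z' t)}.
  move: abD'; apply: filterS => t [d1 d2]; have [d3 d4] := rotation_derive d1 d2.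
  split; [apply: (is_derive_eq d4)|apply: (is_derive_eq d3)]; rewrite /nbeta /Y' /Z' /c /s; ring.
have Hr := liouville_solution acL LC acY acZ YK ZK LD YZD.
have Hi := liouville_solution acL LC acZ' acY' ZK' YK' LD YZD'.
rewrite sqrrN -zE in Hi; rewrite -zE in Hr.
have sqE x : Num.sqrt (zeta x) = expR (2^-1 * L x) by rewrite {1}zE sqrt_expR.
have isqE x : (Num.sqrt (zeta x))^-1 = expR (- 2^-1 * L x) by rewrite sqE mulNr expRN.
have divE (z : R[i]) x : z / (Num.sqrt (zeta x))%:C =
    z * (expR (- 2^-1 * L x))%:C by rewrite -fmorphV isqE.
have ee x : expR (- 2^-1 * L x) * expR (2^-1 * L x) = 1.
  by rewrite -expRD mulNr addNr expR0.
have Wc x : (Y x * expR (- 2^-1 * L x)) * (- - sigma * (Y' x * expR (2^-1 * L x))) -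
    (Z' x * expR (- 2^-1 * L x)) * (- sigma * (Z x * expR (2^-1 * L x))) =
    sigma * (a x * a' x + b x * b' x).
  transitivity (sigma * (Y x * Y' x + Z x * Z' x) *
    (expR (- 2^-1 * L x) * expR (2^-1 * L x))); first by ring.
  have E : c x * c x = 1 - s x * s x by rewrite -!expr2 /c /s cos2sin2.
  by rewrite ee mulr1 /Y /Y' /Z /Z'; ring: E.
have W1 x : a x * a' x + b x * b' x = 1.
  apply: (mulfI sigma_neq0); rewrite -Wc (wronskian_const x x1 zeta_gt0 Hr Hi) Wc.
  have [-> ->] := ab1 x1 (lexx _); have [-> ->] := ab1' x1 (lexx _).
  by rewrite mul0r addr0 mulr1.
exists (fun x => Y x +i* Z' x); split.
- exists (fun x => - sigma * (Z x * expR (2^-1 * L x))).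
  exists (fun x => - - sigma * (Y' x * expR (2^-1 * L x))); split.
    rewrite (_ : (fun x => Re _) = (fun x => Y x * expR (- 2^-1 * L x)))//.
    by apply/funext => x; rewrite divE Re_mulr_real.
  rewrite (_ : (fun x => Im _) = (fun x => Z' x * expR (- 2^-1 * L x)))//.
  by apply/funext => x; rewrite divE Im_mulr_real.
- move=> x xx; have [h1 h2] := ab1 x xx; have [h3 h4] := ab1' x xx.
  apply: complex_ext; rewrite /= ?/Y ?/Z' ?h1 ?h2 ?h3 ?h4 /c /s; ring.
- move=> x xx; have [h1 h2] := ab0 x xx; have [h3 h4] := ab0' x xx.
  rewrite cisN /A /B /harmonic_cosh /harmonic_sinh E1 E2.
  (* On the left [F = E1 cos theta + i E2 sin theta], with [E1], [E2] the harmonic exponentials of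
     [alpha] and [- alpha]; writing cosine and sine as exponentials yields Cosh and Sinh as
     coefficients. *)
  transitivity (2^-1 * 2 * ((a x0 +i* b' x0) * (c x +i* 0) + (a' x0 +i* b x0) * (0 +i* s x))).
    rewrite mulVf ?mul1r ?pnatr_eq0//.
    by apply: complex_ext; rewrite /= ?/Y ?/Z' ?h1 ?h2 ?h3 ?h4; ring.
  have -> : cis (sigma * (x - x0)) = (c x +i* 0) + (0 +i* s x).
    by apply: complex_ext; rewrite /= ?addr0 ?add0r.
  have -> : ((c x +i* 0) + (0 +i* s x))^*%C = (c x +i* 0) - (0 +i* s x).
    by apply: complex_ext; rewrite /= ?subr0 ?add0r ?addr0 ?sub0r.
  by ring.
- rewrite /A /B /harmonic_cosh /harmonic_sinh E1 E2.
  have -> : (2^-1 : R[i]) = (2^-1 : R)%:C by rewrite fmorphV rmorph_nat.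
  have := W1 x0 => W.
  apply: complex_ext => /=; last by ring.
  (* In terms of the series, [|Cosh|^2 - |Sinh|^2] is exactly [a a' + b b'] at [x0]. *)
  by rewrite -[RHS]W; field.
- move=> D p [wr [wi [Dr Di]]] D0 x.
  have W0 : (Y x1 * expR (- 2^-1 * L x1)) * (- - sigma * (Y' x1 * expR (2^-1 * L x1))) -
    (Z' x1 * expR (- 2^-1 * L x1)) * (- sigma * (Z x1 * expR (2^-1 * L x1))) != 0.
    by rewrite Wc W1 mulr1.
  have nr : \forall x \near p, Re (D x / (Num.sqrt (zeta x))%:C) = 0.
    by move: D0; apply: filterS => y ->; rewrite mul0r.
  have ni : \forall x \near p, Im (D x / (Num.sqrt (zeta x))%:C) = 0.
    by move: D0; apply: filterS => y ->; rewrite mul0r.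
  have hr := solution_pair_unique zeta_gt0 Hr Hi W0 Dr nr x.
  have hi := solution_pair_unique zeta_gt0 Hr Hi W0 Di ni x.
  have : D x / (Num.sqrt (zeta x))%:C = 0 by apply: complex_ext.
  move=> /eqP; rewrite mulf_eq0 invr_eq0 => /orP[/eqP//|].
  by rewrite fmorph_eq0 sqE gt_eqF// expR_gt0.
Qed.

End scattering.

(** * Plane waves and the S-matrix *)

Section plane_waves.
Context {R : realType}.
Implicit Types (sigma x y t : R) (z p q : R[i]).

Lemma conj_mul p q : (p * q)^*%C = p^*%C * q^*%C. Proof. exact: rmorphM. Qed.

Lemma conj_add p q : (p + q)^*%C = p^*%C + q^*%C. Proof. exact: rmorphD. Qed.

Lemma conj_real x : (x%:C)^*%C = x%:C :> R[i].
Proof. by apply: complex_ext; rewrite /= ?oppr0. Qed.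

Lemma cexp_wave sigma x : cexp ('i%C * sigma%:C * x%:C) = cis (sigma * x).
Proof. by apply: cexp_i => /=; ring. Qed.

Lemma cexp_waveN sigma x : cexp (- ('i%C * sigma%:C * x%:C)) = (cis (sigma * x))^*%C.
Proof. by rewrite -cisN; apply: cexp_i => /=; ring. Qed.

Lemma cexp_wave2 sigma x : cexp (2 * 'i%C * sigma%:C * x%:C) = cis (sigma * x) * cis (sigma * x).
Proof. by rewrite -cisD; apply: cexp_i => /=; ring. Qed.

Lemma cexp_wave2N sigma x : cexp (- (2 * 'i%C * sigma%:C * x%:C)) =
  (cis (sigma * x))^*%C * (cis (sigma * x))^*%C.
Proof. by rewrite -!cisN -cisD; apply: cexp_i => /=; ring. Qed.

Lemma cis_conj t : cis t * (cis t)^*%C = 1.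
Proof. by rewrite -cisN -cisD subrr cis0. Qed.

Lemma cis_half_turn sigma t : sigma != 0 -> `|t| = pi / 2 / `|sigma| ->
  cis (sigma * t) * cis (sigma * t) = -1.
Proof.
move=> s0 tE; rewrite -cisD.
have h : `|sigma * t + sigma * t| = pi.
  rewrite -mulr2n -mulr_natl !normrM tE normr_nat; field.
  by rewrite normr_eq0.
have [H|H] := ler0P (sigma * t + sigma * t).
  have -> : sigma * t + sigma * t = - pi by rewrite -h ler0_norm ?opprK.
  by apply: complex_ext; rewrite /cis /= ?cosN ?sinN ?cospi ?sinpi ?oppr0.
have -> : sigma * t + sigma * t = pi by rewrite -h gtr0_norm.
by apply: complex_ext; rewrite /cis /= ?cospi ?sinpi ?oppr0.
Qed.

(** The points are a quarter of a wavelength apart, so the phase between them is [k] with [k^2 = -1]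
    and [conj k = - k]. The two equations become [p e + q conj e = 0] and [p e - q conj e = 0]. The
    absolute value permits a step in either direction, as the two half-lines require. *)
Lemma wave_independence sigma p q y y' : sigma != 0 -> `|y' - y| = pi / 2 / `|sigma| ->
  p * cis (sigma * y) + q * (cis (sigma * y))^*%C = 0 ->
  p * cis (sigma * y') + q * (cis (sigma * y'))^*%C = 0 -> p = 0 /\ q = 0.
Proof.
move=> s0 yE; have kk := cis_half_turn s0 yE.
have -> : cis (sigma * y') = cis (sigma * y) * cis (sigma * (y' - y)).
  by rewrite -cisD; congr cis; ring.
move: (cis (sigma * y)) (cis_conj (sigma * y)) (cis (sigma * (y' - y)))
  (cis_conj (sigma * (y' - y))) kk => e ee k kkc kk H1 H2.
have kc : k^*%C = - k.
  by rewrite -[LHS]opprK -[k^*%C]mul1r -mulNr -kk -mulrA kkc mulr1.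
rewrite conj_mul kc in H2.
have E : p * e = 0.
  have : k * (2 * (p * e)) = k * (p * e + q * e^*%C) + (p * (e * k) + q * (e^*%C * - k)) by ring.
  rewrite H1 H2 mulr0 addr0 => /(congr1 (fun z => - (k * z))).
  rewrite mulr0 oppr0 mulrA kk mulN1r opprK => /eqP.
  by rewrite mulf_eq0 pnatr_eq0 /= => /eqP.
have p0 : p = 0 by rewrite -[p]mulr1 -ee mulrA E mul0r.
split=> //; move: H1; rewrite p0 mul0r add0r => h.
by rewrite -[q]mulr1 -ee [e * _]mulrC mulrA h mul0r.
Qed.

End plane_waves.

Theorem theorem3 (R : realType) (x0 x1 : R) (zeta : R -> R) (sigma : R)
    (hX : x0 < x1)
    (zeta_gt0 : forall x, 0 < zeta x)
    (zeta_ac : absolutely_continuous zeta)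
    (zeta_supp : ess_support (derive1 zeta) `<=` `]x0, x1[)
    (sigma_neq0 : sigma != 0) :
  let alpha : R -> R := fun x => - 2^-1 * derive1 (fun t => ln (zeta t)) x in
  forall M : 'M[R[i]]_2,
    is_S_matrix zeta x0 x1 sigma%:C M <->
    M = harmonic_sech x0 x1 alpha sigma%:C *:
        mx2 1
            (cexp (2 * 'i%C * sigma%:C * x0%:C) *
               harmonic_sinh x0 x1 alpha sigma%:C)
            (- (cexp (- (2 * 'i%C * sigma%:C * x0%:C)) *
               (harmonic_sinh x0 x1 alpha sigma%:C)^*%C))
            1.
Proof.
move=> alpha M; have acz := absolutely_continuousP zeta_ac.
have cz := ac_continuous acz.
have [F [Fsol F1 F0 W uniq]] := jost_function hX zeta_gt0 acz zeta_supp sigma_neq0.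
rewrite -/alpha in F0 W; rewrite cexp_wave2 cexp_wave2N /harmonic_sech.
move: (harmonic_cosh x0 x1 alpha sigma%:C) (harmonic_sinh x0 x1 alpha sigma%:C) F0 W
  => A B F0 W.
(* If [A] were 0, the identity [W] would read [- |B|^2 = 1]. *)
have A0 : A != 0.
  apply/eqP => A0; move: W; rewrite A0 mul0r sub0r => /(congr1 (@complex.Re R)).
  clear; case: B => p q /= h; have := sqr_ge0 p; have := sqr_ge0 q; nra.
set e0 := cis (sigma * x0).
have e01 : e0 * e0^*%C = 1 by exact: cis_conj.
have shift x : cis (sigma * (x - x0)) = cis (sigma * x) * e0^*%C.
  by rewrite /e0 -cisN -cisD; congr cis; ring.
pose sol (f : R -> R[i]) := complex_solution zeta (sigma ^+ 2)
  (fun x => f x / (Num.sqrt (zeta x))%:C).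
have solE f : schrodinger_solution zeta sigma%:C f <-> sol f.
  by split; [exact: impedance_solution_parts|exact: complex_solution_impedance].
have comb f g a b : sol f -> sol g -> sol (fun x => a * f x + b * g x).
  move=> sf sg; have := complex_solution_comb a b sf sg.
  rewrite /sol (_ : (fun x => a * (f x / _) + _) =
    (fun x => (a * f x + b * g x) / (Num.sqrt (zeta x))%:C))//.
  by apply/funext => x; rewrite mulrDl !mulrA.
have conjs f : sol f -> sol (fun x => (f x)^*%C).
  move=> /complex_solution_conj; rewrite /sol.
  rewrite (_ : (fun x => (f x / _)^*%C) = (fun x => (f x)^*%C / (Num.sqrt (zeta x))%:C))//.
  by apply/funext => x; rewrite -fmorphV conj_mul conj_real.
(* The factor [e0] moves the origin of phases from [x0] to 0; the null term gives the shape expected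
   by [comb]. *)
pose f1 x := e0 * F x + 0 * F x.
(* The combination that cancels the wave [e^{i sigma x}] on the left; by [W] the other wave then has
   coefficient 1. *)
pose f2 x := - (e0 * e0 * B)^*%C * f1 x + A * (f1 x)^*%C.
have s1 : sol f1 by exact: comb.
have s2 : sol f2 by apply: comb => //; exact: conjs.
have f1r x : x1 <= x -> f1 x = cis (sigma * x).
  by move=> xx; rewrite /f1 F1// shift mul0r addr0 mulrCA e01 mulr1.
have f1l x : x <= x0 -> f1 x = A * cis (sigma * x) + e0 * e0 * B * (cis (sigma * x))^*%C.
  move=> xx; rewrite /f1 F0// cisN shift conj_mul conjcK mul0r addr0.
  transitivity (A * cis (sigma * x) * (e0 * e0^*%C) + e0 * e0 * B * (cis (sigma * x))^*%C);
    first by ring.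
  by rewrite e01 mulr1.
have f2l x : x <= x0 -> f2 x = (cis (sigma * x))^*%C.
  move=> xx; rewrite /f2 f1l// conj_add !conj_mul conjcK.
  transitivity ((A * A^*%C - B * B^*%C * (e0 * e0^*%C) * (e0 * e0^*%C)) * (cis (sigma * x))^*%C);
    first by ring.
  by rewrite e01 !mulr1 W mul1r.
have f2r x : x1 <= x -> f2 x = - (e0 * e0 * B)^*%C * cis (sigma * x) + A * (cis (sigma * x))^*%C.
  by move=> xx; rewrite /f2 f1r.
pose d := pi / 2 / `|sigma|.
have d0 : 0 < d by rewrite !divr_gt0 ?pi_gt0// normr_gt0.
have mxE T1 T2 R1 R2 : T1 = 1 / A -> T2 = 1 / A -> R2 = e0 * e0 * B / A ->
    R1 = - (e0 * e0 * B)^*%C / A ->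
    mx2 T1 R2 R1 T2 = 1 / A *: mx2 1 (e0 * e0 * B) (- (e0^*%C * e0^*%C * B^*%C)) 1.
  move=> -> -> -> ->; apply/matrixP => i j; rewrite !mxE.
  by case: ifP => _; case: ifP => _; rewrite ?conj_mul; field.
split.
  move=> [g1 [g2 [[G1 g1r G2 g2l] [T1 [T2 [R1 [R2 [[T10 T20] g1l g2r ->]]]]]]]].
  (* Any point interior to the half-line on which [g1] is prescribed serves for uniqueness; [x1 + 1]
     is one. *)
  have eq1 x : g1 x = f1 x.
    apply/eqP; rewrite -subr_eq0; apply/eqP.
    apply: (uniq (fun x => g1 x - f1 x) (x1 + 1)).
      have := comb _ _ 1 (-1) ((solE _).1 G1) s1; rewrite /sol.
      rewrite (_ : (fun x => (1 * g1 x + _) / _) =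
        (fun x => (g1 x - f1 x) / (Num.sqrt (zeta x))%:C))//.
      by apply/funext => y; rewrite mul1r mulN1r.
    near=> y; have yx : x1 <= y.
      by apply/ltW; near: y; apply: lt_nbhsr; rewrite ltrDl.
    by rewrite g1r// f1r// cexp_wave subrr.
  have eq2 x : g2 x = f2 x.
    apply/eqP; rewrite -subr_eq0; apply/eqP.
    apply: (uniq (fun x => g2 x - f2 x) (x0 - 1)).
      have := comb _ _ 1 (-1) ((solE _).1 G2) s2; rewrite /sol.
      rewrite (_ : (fun x => (1 * g2 x + _) / _) =
        (fun x => (g2 x - f2 x) / (Num.sqrt (zeta x))%:C))//.
      by apply/funext => y; rewrite mul1r mulN1r.
    near=> y; have yx : y <= x0.
      by apply/ltW; near: y; apply: lt_nbhsl; lra.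
    by rewrite g2l// f2l// cexp_waveN subrr.
  (* Two expansions of the same function into plane waves on a half-line; comparing them at two
     points a quarter of a wavelength apart identifies the coefficients. *)
  have c1 x : x <= x0 -> (1 / T2 - A) * cis (sigma * x) +
      (R2 / T2 - e0 * e0 * B) * (cis (sigma * x))^*%C = 0.
    move=> xx; have := g1l x xx; rewrite eq1 f1l// cexp_wave cexp_waveN => h.
    by rewrite !mulrBl addrACA -h -opprD subrr.
  have c2 x : x1 <= x -> (R1 / T1 + (e0 * e0 * B)^*%C) * cis (sigma * x) +
      (1 / T1 - A) * (cis (sigma * x))^*%C = 0.
    move=> xx; have := g2r x xx; rewrite eq2 f2r// cexp_wave cexp_waveN => h.
    rewrite mulrDl mulrBl addrACA -h; ring.
  have l0 : x0 - d <= x0 by lra.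
  have l1 : x1 <= x1 + d by lra.
  have n0 : `|x0 - d - x0| = d by rewrite addrAC subrr add0r normrN gtr0_norm.
  have n1 : `|x1 + d - x1| = d by rewrite addrAC subrr add0r gtr0_norm.
  have [h1 h2] := wave_independence sigma_neq0 n0 (c1 x0 (lexx _)) (c1 (x0 - d) l0).
  have [h3 h4] := wave_independence sigma_neq0 n1 (c2 x1 (lexx _)) (c2 (x1 + d) l1).
  move/eqP: h1; rewrite subr_eq0 => /eqP h1; move/eqP: h2; rewrite subr_eq0 => /eqP h2.
  move/eqP: h3; rewrite addr_eq0 => /eqP h3; move/eqP: h4; rewrite subr_eq0 => /eqP h4.
  have T1E : T1 = 1 / A by rewrite -h4; field.
  have T2E : T2 = 1 / A by rewrite -h1; field.
  apply: mxE => //.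
  - by rewrite -h2 -h1; field.
  - by rewrite -h3 -h4; field.
move=> ->; exists f1, f2; split.
  split.
  - exact/solE.
  - by move=> x xx; rewrite f1r// cexp_wave.
  - exact/solE.
  - by move=> x xx; rewrite f2l// cexp_waveN.
exists (1 / A), (1 / A), (- (e0 * e0 * B)^*%C / A), (e0 * e0 * B / A); split.
- by rewrite mulf_neq0 ?oner_neq0 ?invr_neq0.
- by move=> x xx; rewrite f1l// cexp_wave cexp_waveN; field.
- by move=> x xx; rewrite f2r// cexp_wave cexp_waveN; field.
- by apply/esym/mxE.
Unshelve. all: by end_near. Qed.
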